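(* Let $\gamma$ be a (non-constant) periodic orbit of the unregularized system $X_H$ on the energy level $H=c$, with Floquet multipliers $\{1,1,\lambda_1,\lambda_2,\lambda_3,\lambda_4\}$. Let $\tilde\gamma$ be the corresponding periodic orbit of the Moser regularized system, regarded as a periodic orbit of the vector field $X_Q$ on (a neighborhood of $T^*S^3$ in) $\mathbb{R}^8$. Then the Floquet multipliers of $\tilde\gamma$ (the eigenvalues, with multiplicity, of the $8\times 8$ monodromy matrix of the flow of $X_Q$ along $\tilde\gamma$ over its period) are $$\{1,1,1,1,\lambda_1,\lambda_2,\lambda_3,\lambda_4\}.$$
   Context: Unregularized system: on $(\mathbf q,\mathbf p)\in\mathbb{R}^3\times\mathbb{R}^3$, $\mathbf q\ne0$, $$H=\tfrac12|\mathbf p|^2+p_1q_2-p_2q_1-\frac{g}{|\mathbf q|}+\tilde V(\mathbf q),$$ with $g\neq0$ constant and $\tilde V$ real analytic on an open set containing $0$. $X_H=(\partial_{\mathbf p}H,-\partial_{\mathbf q}H)$. Floquet multipliers of a $T$-periodic orbit are the eigenvalues of $d\phi^T$ at a point of the orbit, $\phi^t$ being the flow. Moser's transformation: put $(\mathbf x,\mathbf y)=(-\mathbf p,\mathbf q)$ and $$\xi_0=\tfrac{|\mathbf x|^2-1}{|\mathbf x|^2+1},\quad \xi_k=\tfrac{2x_k}{|\mathbf x|^2+1},\quad \eta_0=\mathbf x\cdot\mathbf y,\quad \eta_k=\tfrac{|\mathbf x|^2+1}{2}y_k-(\mathbf x\cdot\mathbf y)x_k\quad(k=1,2,3),$$ which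 maps into $T^*S^3=\{(\boldsymbol\xi,\boldsymbol\eta)\in\mathbb{R}^4\times\mathbb{R}^4: |\boldsymbol\xi|^2=1,\ \boldsymbol\xi\cdot\boldsymbol\eta=0\}$, with inverse $q_k=\eta_0\xi_k+(1-\xi_0)\eta_k$, $p_k=-\xi_k/(1-\xi_0)$. Moser regularized Hamiltonian for the energy $c$: $$Q(\boldsymbol\xi,\boldsymbol\eta)=\frac1{2g}\Big(1-(1-\xi_0)(c+\tfrac12)+(1-\xi_0)(\xi_2\eta_1-\xi_1\eta_2)+(1-\xi_0)\tilde V\Big)^2|\boldsymbol\eta|^2,$$ where $\tilde V$ is evaluated at $q_k=\eta_0\xi_k+(1-\xi_0)\eta_k$. The level $H=c$ corresponds to $Q=g/2$. Vector field on $\mathbb{R}^8$: with $f_1=|\boldsymbol\xi|^2-1$, $f_2=\boldsymbol\xi\cdot\boldsymbol\eta$, and for a function $f$ on $\mathbb{R}^8$ the canonical Hamiltonian vector field $\tilde X_f=(\partial_{\boldsymbol\eta}f,-\partial_{\boldsymbol\xi}f)$ and canonical Poisson bracket $\{\cdot,\cdot\}$, $$X_Q=\tilde X_Q-\frac{\{f_2,Q\}}{\{f_2,f_1\}}\tilde X_{f_1}-\frac{\{f_1,Q\}}{\{f_1,f_2\}}\tilde X_{f_2},$$ defined near $T^*S^3$; it is tangent to $T^*S^3$ and restricts there to the Hamiltonian vector field of $Q|_{T^*S^3}$. Corresponding orbit: $\tilde\gamma(\tau)$ is the image of $\gamma(t)$ under Moser's transformation, with time reparametrized by $dt=|\mathbf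 q|\,d\tau$; it is a periodic orbit of $X_Q$ in $\{Q=g/2\}$. *)

(* Defs.v *)
From HB Require Import structures.
From mathcomp Require Import all_boot all_order all_algebra.
From mathcomp Require Import complex.
From mathcomp Require Import all_classical all_reals all_analysis.

Set Implicit Arguments.
Unset Strict Implicit.
Unset Printing Implicit Defensive.

Import Order.TTheory GRing.Theory Num.Theory.
Import numFieldNormedType.Exports.

Local Open Scope classical_set_scope.
Local Open Scope ring_scope.

Section Euclidean.
Context {R : realType}.

Definition dotv n (u v : 'rV[R]_n) : R := \sum_i u 0 i * v 0 i.

(* The library norm `|u| on ['rV[R]_n] is the sup norm. *)
Definition enorm n (u : 'rV[R]_n) : R := Num.sqrt (dotv u u).

End Euclidean.

Section RealAnalytic.
Context {R : realType}.

(* A family indexed by multi-indices ['I_n -> nat], summed over the box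
   [alpha i < N]. *)
Definition box_sum n (F : ('I_n -> nat) -> R) (N : nat) : R :=
  \sum_(alpha : {ffun 'I_n -> 'I_N}) F (fun i => alpha i : nat).

Definition multi_sum n (F : ('I_n -> nat) -> R) (s : R) : Prop :=
  cvgn (box_sum (fun alpha => `|F alpha|)) /\ box_sum F @ \oo --> s.

Definition real_analytic_at n (f : 'rV[R]_n -> R) (a : 'rV[R]_n) : Prop :=
  exists (c : ('I_n -> nat) -> R) (r : R), 0 < r /\
    forall h : 'rV[R]_n, (forall i, `|h 0 i| < r) ->
      multi_sum (fun alpha => c alpha * \prod_i h 0 i ^+ alpha i) (f (a + h)).

Definition real_analytic_on n (D : set 'rV[R]_n) (f : 'rV[R]_n -> R) : Prop :=
  forall a, D a -> real_analytic_at f a.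

End RealAnalytic.

Section Flow.
Context {R : realType} {n : nat}.
Implicit Types (X : 'rV[R]_n -> 'rV[R]_n) (U : set 'rV[R]_n).

Definition is_solution_at X U (u : R -> 'rV[R]_n) (t : R) : Prop :=
  U (u t) /\ is_derive t (1 : R) u (X (u t)).

(* Vector fields are total functions, meaningful only on an open set [U].
   [flow X U t z] (for [0 <= t]) is the value at time [t] of the solution that
   starts at [z] and stays in [U] during [[0, t]]; it is a default value if
   there is no such solution. *)
Definition flow X U (t : R) (z : 'rV[R]_n) : 'rV[R]_n :=
  get [set w | exists u : R -> 'rV[R]_n,
    [/\ u 0 = z, u t = w &
        forall s, 0 <= s <= t -> is_solution_at X U u s]].

(* [T] need not be the minimal period. *)
Definition periodic_orbit X U (gamma : R -> 'rV[R]_n) (T : R) : Prop :=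
  [/\ 0 < T, forall t, is_solution_at X U gamma t,
      forall t, gamma (t + T) = gamma t & exists t, gamma t != gamma 0].

(* The eigenvalues of the derivative of the time-[T] map at [z], with algebraic
   multiplicity, are the elements of the list [s]. The Jacobian acts on row
   vectors from the right, i.e. it is the transpose of the usual matrix; this
   does not affect the characteristic polynomial. *)
Definition floquet_multipliers X U (z : 'rV[R]_n) (T : R) (s : seq R[i]) :
    Prop :=
  differentiable (flow X U T) z /\
  map_poly (real_complex R) (char_poly ('J (flow X U T) z)) =
    \prod_(l <- s) ('X - l%:P).

End Flow.

Section Hamiltonian.
Context {R : realType} {n : nat}.
Implicit Types (f g : 'rV[R]_(n + n) -> R) (z : 'rV[R]_(n + n)).

(* A phase point is [row_mx x y] with positions [x] and momenta [y]. *)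
Definition dpos f z : 'rV[R]_n :=
  \row_i 'D_(row_mx (delta_mx 0 i) 0) f z.
Definition dmom f z : 'rV[R]_n :=
  \row_i 'D_(row_mx 0 (delta_mx 0 i)) f z.

Definition ham_field f z : 'rV[R]_(n + n) := row_mx (dmom f z) (- dpos f z).

Definition poisson f g z : R :=
  dotv (dpos f z) (dmom g z) - dotv (dmom f z) (dpos g z).

End Hamiltonian.

Section Unregularized.
Context {R : realType}.
Variables (g : R) (V : 'rV[R]_3 -> R).

Definition Ham (z : 'rV[R]_(3 + 3)) : R :=
  let q := lsubmx z in let p := rsubmx z in
  2^-1 * enorm p ^+ 2 + p 0 0 * q 0 1 - p 0 1 * q 0 0
    - g / enorm q + V q.

(* [D] is the domain on which the potential [V] is analytic. *)
Definition Ham_dom (D : set 'rV[R]_3) : set 'rV[R]_(3 + 3) :=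
  [set z | lsubmx z != 0 /\ D (lsubmx z)].

End Unregularized.

Section Moser.
Context {R : realType}.

(* A vector of R^4 has components 0, 1, 2, 3; [vec3 xi] = (xi_1, xi_2, xi_3). *)
Definition vec3 (xi : 'rV[R]_4) : 'rV[R]_3 := rsubmx (xi : 'rV[R]_(1 + 3)).

Definition cons4 (a : R) (v : 'rV[R]_3) : 'rV[R]_4 :=
  row_mx (a%:M : 'rV[R]_1) v.

Definition moser (z : 'rV[R]_(3 + 3)) : 'rV[R]_(4 + 4) :=
  let x := - rsubmx z in let y := lsubmx z in
  let n2 := enorm x ^+ 2 in
  row_mx (cons4 ((n2 - 1) / (n2 + 1)) ((2 / (n2 + 1)) *: x))
         (cons4 (dotv x y) (((n2 + 1) / 2) *: y - dotv x y *: x)).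

Definition moser_q (w : 'rV[R]_(4 + 4)) : 'rV[R]_3 :=
  let xi := lsubmx w in let eta := rsubmx w in
  eta 0 0 *: vec3 xi + (1 - xi 0 0) *: vec3 eta.

Definition Qreg (g c : R) (V : 'rV[R]_3 -> R) (w : 'rV[R]_(4 + 4)) : R :=
  let xi := lsubmx w in let eta := rsubmx w in
  (2 * g)^-1 *
  (1 - (1 - xi 0 0) * (c + 2^-1)
     + (1 - xi 0 0) * (xi 0 2 * eta 0 1 - xi 0 1 * eta 0 2)
     + (1 - xi 0 0) * V (moser_q w)) ^+ 2 * enorm eta ^+ 2.

Definition f1 (w : 'rV[R]_(4 + 4)) : R := enorm (lsubmx w) ^+ 2 - 1.
Definition f2 (w : 'rV[R]_(4 + 4)) : R := dotv (lsubmx w) (rsubmx w).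

Definition constrained_field (Q : 'rV[R]_(4 + 4) -> R) (w : 'rV[R]_(4 + 4)) :
    'rV[R]_(4 + 4) :=
  ham_field Q w
  - (poisson f2 Q w / poisson f2 f1 w) *: ham_field f1 w
  - (poisson f1 Q w / poisson f1 f2 w) *: ham_field f2 w.

Definition Qreg_dom (D : set 'rV[R]_3) : set 'rV[R]_(4 + 4) :=
  [set w | poisson f1 f2 w != 0 /\ D (moser_q w)].

(* [tm] is the physical time t as a function of the regularized time tau, with
   dt = |q| dtau; the period [T] becomes the period [T'] in tau. *)
Definition regularized_orbit (gamma : R -> 'rV[R]_(3 + 3)) (T : R)
    (gamma' : R -> 'rV[R]_(4 + 4)) (T' : R) : Prop :=
  exists tm : R -> R,
    [/\ tm 0 = 0, tm T' = T,
        forall tau, is_derive tau (1 : R) tm (enorm (lsubmx (gamma (tm tau)))) &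
        forall tau, gamma' tau = moser (gamma (tm tau))].

End Moser.

(* Main.v *)
From HB Require Import structures.
Require Import Defs.
From mathcomp Require Import all_boot all_order all_algebra.
From mathcomp Require Import complex.
From mathcomp Require Import all_classical all_reals all_analysis.
From mathcomp Require Import ring lra.
Import Order.TTheory GRing.Theory Num.Theory.
Import numFieldNormedType.Exports.
Set Implicit Arguments.
Unset Strict Implicit.
Unset Printing Implicit Defensive.
Local Open Scope classical_set_scope.
Local Open Scope ring_scope.

(** On [q != 0] one has [Qreg \o moser = (|q| (H - c) + g)^2 / (2 g)], and the
    Moser map, being symplectic onto T*S^3, carries the Hamiltonian field [Y] of
    this function on R^6 to [constrained_field]. As [f1] and [f2] are first
    integrals of the latter, the 8x8 monodromy matrix is block triangular, with
    the monodromy matrix [B] of [Y] and a 2x2 identity block on the diagonal.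

    On [H = c] the field [Y] equals [|q| X_H]; comparing the variational
    equations of [Y] and [X_H] shows that on [ker dH] the matrix [B] differs
    from the monodromy matrix [A] of [X_H] by multiples of [X_H]. Both matrices
    fix [X_H] and [dH], so they agree on the graded pieces of the flag
    <X_H> < ker dH < R^6 and have the same characteristic polynomial.

    The flow of [constrained_field] on a neighbourhood of the orbit in R^8, and
    its differentiability, come from Picard iteration and Gronwall's inequality
    for C^1 fields. *)

(** * Derivatives and norms of row vectors *)

Section Basics.
Context {R : realType}.

(** [Y] is the Hamiltonian field of all of [Qreg \o moser], so that its conjugacy to
    [constrained_field] also holds off the level [H = c]; a monodromy matrix differentiates in
    directions that leave the level. The price is that [Y] is tied to [X_H] only on the level:
    transversally to [ker dH] the two monodromy matrices share nothing but the fact that both fix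
    [dH], hence a comparison along a flag instead of a similarity. Inside [ker dH], the fixed time
    [T'] corresponds to different physical times on neighbouring orbits, and this delay is the
    multiple of [X_H].

    T*S^3 is never treated as a manifold. Its tangent space at a point of the orbit is the row space
    of the Jacobian of [moser], and the two additional multipliers 1 live on the quotient, which is
    dual to [df1] and [df2]. For this [f1] and [f2] must be conserved on a full neighbourhood in
    R^8, not only on T*S^3.

    [flow] is a partial map made total by choice, so an identity between flows has to be established
    for all initial points near the orbit before it can be differentiated. *)

Lemma normZ_sub_le (V : normedModType R) (a d : V) (h e : R) : h != 0 ->
  (`|a - h *: d| <= e * `|h|) = (`|d - h^-1 *: a| <= e).
Proof.
move=> h0; rewrite -ler_pdivrMr ?normr_gt0// -normfV mulrC -normrZ.
by rewrite scalerBr scalerA mulVf// scale1r distrC.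
Qed.

(** The increment form includes [h = 0] and has no quotient, so it accepts norm estimates directly;
    restriction to lines, rescaling of the direction and limits of sequences go through it. *)
Lemma is_derive_epsP (V W : normedModType R) (f : V -> W) x v d :
  is_derive x v f d <->
  forall e, 0 < e -> exists2 r, 0 < r & forall h : R, `|h| < r ->
    `|f (x + h *: v) - f x - h *: d| <= e * `|h|.
Proof.
split=> [[fxv <-] e e0|H].
  move/cvgrPdist_le/(_ e e0): (fxv).
  case=> r /= r0 Hr; exists r => // h hr.
  have [->|h0] := eqVneq h 0.
    by rewrite !scale0r addr0 !subrr !normr0 mulr0.
  have := Hr h; rewrite /ball/= sub0r normrN => /(_ hr h0).
  by rewrite normZ_sub_le// [x + _]addrC.
have fl : h^-1 *: ((f \o shift x) (h *: v) - f x) @[h --> 0^'] --> d.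
  apply/cvgrPdist_le => e e0; have [r r0 Hr] := H e e0.
  exists r => //= h; rewrite /ball/= sub0r normrN => hr h0.
  by have := Hr h hr; rewrite normZ_sub_le// [x + _]addrC.
by apply: DeriveDef; [apply/cvg_ex; exists d | exact: cvg_lim].
Qed.

Lemma differentiable_eps (V W : normedModType R) (f : V -> W) x
    (L : {linear V -> W}) :
  continuous L ->
  (forall e, 0 < e -> exists2 r, 0 < r & forall h, `|h| < r ->
    `|f (x + h) - f x - L h| <= e * `|h|) ->
  differentiable f x /\ 'd f x = L :> (V -> W).
Proof.
move=> cL H.
have E : f \o shift x = cst (f x) + L +o_ 0 id.
  apply/eqaddoP => e e0; have [r r0 Hr] := H e e0.
  apply/nbhs_ballP; exists r => //= h.
  rewrite -ball_normE /= sub0r normrN => /Hr.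
  by rewrite !fctE /= opprD addrA [h + x]addrC.
have dE := diff_unique cL E; split => //.
by apply/diff_locallyP; rewrite dE.
Qed.

Lemma is_derive_line (V W : normedModType R) (f : V -> W) x v d (t : R) :
  is_derive (x + t *: v) v f d -> is_derive t 1 (fun s : R => f (x + s *: v)) d.
Proof.
move=> /is_derive_epsP H; apply/is_derive_epsP => e /H[r r0 Hr].
exists r => // h /Hr; rewrite (_ : _ + h *: v = x + (t + h *: 1) *: v)//.
by rewrite scalerDl addrA [h *: 1]mulr1.
Qed.

Lemma is_deriveZv (V W : normedModType R) (f : V -> W) x v d (k : R) :
  is_derive x v f d -> is_derive x (k *: v) f (k *: d).
Proof.
have [->|k0] := eqVneq k 0; first by rewrite !scale0r => _; apply: is_derive0.
move=> /is_derive_epsP H; apply/is_derive_epsP => e e0.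
have k1 : 0 < `|k| by rewrite normr_gt0.
have [|r r0 Hr] := H (e / `|k|); first exact: divr_gt0.
exists (r / `|k|); first exact: divr_gt0.
move=> h; rewrite ltr_pdivlMr// -normrM => /Hr; rewrite !scalerA normrM.
by rewrite (_ : e / `|k| * _ = e * `|h|)//; field; rewrite gt_eqF.
Qed.

Lemma is_derive_comp_diff (V W : normedModType R) (u : R -> V) (f : V -> W)
    (t : R) du :
  is_derive t 1 u du -> differentiable f (u t) ->
  is_derive t 1 (f \o u) ('d f (u t) du).
Proof.
move=> [u1 <-] fd; have /derivable1_diffP ud := u1.
have cd : differentiable (f \o u) t by exact: differentiable_comp.
apply: DeriveDef; first exact/derivable1_diffP.
by rewrite !deriveE// diff_comp.
Qed.

Lemma is_derive_continuous (V : normedModType R) (u : R -> V) (t : R) du :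
  is_derive t 1 u du -> {for t, continuous u}.
Proof.
by move=> [/derivable1_diffP ud _]; exact: differentiable_continuous.
Qed.

Lemma is_derive_row (V : normedModType R) n (u : V -> 'rV[R]_n) x v du :
  is_derive x v u du <-> forall i, is_derive x v (fun y => u y 0 i) (du 0 i).
Proof.
split=> [[u1 ud] i|H].
  apply: DeriveDef; first by move/derivable_mxP: u1.
  by rewrite -ud derive_mx// mxE.
have u1 : derivable u x v.
  by apply/derivable_mxP => i j; rewrite ord1; exact: ex_derive.
apply: DeriveDef => //; apply/rowP => i; rewrite derive_mx// mxE.
exact: derive_val.
Qed.

Lemma norm_row_le n (v : 'rV[R]_n) e : 0 <= e ->
  (`|v| <= e) <-> (forall i, `|v 0 i| <= e).
Proof.
move=> e0; rewrite [`|v|]/Num.Def.normr/= mx_normrE; split.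
  by move=> /bigmax_leP[_ H] i; exact: (H (0, i)).
by move=> H; apply/bigmax_leP; split => // -[i j] _ /=; rewrite ord1.
Qed.

Lemma norm_row_lt n (v : 'rV[R]_n) e : 0 < e ->
  (`|v| < e) <-> (forall i, `|v 0 i| < e).
Proof.
move=> e0; rewrite [`|v|]/Num.Def.normr/= mx_normrE; split.
  by move=> /bigmax_ltP[_ H] i; exact: (H (0, i)).
by move=> H; apply/bigmax_ltP; split => // -[i j] _ /=; rewrite ord1.
Qed.

Lemma rowB n (a b : 'rV[R]_n) i : (a - b) 0 i = a 0 i - b 0 i.
Proof. by rewrite !mxE. Qed.

Lemma norm_coord_le n (v : 'rV[R]_n) i : `|v 0 i| <= `|v|.
Proof. by have /norm_row_le := lexx `|v|; apply. Qed.

Lemma continuous_rowP (T : topologicalType) n (u : T -> 'rV[R]_n) (t : T) :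
  {for t, continuous u} <-> forall i, {for t, continuous (fun s => u s 0 i)}.
Proof.
split=> [H i|H].
  apply: (@continuous_comp _ _ _ u (fun M : 'rV_n => M 0 i) t H).
  exact: coord_continuous.
apply/cvgrPdist_le => e e0; near=> s.
apply/norm_row_le; first exact: ltW.
move=> i; rewrite !mxE; move: i; near: s; apply: filter_forall => i.
by have /cvgrPdist_le/(_ e e0) := H i.
Unshelve. all: by end_near. Qed.

Lemma continuous_epsP (V W : normedModType R) (f : V -> W) x :
  {for x, continuous f} <-> forall e, 0 < e -> exists2 r, 0 < r &
    forall y, `|y - x| < r -> `|f y - f x| <= e.
Proof.
split=> [/cvgrPdist_le H e /H/nbhs_ballP[r /= r0 Hr]|H].
  exists r => // y yr; rewrite distrC; apply: Hr.
  by rewrite -ball_normE /= distrC.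
apply/cvgrPdist_le => e /H[r r0 Hr]; apply/nbhs_ballP; exists r => //= y.
by rewrite -ball_normE /= distrC => /Hr; rewrite distrC.
Qed.

Lemma norm_mulmx_le n m (M : 'M[R]_(n, m)) (v : 'rV[R]_n) :
  `|v *m M| <= (\sum_i \sum_j `|M i j|) * `|v|.
Proof.
have s0 i : 0 <= \sum_j `|M i j| by rewrite sumr_ge0.
apply/norm_row_le; first by rewrite mulr_ge0// sumr_ge0.
move=> j; rewrite mxE mulr_suml (le_trans (ler_norm_sum _ _ _))// ler_sum// => i _.
rewrite normrM mulrC ler_pM//; last exact: norm_coord_le.
by rewrite (bigD1 j)//= lerDl sumr_ge0.
Qed.

Lemma mulmx_row_continuous n m (M : 'M[R]_(n, m)) :
  continuous (mulmxr M : 'rV[R]_n -> 'rV[R]_m).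
Proof.
move=> x; apply/continuous_epsP => e e0.
set C := \sum_i \sum_j `|M i j|.
have C0 : 0 <= C by rewrite sumr_ge0// => i _; rewrite sumr_ge0.
have C1 : 0 < C + 1 by rewrite ltr_wpDl.
exists (e / (C + 1)); first exact: divr_gt0.
move=> y; rewrite ltr_pdivlMr// => /ltW yx /=; rewrite -mulmxBl.
rewrite (le_trans (norm_mulmx_le _ _))// (le_trans _ yx)// mulrC ler_wpM2l//.
by rewrite lerDl.
Qed.

Lemma continuous_sum (T : topologicalType) (I : Type) (r : seq I)
    (f : I -> T -> R) (t : T) :
  (forall i, {for t, continuous (f i)}) ->
  {for t, continuous (fun x => \sum_(i <- r) f i x)}.
Proof.
move=> cf; elim: r => [|i r IH].
  rewrite (_ : (fun _ => _) = cst 0); first exact: cst_continuous.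
  by apply/funext => x; rewrite big_nil.
rewrite (_ : (fun _ => _) = f i \+ (fun x => \sum_(i <- r) f i x)).
  by apply: continuousD; [exact: cf|].
by apply/funext => x; rewrite big_cons.
Qed.

End Basics.

(** * Mean value and Gronwall estimates *)

Section Calculus.
Context {R : realType}.

Lemma mean_value (f f' : R -> R) (a b : R) : a <= b ->
  (forall t, a <= t <= b -> is_derive t 1 f (f' t)) ->
  exists2 c, a <= c <= b & f b - f a = f' c * (b - a).
Proof.
move=> ab fd; have [|| c cab E] := @MVT_segment R f f' a b ab.
- by move=> t; rewrite in_itv/= => /andP[/ltW ? /ltW ?]; apply: fd; apply/andP.
- apply: derivable_within_continuous => t; rewrite in_itv/= => tab.
  exact: (@ex_derive _ _ _ _ _ _ _ (fd t tab)).
- by exists c.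
Qed.

Lemma mean_value_dir (f : R -> R) (f' : R -> R) (t h : R) :
  (forall s, `|s - t| <= `|h| -> is_derive s 1 f (f' s)) ->
  exists2 c, `|c - t| <= `|h| & f (t + h) - f t = f' c * h.
Proof.
move=> fd; have [h0|/ltW h0] := leP 0 h.
- have [|s|c /andP[c1 c2] ->] := @mean_value f f' t (t + h).
  + by rewrite lerDl.
  + move=> /andP[s1 s2]; apply: fd; rewrite !ger0_norm ?subr_ge0//; lra.
  + by exists c; [rewrite !ger0_norm ?subr_ge0//; lra|congr (_ * _); ring].
- have [|s|c /andP[c1 c2] E] := @mean_value f f' (t + h) t.
  + by rewrite gerDl.
  + move=> /andP[s1 s2]; apply: fd; rewrite !ler0_norm ?subr_le0//; lra.
  + exists c; [rewrite !ler0_norm ?subr_le0//; lra|].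
    by rewrite -opprB E; ring.
Qed.

Lemma le_lim (u : nat -> R) (l M : R) :
  u @ \oo --> l -> (\forall k \near \oo, u k <= M) -> l <= M.
Proof. by move=> ul uM; apply: (closed_cvg (fun y => y <= M)) ul => //; exact: closed_le. Qed.

(** The mean value theorem writes the increment of [f_ k] as [f'_ k c * h], with [c] depending on
    [k]. Uniform closeness of [f'_ k] to [g] and continuity of [g] bound the error independently of
    [c], after which [k] goes to infinity. Both the Picard limit and power series rest on this. *)
Lemma is_derive_unif_limit (f_ f'_ : nat -> R -> R) (f g : R -> R) (eps : nat -> R)
    (t r : R) : 0 < r ->
  (forall k s, `|s - t| < r -> is_derive s 1 (f_ k) (f'_ k s)) ->
  (forall k s, `|s - t| < r -> `|f'_ k s - g s| <= eps k) ->
  eps @ \oo --> 0 ->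
  (forall s, `|s - t| < r -> f_ ^~ s @ \oo --> f s) ->
  {for t, continuous g} ->
  is_derive t 1 f (g t).
Proof.
move=> r0 fd fg eps0 ff /continuous_epsP gc; apply/is_derive_epsP => e e0.
have e2 : 0 < e / 2 by rewrite divr_gt0.
have [r1 r10 gr] := gc _ e2; exists (Num.min r r1); first by rewrite lt_min r0.
move=> h; rewrite lt_min => /andP[hr hr1]; rewrite [h *: 1]mulr1.
have tht : `|t + h - t| < r by rewrite addrAC subrr add0r.
have tt : `|t - t| < r by rewrite subrr normr0.
have cv : (fun k => `|f_ k (t + h) - f_ k t - h *: g t|) @ \oo -->
    `|f (t + h) - f t - h *: g t|.
  by apply: cvg_norm; apply: cvgB; [apply: cvgB; exact: ff|exact: cvg_cst].
apply: (le_lim cv).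
move/cvgrPdist_le : eps0 => /(_ _ e2); apply: filterS => k.
rewrite sub0r normrN => ek.
have [s sh|c ch ->] := @mean_value_dir (f_ k) (f'_ k) t h.
  by apply: fd; exact: le_lt_trans hr.
rewrite [h *: _]mulrC -mulrBl normrM ler_wpM2r//.
have -> : f'_ k c - g t = (f'_ k c - g c) + (g c - g t) by ring.
rewrite (le_trans (ler_normD _ _))// (splitr e) lerD//.
  rewrite (le_trans (fg _ _ _))//; first exact: le_lt_trans hr.
  by rewrite (le_trans (ler_norm _)).
by apply: gr; exact: le_lt_trans hr1.
Qed.

Lemma is_derive_big_sum (V : normedModType R) (I : Type) (r : seq I) (h : I -> V -> R)
    (dh : I -> R) x v :
  (forall i, is_derive x v (h i) (dh i)) ->
  is_derive x v (fun s => \sum_(i <- r) h i s) (\sum_(i <- r) dh i).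
Proof.
move=> H; elim: r => [|i r IH].
  rewrite big_nil (_ : (fun s => _) = cst 0); first exact: is_derive_cst.
  by apply/funext => s; rewrite big_nil.
rewrite big_cons (_ : (fun s => _) = h i \+ (fun s => \sum_(i <- r) h i s)).
  exact: is_deriveD.
by apply/funext => s; rewrite big_cons.
Qed.

Lemma ge_derive_le (f f' : R -> R) (a b : R) : a <= b ->
  (forall t, a <= t <= b -> is_derive t 1 f (f' t)) ->
  (forall t, a <= t <= b -> f' t <= 0) -> f b <= f a.
Proof.
move=> ab fd f0; have [c cab E] := mean_value ab fd.
by rewrite -subr_le0 E mulr_le0_ge0 ?f0// subr_ge0.
Qed.

(** [C] is chosen before the curve, from [n], [L] and [T] alone, so one constant serves all
    neighbouring solutions at once. The forcing [e] enters linearly, as the differentiability of the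
    flow requires. *)
Lemma gronwall n (L T : R) : 0 <= L -> 0 <= T ->
  exists2 C, 0 <= C & forall (w w' : R -> 'rV[R]_n) e, 0 <= e ->
    (forall t, 0 <= t <= T -> is_derive t 1 w (w' t)) ->
    (forall t, 0 <= t <= T -> `|w' t| <= L * `|w t| + e) ->
    forall t, 0 <= t <= T -> `|w t| <= C * (`|w 0| + e).
Proof.
(* [K] comes from [2 |w| (L |w| + e) <= (2 L + 1) |w|^2 + e^2], and [N] from bounding every
   coordinate by the sup norm before summing. *)
move=> L0 T0; pose N := n%:R : R; pose K : R := N * (2 * L + 1).
have N0 : 0 <= N by rewrite ler0n.
have K0 : 0 <= K by rewrite mulr_ge0//; lra.
pose M := N * (1 + T) * expR (K * T).
have M0 : 0 <= M by rewrite mulr_ge0 ?expR_ge0// mulr_ge0//; lra.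
exists (Num.sqrt M); first exact: sqrtr_ge0.
move=> w w' e e0 wd wl t /andP[t0 tT].
(* The Euclidean energy [E] is differentiable, unlike the sup norm, and
   satisfies [E' <= K E + N e^2]. *)
pose E s := \sum_i w s 0 i ^+ 2.
pose E' s := \sum_i 2 * w s 0 i * w' s 0 i.
have Ed s : 0 <= s <= T -> is_derive s 1 E (E' s).
  move=> /wd/is_derive_row ws; apply: is_derive_big_sum => i.
  have := ws i => {}ws; apply: is_derive_eq.
  by rewrite /GRing.scale/=; ring.
have normE s : `|w s| ^+ 2 <= E s.
  rewrite -[E s]sqr_sqrtr; last by rewrite sumr_ge0// => i _; rewrite sqr_ge0.
  rewrite ler_sqr ?nnegrE ?sqrtr_ge0//; apply/norm_row_le; first exact: sqrtr_ge0.
  move=> i; rewrite -sqrtr_sqr ler_sqrt; last by rewrite sumr_ge0// => j _; rewrite sqr_ge0.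
  by rewrite /E (bigD1 i)//= lerDl sumr_ge0// => j _; rewrite sqr_ge0.
have sumN (x : R) : \sum_(i < n) x = N * x by rewrite sumr_const card_ord mulr_natl.
have E'le s : 0 <= s <= T -> E' s <= K * E s + N * e ^+ 2.
  move=> sT; apply: (@le_trans _ _ (N * (2 * `|w s| * (L * `|w s| + e)))).
    rewrite -sumN ler_sum// => i _; rewrite (le_trans (ler_norm _))// !normrM.
    rewrite [`|2|]ger0_norm// ler_pM ?mulr_ge0//.
      by rewrite ler_pM2l//; exact: norm_coord_le.
    by rewrite (le_trans (norm_coord_le _ _))// wl.
  apply: (@le_trans _ _ (N * ((2 * L + 1) * `|w s| ^+ 2 + e ^+ 2))).
    by rewrite ler_wpM2l//; have := sqr_ge0 (`|w s| - e); lra.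
  by rewrite mulrDr lerD2r mulrA ler_wpM2l.
(* Integrating factor. As it is at most 1 for [s >= 0], the forcing contributes at most
   [N * e ^+ 2 * s], and [G] is nonincreasing. *)
pose G s := E s * expR (- (K * s)) - N * e ^+ 2 * s.
have : G t <= G 0.
  pose G' s := E' s * expR (- (K * s)) - K * E s * expR (- (K * s)) - N * e ^+ 2.
  apply: (@ge_derive_le G G' 0 t t0) => s /andP[s0 st];
    have sT : 0 <= s <= T by rewrite s0 (le_trans st).
    have Es := Ed s sT.
    have x1 : is_derive s 1 (fun s : R => - (K * s)) (- K).
      by apply: is_derive_eq; rewrite /GRing.scale/=; ring.
    have x2 : is_derive s 1 (fun s : R => expR (- (K * s))) (expR (- (K * s)) * - K).
      exact: (@is_derive1_comp _ expR (fun s : R => - (K * s))).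
    rewrite /G' /G; apply: is_derive_eq.
    rewrite /GRing.scale/=; ring.
  rewrite /G'; have := E'le s sT => E'l.
  set x := expR _; have x0 : 0 <= x by exact: expR_ge0.
  have x1 : x <= 1 by rewrite /x -[leRHS]expR0 ler_expR lerNl oppr0 mulr_ge0.
  have h1 : (E' s - K * E s) * x <= N * e ^+ 2 * x by rewrite ler_wpM2r// lerBlDl.
  have h2 : N * e ^+ 2 * x <= N * e ^+ 2 * 1 by rewrite ler_wpM2l// mulr_ge0// sqr_ge0.
  by rewrite -mulrBl; lra.
rewrite /G mulr0 oppr0 expR0 mulr1 mulr0 subr0 => Gt.
have {Gt}Et : E t <= (E 0 + N * e ^+ 2 * t) * expR (K * t).
  by rewrite -ler_pdivrMr ?expR_gt0// -expRN; lra.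
rewrite -[_ * _]ger0_norm; last by rewrite mulr_ge0 ?sqrtr_ge0// addr_ge0.
rewrite -[leLHS]ger0_norm// -ler_sqr ?nnegrE// !real_normK ?num_real//.
rewrite exprMn sqr_sqrtr// (le_trans (normE t))// (le_trans Et)//.
have E0 : E 0 <= N * `|w 0| ^+ 2.
  rewrite -sumN ler_sum// => i _.
  by rewrite -[w 0 0 i ^+ 2]ger0_norm ?sqr_ge0// normrX ler_sqr ?nnegrE// norm_coord_le.
have -> : M * (`|w 0| + e) ^+ 2 = (N * (1 + T) * (`|w 0| + e) ^+ 2) * expR (K * T).
  by rewrite /M; ring.
rewrite ler_pM ?expR_ge0//.
- rewrite addr_ge0 ?sumr_ge0//; first by move=> i _; exact: sqr_ge0.
  by rewrite !mulr_ge0// sqr_ge0.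
- apply: (@le_trans _ _ (N * (`|w 0| ^+ 2 + e ^+ 2 * T))).
    rewrite mulrDr lerD// -mulrA ler_wpM2l// ler_wpM2l// sqr_ge0//.
  rewrite -mulrA ler_wpM2l//.
  have h1 := normr_ge0 (w 0); set x := `|w 0| in h1 *.
  have h2 : 0 <= x * e by exact: mulr_ge0.
  have h3 : 0 <= x ^+ 2 * T by rewrite mulr_ge0// sqr_ge0.
  have h4 : 0 <= x * e * T by rewrite mulr_ge0.
  by have := sqr_ge0 e; nra.
- by rewrite ler_expR ler_wpM2l.
Qed.

End Calculus.

(** * Picard iteration *)

Section Picard.
Context {R : realType}.

(** The sign convention for [t < 0] makes this an antiderivative on the whole line, so that Picard
    iterates exist for negative times too. *)
Definition primitive (f : R -> R) (t : R) : R :=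
  if 0 <= t then \int[lebesgue_measure]_(s in `[0, t]) f s
  else - \int[lebesgue_measure]_(s in `[t, 0]) f s.

Lemma primitive0 f : primitive f 0 = 0.
Proof. by rewrite /primitive lexx set_itv1 Rintegral_set1. Qed.

Lemma is_derive_primitive (f : R -> R) (t : R) : continuous f ->
  is_derive t 1 (primitive f) (f t).
Proof.
(* With a base point [a] below both [t] and 0 the case split disappears: near [t] the primitive is a
   difference of two integrals starting at [a], also when [t = 0]. *)
move=> fc; pose a := Num.min t 0 - 1.
have at0 : a < t.
  rewrite /a; have : Num.min t 0 <= t by rewrite ge_min lexx.
  lra.
have a0 : a < 0.
  rewrite /a; have : Num.min t 0 <= 0 by rewrite ge_min lexx orbT.
  lra.
have fi b c : lebesgue_measure.-integrable `[b, c] (EFin \o f).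
  apply: continuous_compact_integrable; first exact: segment_compact.
  exact: continuous_subspaceT.
have E s : a < s -> primitive f s =
    \int[lebesgue_measure]_(x in `[a, s]) f x - \int[lebesgue_measure]_(x in `[a, 0]) f x.
  move=> as_; have obnd b c : lebesgue_measure.-integrable `]b, c] (EFin \o f).
    apply: integrableS (fi b c) => //; exact: subset_itv_oc_cc.
  rewrite /primitive; case: leP => s0.
    rewrite (@Rintegral_itvB _ f (BLeft a) (BRight s) 0)//; first by rewrite Rintegral_itv_obnd_cbnd.
    by rewrite bnd_simp ltW.
  rewrite -opprB (@Rintegral_itvB _ f (BLeft a) (BRight 0) s)//; first by rewrite Rintegral_itv_obnd_cbnd.
  - by rewrite bnd_simp ltW.
  - by rewrite bnd_simp ltW.
have tt1 : t < t + 1 by rewrite ltrDl.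
have [dG G'] := @continuous_FTC1_closed _ f a t (t + 1) tt1 (fi _ _) at0 (fc t).
move: dG G'; set G := fun s => _ => dG G'.
have Gd : is_derive t 1 G (f t).
  by rewrite -G' derive1E; exact: (derivableP dG).
have Gd1 : is_derive t 1 (fun s => G s - G 0) (f t).
  by apply: is_derive_eq; rewrite subr0.
apply: near_eq_is_derive Gd1.
near=> s; rewrite E//; near: s; exact: lt_nbhsr.
Unshelve. all: by end_near. Qed.

(** On [t >= 0] both [f - B] and [- f - B] are nonincreasing; negative times are reflected. The
    bound on the derivative is thus integrated through an antiderivative [B] in closed form, which
    suits the exponential majorant of the Picard step. *)
Lemma le_abs_primitive (f f' B b : R -> R) (t : R) :
  (forall s : R, `|s| <= `|t| -> is_derive s 1 f (f' s)) ->
  (forall s : R, is_derive s 1 B (b s)) ->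
  (forall s, `|s| <= `|t| -> `|f' s| <= b `|s|) ->
  `|f t - f 0| <= B `|t| - B 0.
Proof.
have main (g g' : R -> R) (x : R) : 0 <= x ->
    (forall s : R, 0 <= s <= x -> is_derive s 1 g (g' s)) ->
    (forall s : R, is_derive s 1 B (b s)) ->
    (forall s, 0 <= s <= x -> g' s <= b s) -> g x - g 0 <= B x - B 0.
  move=> x0 gd Bd gb.
  have : g x - B x <= g 0 - B 0; last lra.
  apply: (@ge_derive_le _ (fun s => g s - B s) (fun s => g' s - b s) _ _ x0) => s sx.
    by have := gd s sx; have := Bd s => ? ?; exact: is_deriveB.
  by rewrite subr_le0 gb.
move=> fd Bd fb; have [t0|/ltW t0] := leP 0 t.
  have st s : 0 <= s <= t -> `|s| <= `|t|.
    by move=> /andP[s0 st]; rewrite !ger0_norm.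
  rewrite [`|t|]ger0_norm// ler_norml lerNl; apply/andP; split.
    have := main (fun s => - f s) (fun s => - f' s) t t0.
    rewrite opprK opprB addrC; apply => // s sx.
      by have := fd s (st s sx) => ?; exact: is_deriveN.
    rewrite -[in b s](@ger0_norm _ s); last by case/andP: sx.
    by rewrite (le_trans _ (fb s (st s sx)))// lerNl lerNnormlW.
  apply: (main f f') => // s sx; first exact: fd (st s sx).
  rewrite -[in b s](@ger0_norm _ s); last by case/andP: sx.
  by rewrite (le_trans _ (fb s (st s sx)))// ler_norm.
have t0' : 0 <= - t by rewrite oppr_ge0.
have st s : 0 <= s <= - t -> `|- s| <= `|t|.
  by move=> /andP[s0 st]; rewrite normrN ger0_norm// ler0_norm.
have fd' s : 0 <= s <= - t -> is_derive s 1 (fun s => f (- s)) (- f' (- s)).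
  move=> sx; have h := fd _ (st s sx).
  have h2 : is_derive s 1 (fun s : R => - s) (-1) by apply: is_deriveNid.
  by have := is_derive1_comp h h2; rewrite mulrN1.
have nb s : 0 <= s <= - t -> `|f' (- s)| <= b s.
  move=> sx; rewrite (le_trans (fb _ (st s sx)))// normrN ger0_norm//.
  by case/andP: sx.
rewrite [`|t|]ler0_norm// ler_norml lerNl; apply/andP; split.
  have := main (fun s => - f (- s)) (fun s => - - f' (- s)) (- t) t0'.
  rewrite oppr0 !opprK opprB addrC; apply => // s sx.
    by have := fd' s sx => ?; exact: is_deriveN.
  by rewrite opprK (le_trans _ (nb s sx))// ler_norm.
have := main (fun s => f (- s)) (fun s => - f' (- s)) (- t) t0'.
rewrite opprK oppr0; apply => // s sx.
by rewrite (le_trans _ (nb s sx))// -normrN ler_norm.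
Qed.

Lemma cvg_tail (u M : nat -> R) :
  (forall k m, (k <= m)%N -> `|u m - u k| <= M k) -> M @ \oo --> 0 -> cvgn u.
Proof.
move=> uM M0; apply/cauchy_cvgP/cauchy_exP => e e0.
have e2 : 0 < e / 2 by rewrite divr_gt0.
move/cvgrPdist_le : M0 => /(_ _ e2)[k _ /(_ k (leqnn k))]; rewrite sub0r normrN => Mk.
exists (u k); exists k => // m /= km; rewrite -ball_normE /= distrC.
rewrite (le_lt_trans (uM k m km))// (le_lt_trans (ler_norm _))// (le_lt_trans Mk)//; lra.
Qed.

Variable n : nat.

(** A global Lipschitz constant gives a solution on the whole line at once, with no continuation of
    local solutions. Continuity is required along curves because [F] is only ever integrated in that
    form. *)
Lemma picard (F : R -> 'rV[R]_n -> 'rV[R]_n) (L C : R) (z : 'rV[R]_n) :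
  (forall w : R -> 'rV[R]_n, continuous w -> continuous (fun t => F t (w t))) ->
  (forall t a b, `|F t a - F t b| <= L * `|a - b|) ->
  (forall t, `|F t z| <= C) ->
  exists2 w : R -> 'rV[R]_n, w 0 = z & forall t : R, is_derive t 1 w (F t (w t)).
Proof.
(* The normalisation [1 <= L] yields [|t| <= exp (2 L |t|) - 1], the base case of the estimate
   [dk]. *)
move=> Fc; wlog L1 : L / 1 <= L.
  move=> H FL FC; apply: (H (Num.max 1 L)) => //; first by rewrite le_max lexx.
  move=> t a b; rewrite (le_trans (FL t a b))// ler_wpM2r//.
  by rewrite le_max lexx orbT.
move=> FL FC; have C0 : 0 <= C by rewrite (le_trans _ (FC 0)).
have L0 : 0 < L by lra.
pose next (w : R -> 'rV[R]_n) t := z + \row_i primitive (fun s => F s (w s) 0 i) t.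
pose w_ k := iter k next (cst z).
have w0 k : w_ k 0 = z.
  case: k => [|k] //=; rewrite /next; apply/rowP => i.
  by rewrite !mxE primitive0 addr0.
have nextd w (t : R) : continuous w -> is_derive t 1 (next w) (F t (w t)).
  move=> wc; apply/is_derive_row => i.
  rewrite (_ : (fun s => _) = fun s => z 0 i + primitive (fun s => F s (w s) 0 i) s); last first.
    by apply/funext => s; rewrite /next !mxE.
  have h := @is_derive_primitive (fun s => F s (w s) 0 i) t.
  have {}h := h (fun s => (continuous_rowP _ _).1 (Fc w wc s) i).
  by have := is_deriveD (is_derive_cst (z 0 i) t 1) h; rewrite add0r.
have wc k : continuous (w_ k).
  elim: k => [|k IH] t; first exact: cst_continuous.
  exact: is_derive_continuous (nextd _ t IH).
have wd k (t : R) : is_derive t 1 (w_ k.+1) (F t (w_ k t)) by exact: nextd.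
pose Ex (t : R) := expR (2 * L * t).
have Exd (t : R) : is_derive t 1 Ex (2 * L * Ex t).
  have x1 : is_derive t 1 (fun s : R => 2 * L * s) (2 * L).
    by apply: is_derive_eq; rewrite /GRing.scale/=; ring.
  by rewrite [_ * Ex t]mulrC; exact: (@is_derive1_comp _ expR (fun s : R => 2 * L * s)).
pose q k : R := C / 2 ^+ k.
have q0 k : 0 <= q k by rewrite /q divr_ge0// exprn_ge0.
have qS k : q k.+1 = q k / 2 by rewrite /q exprS invfM mulrA mulrAC.
(* The factor [exp (2 L |t|)] makes the Picard operator contract by 1/2. *)
have dk k t : `|w_ k.+1 t - w_ k t| <= q k * (Ex `|t| - 1).
  elim: k t => [|k IH] t.
    apply: (@le_trans _ _ (C * `|t|)); last first.
      rewrite /q expr0 divr1 ler_wpM2l// /Ex.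
      have := expR_ge1Dx (2 * L * `|t|); have := normr_ge0 t; nra.
    apply/norm_row_le; first exact: mulr_ge0.
    move=> i; rewrite !mxE /= addrAC subrr add0r.
    have -> : primitive (fun s => F s z 0 i) t = w_ 1%N t 0 i - w_ 1%N 0 0 i.
      by rewrite w0 /= /next !mxE addrAC subrr add0r.
    have := @le_abs_primitive (fun s => w_ 1%N s 0 i) (fun s => F s z 0 i) (fun s => C * s) (fun=> C) t.
    rewrite mulr0 subr0; apply.
    - by move=> s _; have /is_derive_row := wd 0%N s.
    - by move=> s; apply: is_derive_eq; rewrite /GRing.scale/=; ring.
    - by move=> s _; rewrite (le_trans (norm_coord_le _ _)).
  apply/norm_row_le.
    rewrite mulr_ge0// subr_ge0 /Ex -expR0 ler_expR mulr_ge0// mulr_ge0// ?(ltW L0)//.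
  move=> i; rewrite rowB.
  pose d s := w_ k.+2 s 0 i - w_ k.+1 s 0 i.
  have : `|d t - d 0| <= q k.+1 * Ex `|t| - q k.+1 * Ex 0; last first.
    by rewrite /d !w0 subrr subr0 [Ex 0]/Ex mulr0 expR0 -mulrBr.
  apply: (@le_abs_primitive d (fun s => (F s (w_ k.+1 s) - F s (w_ k s)) 0 i)
    (fun s => q k.+1 * Ex s) (fun s => L * (q k * Ex s)) t).
  - move=> s _; rewrite rowB.
    have /is_derive_row/(_ i) h1 := wd k.+1 s.
    have /is_derive_row/(_ i) h2 := wd k s.
    exact: is_deriveB.
  - move=> s; have h := Exd s; apply: is_derive_eq.
    by rewrite qS /GRing.scale/=; field.
  - move=> s _; rewrite (le_trans (norm_coord_le _ _))// (le_trans (FL _ _ _))//.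
    rewrite ler_wpM2l ?(ltW L0)// (le_trans (IH _))// ler_wpM2l//; lra.
(* [2 * q k] is the sum of the geometric tail [q k + q k.+1 + ...]. *)
pose M k (t : R) := 2 * q k * Ex `|t|.
have wM k m t : (k <= m)%N -> `|w_ m t - w_ k t| <= M k t.
  move=> /subnK <-; set j := (m - k)%N.
  have E0 : 0 < Ex `|t| by exact: expR_gt0.
  suff : `|w_ (j + k)%N t - w_ k t| <= (2 * q k - 2 * q (j + k)%N) * Ex `|t|.
    move/le_trans; apply; rewrite /M ler_wpM2r ?(ltW E0)//; have := q0 (j + k)%N; lra.
  elim: j => [|j IH]; first by rewrite add0n !subrr normr0 mul0r.
  rewrite addSn qS.
  have -> : w_ (j + k).+1 t - w_ k t = (w_ (j + k).+1 t - w_ (j + k)%N t) + (w_ (j + k)%N t - w_ k t).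
    by rewrite addrA subrK.
  rewrite (le_trans (ler_normD _ _))//; have := dk (j + k)%N t.
  by move: IH; have := q0 (j + k)%N; nra.
have M0 t : M ^~ t @ \oo --> 0.
  rewrite (_ : (fun k => M k t) = geometric (2 * C * Ex `|t|) (2^-1)); last first.
    by apply/funext => k; rewrite /M /q /geometric /= exprVn; ring.
  by apply: cvg_geometric; rewrite ger0_norm// invf_lt1// ltr1n.
have wcv t i : cvgn (fun k => w_ k t 0 i).
  apply: (@cvg_tail _ (M ^~ t)) => // k m km.
  by rewrite (le_trans _ (wM k m t km))// (le_trans _ (norm_coord_le _ i))// rowB.
pose w t := \row_i limn (fun k => w_ k t 0 i).
have w_lim k t : `|w t - w_ k t| <= M k t.
  have Mp : 0 <= M k t by rewrite /M !mulr_ge0// expR_ge0.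
  apply/norm_row_le => // i; rewrite !mxE.
  have cv : (fun m => `|w_ m t 0 i - w_ k t 0 i|) @ \oo -->
      `|limn (fun k => w_ k t 0 i) - w_ k t 0 i|.
    by apply: cvg_norm; apply: cvgB; [exact: wcv|exact: cvg_cst].
  apply: (le_lim cv); exists k => // m /= km.
  by rewrite (le_trans _ (wM k m t km))// (le_trans _ (norm_coord_le _ i))// rowB.
(* Makes the convergence uniform for [|s - t| < 1], which is enough for continuity and
   differentiability of the limit at [t]. *)
have Mloc k t s : `|s - t| < 1 -> M k s <= M k (`|t| + 1).
  move=> st; rewrite /M ler_wpM2l ?mulr_ge0// /Ex ler_expR ler_wpM2l ?mulr_ge0 ?(ltW L0)//.
  rewrite [`|_ + 1|]ger0_norm; last by rewrite addr_ge0.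
  have : `|s| <= `|s - t| + `|t| by rewrite -[X in `|X| <= _](subrK t) ler_normD.
  lra.
have cw : continuous w.
  move=> t; apply/continuous_epsP => e e0.
  have e3 : 0 < e / 3 by rewrite divr_gt0.
  have /cvgrPdist_le/(_ _ e3)[k _ /(_ k (leqnn k))] := M0 (`|t| + 1).
  rewrite sub0r normrN => /(le_trans (ler_norm _)) Mk.
  have /continuous_epsP/(_ _ e3)[r r0 Hr] := wc k t.
  exists (Num.min 1 r); first by rewrite lt_min ltr01.
  move=> s; rewrite lt_min => /andP[s1 sr].
  have -> : w s - w t = (w s - w_ k s) + (w_ k s - w_ k t) - (w t - w_ k t).
    by rewrite opprB !subrKA.
  have b1 : `|w s - w_ k s| <= e / 3.
    by rewrite (le_trans (w_lim k s))// (le_trans _ Mk)// Mloc.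
  have b2 : `|w t - w_ k t| <= e / 3.
    by rewrite (le_trans (w_lim k t))// (le_trans _ Mk)// Mloc// subrr normr0.
  rewrite (_ : e = e / 3 + e / 3 + e / 3); last by field.
  apply: (le_trans (ler_normB _ _)); apply: lerD b2.
  by apply: (le_trans (ler_normD _ _)); apply: lerD b1 _; exact: Hr.
exists w.
  by apply/rowP => i; rewrite mxE (_ : (fun k => _) = cst (z 0 i)) ?lim_cst//; apply/funext => k; rewrite w0.
move=> t; apply/is_derive_row => i.
apply: (@is_derive_unif_limit _ (fun k s => w_ k.+1 s 0 i) (fun k s => F s (w_ k s) 0 i)
  (fun s => w s 0 i) (fun s => F s (w s) 0 i) (fun k => L * M k (`|t| + 1)) t 1) => //.
- by move=> k s _; have /is_derive_row := wd k s.
- move=> k s st; rewrite (_ : _ - _ = (F s (w_ k s) - F s (w s)) 0 i); last by rewrite !mxE.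
  rewrite (le_trans (norm_coord_le _ _))// (le_trans (FL _ _ _))// ler_wpM2l ?(ltW L0)//.
  by rewrite distrC (le_trans (w_lim k s))// Mloc.
- rewrite -(mulr0 L); apply: cvgMl_tmp; exact: M0.
- move=> s _; rewrite mxE; by rewrite (cvg_shiftS (fun k => w_ k s 0 i)); exact: wcv.
- exact: (continuous_rowP _ _).1 (Fc w cw t) i.
Qed.

End Picard.

(** * Flows of continuously differentiable vector fields *)

Section Clamp.
Context {R : realType}.

Definition clamp (a b x : R) : R := Num.max a (Num.min b x).

Lemma clamp_in a b x : a <= b -> a <= clamp a b x <= b.
Proof.
by move=> ab; rewrite /clamp le_max lexx ge_max ab ge_min lexx.
Qed.

Lemma clamp_id a b x : a <= x <= b -> clamp a b x = x.
Proof. by move=> /andP[ax xb]; rewrite /clamp min_r// max_r. Qed.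

Lemma clamp_lipschitz a b x y : a <= b -> `|clamp a b x - clamp a b y| <= `|x - y|.
Proof.
move=> ab; rewrite /clamp; wlog xy : x y / x <= y.
  move=> H; have [/H//|/ltW/H] := leP x y.
  by rewrite distrC [`|y - x|]distrC.
rewrite [in leRHS]ler0_norm ?subr_le0//.
case: (leP b x) => bx; case: (leP b y) => by_; [| |case: (leP a x) => ax|case: (leP a x) => ax; case: (leP a y) => ay];
  rewrite ?(max_r ab) ?(max_r (ltW ax)) ?subrr ?normr0 ?ler0_norm ?subr_le0; lra.
Qed.

Lemma clamp_continuous a b : a <= b -> continuous (clamp a b).
Proof.
move=> ab x; apply/continuous_epsP => e e0; exists e => // y yx.
by rewrite (le_trans (clamp_lipschitz _ _ ab))// ltW.
Qed.

(** Because the norm is the sup norm, truncating coordinates is a 1-Lipschitz retraction onto the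
    ball of radius [r]; a field known on the ball extends with the same Lipschitz constant. *)
Definition clamp_row n (r : R) (v : 'rV[R]_n) : 'rV[R]_n := \row_i clamp (- r) r (v 0 i).

Variables (n : nat) (r : R).
Hypothesis r0 : 0 <= r.

Lemma norm_clamp_row (v : 'rV[R]_n) : `|clamp_row r v| <= r.
Proof. by apply/norm_row_le => // i; rewrite mxE ler_norml clamp_in// ge0_cp. Qed.

Lemma clamp_row_id (v : 'rV[R]_n) : `|v| <= r -> clamp_row r v = v.
Proof.
by move=> /norm_row_le vr; apply/rowP => i; rewrite mxE clamp_id// -ler_norml vr.
Qed.

Lemma clamp_row_lipschitz (v w : 'rV[R]_n) :
  `|clamp_row r v - clamp_row r w| <= `|v - w|.
Proof.
apply/norm_row_le => // i; rewrite rowB !mxE.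
have rr : - r <= r by rewrite ge0_cp.
rewrite (le_trans (clamp_lipschitz _ _ rr))//.
by rewrite -rowB norm_coord_le.
Qed.

End Clamp.

(** Strict differentiability: the two-point estimate gives local Lipschitz bounds without convexity
    arguments. The clause [U a] makes [U] open, and the last clause is continuity of [J]. *)
Definition C1_map (R : realType) n m (X : 'rV[R]_n -> 'rV[R]_m) (U : set 'rV[R]_n)
    (J : 'rV[R]_n -> 'M[R]_(n, m)) :=
  forall x, U x -> forall e, 0 < e ->
  exists2 r, 0 < r & forall a b, `|a - x| < r -> `|b - x| < r ->
    [/\ U a, `|X a - X b - (a - b) *m J x| <= e * `|a - b| &
        forall v : 'rV_n, `|v *m (J a - J x)| <= e * `|v|].

Section Flow.
Context {R : realType} {n : nat}.
Variables (X : 'rV[R]_n -> 'rV[R]_n) (U : set 'rV[R]_n) (J : 'rV[R]_n -> 'M[R]_n).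

(** Compactness of [[0, T]]. The hypothesis speaks of all small [p], since the radii found near
    different times must finally be replaced by a single one. *)
Lemma near_segment (P : R -> R -> Prop) (T : R) :
  (forall t, 0 <= t <= T -> exists2 r, 0 < r & forall p s, 0 < p -> p < r ->
    `|s - t| < r -> P p s) ->
  exists2 r, 0 < r & forall s, 0 <= s <= T -> P r s.
Proof.
move=> H.
have /compact_near_coveringP/(_ _ (0^'+) P _) := @segment_compact R 0 T.
move=> []//.
  move=> t /=; rewrite in_itv/= => /H[r r0 Hr].
  exists (ball t r, [set p | 0 < p < r]).
    split; first exact: nbhsx_ballx.
    by near=> p; apply/andP; split.
  move=> [s p] /= [st /andP[p0 pr]]; apply: Hr => //.
  by move: st; rewrite -ball_normE /= distrC.
move=> r /= r0 Hr; have r2 : 0 < r / 2 by rewrite divr_gt0.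
exists (r / 2) => // s sT; apply: (Hr (r / 2)) => //=.
  by rewrite sub0r normrN gtr0_norm//; lra.
Unshelve. all: by end_near. Qed.

Hypothesis XC : C1_map X U J.

Lemma C1_map_open : open U.
Proof.
rewrite openE => x /XC/(_ 1 ltr01)[r r0 Hr]; apply/nbhs_ballP; exists r => //= a.
by rewrite -ball_normE /= distrC => ax; case: (Hr a a ax ax).
Qed.

Lemma C1_map_lipschitz x : U x -> exists2 r, 0 < r & forall a b,
  `|a - x| < r -> `|b - x| < r -> `|X a - X b| <= r^-1 * `|a - b|.
Proof.
move=> /XC/(_ 1 ltr01)[r r0 Hr].
set M := \sum_i \sum_j `|J x i j|.
have M0 : 0 <= M by rewrite sumr_ge0// => i _; rewrite sumr_ge0.
have M1 : 0 < 1 + M by lra.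
exists (Num.min r (1 + M)^-1); first by rewrite lt_min r0 invr_gt0.
move=> a b; rewrite !lt_min => /andP[ar _] /andP[br _].
apply: (@le_trans _ _ ((1 + M) * `|a - b|)).
  have -> : X a - X b = (X a - X b - (a - b) *m J x) + (a - b) *m J x by rewrite subrK.
  rewrite (le_trans (ler_normD _ _))// mulrDl lerD//; last exact: norm_mulmx_le.
  by case: (Hr a b ar br).
rewrite ler_wpM2r// -[leLHS]invrK lef_pV2 ?posrE ?invr_gt0//.
  by rewrite ge_min lexx orbT.
by rewrite lt_min r0 invr_gt0.
Qed.

Lemma C1_map_continuous x : U x -> {for x, continuous X}.
Proof.
move=> /C1_map_lipschitz[r r0 Hr]; apply/continuous_epsP => e e0.
exists (Num.min r (e * r)); first by rewrite lt_min r0 mulr_gt0.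
move=> y; rewrite lt_min => /andP[yr /ltW ye].
rewrite (le_trans (Hr _ _ yr _))//; first by rewrite subrr normr0.
by rewrite mulrC ler_pdivrMr.
Qed.

Section Tube.
Variables (u : R -> 'rV[R]_n) (T : R).
Hypothesis uc : forall t, 0 <= t <= T -> {for t, continuous u}.
Hypothesis uU : forall t, 0 <= t <= T -> U (u t).

(* The radius [r] of the tube around the curve also provides the Lipschitz
   constant [r^-1], so that one compactness argument yields both. *)
Lemma tube_lipschitz : exists2 r, 0 < r & forall t, 0 <= t <= T -> forall a b,
  `|a| <= r -> `|b| <= r ->
  U (u t + a) /\ `|X (u t + a) - X (u t + b)| <= r^-1 * `|a - b|.
Proof.
apply: (@near_segment (fun r t => forall a b, `|a| <= r -> `|b| <= r ->
  U (u t + a) /\ `|X (u t + a) - X (u t + b)| <= r^-1 * `|a - b|)).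
move=> t tT; have [r r0 Hr] := C1_map_lipschitz (uU tT).
have [r1 r10 Hr1] := XC (uU tT) ltr01.
pose p := Num.min r r1; have p0 : 0 < p / 4 by rewrite divr_gt0// lt_min r0.
have /continuous_epsP/(_ _ p0)[d d0 ud] := uc tT.
exists (Num.min d (p / 4)); first by rewrite lt_min d0.
move=> q s q0; rewrite lt_min => /andP[_ qp]; rewrite lt_min => /andP[/ud usd _] a b aq bq.
have near_u c : `|c| <= q -> `|u s + c - u t| < p.
  by move=> cq; rewrite addrAC (le_lt_trans (ler_normD _ _))//; lra.
have pr : p <= r by rewrite ge_min lexx.
have pr1 : p <= r1 by rewrite ge_min lexx orbT.
split.
  by case: (Hr1 (u s + a) (u s + a)); rewrite ?(lt_le_trans (near_u _ _) pr1).
rewrite (le_trans (Hr _ _ _ _))//; try by rewrite (lt_le_trans (near_u _ _) pr).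
rewrite opprD addrACA subrr add0r ler_wpM2r// lef_pV2 ?posrE//; lra.
Qed.

Lemma tube_diff e : 0 < e -> exists2 r, 0 < r & forall t, 0 <= t <= T -> forall a,
  `|a| <= r -> `|X (u t + a) - X (u t) - a *m J (u t)| <= e * `|a|.
Proof.
move=> e0; have e2 : 0 < e / 2 by rewrite divr_gt0.
apply: (@near_segment (fun r t => forall a,
  `|a| <= r -> `|X (u t + a) - X (u t) - a *m J (u t)| <= e * `|a|)).
move=> t tT; have [r r0 Hr] := XC (uU tT) e2.
have r4 : 0 < r / 4 by rewrite divr_gt0.
have /continuous_epsP/(_ _ r4)[d d0 ud] := uc tT.
exists (Num.min d (r / 4)); first by rewrite lt_min d0.
move=> q s q0; rewrite lt_min => /andP[_ qp]; rewrite lt_min => /andP[/ud usd _] a aq.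
have h1 : `|u s + a - u t| < r.
  by rewrite addrAC (le_lt_trans (ler_normD _ _))//; lra.
have h2 : `|u s - u t| < r by lra.
have [_ + _] := Hr _ _ h1 h2; have [_ _ /(_ a) b2] := Hr _ _ h2 h2.
rewrite [u s + a - u s]addrAC subrr add0r => b1.
(* [Hr] uses the derivative at the centre [u t]; replacing it by [J (u s)] costs the second [e / 2],
   through the continuity clause of [C1_map]. *)
have -> : X (u s + a) - X (u s) - a *m J (u s) =
  (X (u s + a) - X (u s) - a *m J (u t)) - a *m (J (u s) - J (u t)).
  by rewrite mulmxBr opprB subrKA.
by rewrite (le_trans (ler_normB _ _))// (splitr e) mulrDl lerD.
Qed.

Lemma tube_jac : exists2 M, 0 <= M & forall t, 0 <= t <= T -> forall a : 'rV_n,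
  `|a *m J (u t)| <= M * `|a|.
Proof.
have [r r0 Hr] : exists2 r, 0 < r & forall t, 0 <= t <= T -> forall a : 'rV_n,
    `|a *m J (u t)| <= r^-1 * `|a|.
  apply: (@near_segment (fun r t => forall a : 'rV_n, `|a *m J (u t)| <= r^-1 * `|a|)).
  move=> t tT; have [r r0 Hr] := XC (uU tT) ltr01.
  set M := \sum_i \sum_j `|J (u t) i j|.
  have M0 : 0 <= M by rewrite sumr_ge0// => i _; rewrite sumr_ge0.
  have M1 : 0 < 1 + M by lra.
  have r2 : 0 < r / 2 by rewrite divr_gt0.
  have /continuous_epsP/(_ _ r2)[d d0 ud] := uc tT.
  exists (Num.min d (1 + M)^-1); first by rewrite lt_min d0 invr_gt0.
  move=> q s q0; rewrite !lt_min => /andP[_ qp] /andP[/ud usd _] a.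
  have h2 : `|u s - u t| < r by lra.
  have [_ _ /(_ a) b2] := Hr _ _ h2 h2.
  apply: (@le_trans _ _ ((1 + M) * `|a|)).
    have -> : a *m J (u s) = a *m (J (u s) - J (u t)) + a *m J (u t).
      by rewrite mulmxBr subrK.
    by rewrite (le_trans (ler_normD _ _))// mulrDl lerD// norm_mulmx_le.
  by rewrite ler_wpM2r// -[leLHS]invrK lef_pV2 ?posrE ?invr_gt0// ltW.
by exists r^-1 => //; rewrite invr_ge0 ltW.
Qed.

End Tube.

(** [X] is only locally Lipschitz and the two curves need not lie in a common tube. Compactness
    still bounds [|X u - X v| / |u - v|] along them: near a time where they agree by the local
    Lipschitz constant, near any other time because the denominator stays away from 0. Gronwall with
    zero data concludes. *)
Lemma solution_unique (u v : R -> 'rV[R]_n) T :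
  (forall t, 0 <= t <= T -> is_solution_at X U u t) ->
  (forall t, 0 <= t <= T -> is_solution_at X U v t) ->
  u 0 = v 0 -> forall t, 0 <= t <= T -> u t = v t.
Proof.
move=> us vs uv0 t tT.
have T0 : 0 <= T by case/andP: tT => t0 /(le_trans t0).
have uc s : 0 <= s <= T -> {for s, continuous u}.
  by move=> /us[_]; exact: is_derive_continuous.
have vc s : 0 <= s <= T -> {for s, continuous v}.
  by move=> /vs[_]; exact: is_derive_continuous.
have [r r0 Hr] : exists2 r, 0 < r & forall s, 0 <= s <= T ->
    `|X (u s) - X (v s)| <= r^-1 * `|u s - v s|.
  apply: (@near_segment (fun r s => `|X (u s) - X (v s)| <= r^-1 * `|u s - v s|)).
  move=> s sT; have [Uu _] := us s sT; have [Uv _] := vs s sT.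
  have [uvs|uvs] := eqVneq (u s) (v s).
    have [r r0 Hr] := C1_map_lipschitz Uu.
    have r2 : 0 < r / 2 by rewrite divr_gt0.
    have /continuous_epsP/(_ _ r2)[d d0 ud] := uc s sT.
    have /continuous_epsP/(_ _ r2)[d' d'0 vd] := vc s sT.
    exists (Num.min r (Num.min d d')); first by rewrite !lt_min r0 d0.
    move=> q x q0; rewrite lt_min => /andP[qr _].
    rewrite !lt_min => /and3P[_ /ud b1 /vd b2].
    rewrite (le_trans (Hr _ _ _ _))//; [lra|rewrite uvs; lra|].
    by rewrite ler_wpM2r// lef_pV2 ?posrE// ltW.
  (* Each curve moves by at most [D / 4], so the distance stays at least [D / 2]; each velocity
     changes by at most 1, whence the 2 in [N]. A radius below [D / (2 N)] then makes the quotient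
     bound hold. *)
  pose D := `|u s - v s|; have D0 : 0 < D / 4 by rewrite divr_gt0// normr_gt0 subr_eq0.
  pose N := `|X (u s)| + `|X (v s)| + 2; have N0 : 0 < N by rewrite ltr_wpDl// addr_ge0.
  have Xuc : {for s, continuous (X \o u)}.
    by apply: continuous_comp; [exact: uc|exact: C1_map_continuous].
  have Xvc : {for s, continuous (X \o v)}.
    by apply: continuous_comp; [exact: vc|exact: C1_map_continuous].
  have /continuous_epsP/(_ _ D0)[d1 d10 H1] := uc s sT.
  have /continuous_epsP/(_ _ D0)[d2 d20 H2] := vc s sT.
  have /continuous_epsP/(_ _ ltr01)[d3 d30 H3] := Xuc.
  have /continuous_epsP/(_ _ ltr01)[d4 d40 H4] := Xvc.
  exists (Num.min (D / (2 * N)) (Num.min (Num.min d1 d2) (Num.min d3 d4))).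
    by rewrite !lt_min d10 d20 d30 d40 !andbT divr_gt0 ?mulr_gt0// normr_gt0 subr_eq0.
  move=> q x q0; rewrite lt_min => /andP[qD _].
  rewrite !lt_min => /andP[_ /andP[/andP[/H1 b1 /H2 b2] /andP[/H3/= b3 /H4/= b4]]].
  apply: (@le_trans _ _ N).
    rewrite (le_trans (ler_normB _ _))//.
    have c1 : `|X (u x)| <= `|X (u x) - X (u s)| + `|X (u s)|.
      by rewrite -[X in `|X| <= _](subrK (X (u s))) ler_normD.
    have c2 : `|X (v x)| <= `|X (v x) - X (v s)| + `|X (v s)|.
      by rewrite -[X in `|X| <= _](subrK (X (v s))) ler_normD.
    by rewrite /N; lra.
  have c3 : D <= `|u x - v x| + D / 4 + D / 4.
    have E : D = `|(u s - u x) + (u x - v x) + (v x - v s)|.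
      by rewrite !subrKA.
    have := ler_normD (u s - u x + (u x - v x)) (v x - v s).
    have := ler_normD (u s - u x) (u x - v x).
    by rewrite -E (distrC (u s) (u x)); lra.
  rewrite mulrC ler_pdivlMr// (@le_trans _ _ (D / 2))//; last lra.
  have := ltW qD; rewrite -(ler_pM2l N0) => /le_trans; apply.
  by rewrite le_eqVlt; apply/orP; left; apply/eqP; field; rewrite gt_eqF.
have [] := @gronwall _ n r^-1 T => //; first by rewrite invr_ge0 ltW.
move=> C C0 /(_ (fun s => u s - v s) (fun s => X (u s) - X (v s)) 0 (lexx 0)).
rewrite /= uv0 subrr normr0 addr0 mulr0 => H.
have : `|u t - v t| <= 0.
  apply: H => // s sT.
    have [_ ?] := us s sT; have [_ ?] := vs s sT; exact: is_deriveB.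
  by rewrite addr0 Hr.
by rewrite normr_le0 subr_eq0 => /eqP.
Qed.

(** [flow] picks an endpoint by choice; uniqueness of solutions leaves only one candidate. *)
Lemma flowE (u : R -> 'rV[R]_n) T : 0 <= T ->
  (forall t, 0 <= t <= T -> is_solution_at X U u t) ->
  flow X U T (u 0) = u T.
Proof.
move=> T0 us; rewrite /flow; case: xgetP => [w _ [v [v0 <- vs]]|/(_ (u T))]; last first.
  by case; exists u.
by apply: (solution_unique vs us) => //; rewrite T0 lexx.
Qed.

Section Existence.
Variables (u : R -> 'rV[R]_n) (T : R).
Hypothesis T0 : 0 <= T.
Hypothesis us : forall t, 0 <= t <= T -> is_solution_at X U u t.

Let uU t : 0 <= t <= T -> U (u t). Proof. by move=> /us[]. Qed.

Let uc t : 0 <= t <= T -> {for t, continuous u}.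
Proof. by move=> /us[_]; exact: is_derive_continuous. Qed.

Let ct t : 0 <= clamp 0 T t <= T. Proof. exact: clamp_in. Qed.

Let uct : continuous (u \o clamp 0 T).
Proof.
move=> t; apply: continuous_comp; first exact: clamp_continuous.
exact: uc.
Qed.

(** Shows that the time-[T] map is given by genuine solutions on a whole neighbourhood of [u 0],
    with a Lipschitz estimate at [u 0]. Identities between flows are later differentiated on this
    neighbourhood. *)
Lemma flow_near : exists2 r, 0 < r & exists2 C, 0 <= C &
  forall z, `|z - u 0| < r -> exists2 v : R -> 'rV[R]_n, v 0 = z &
    forall t, 0 <= t <= T -> is_solution_at X U v t /\
      `|v t - u t| <= C * `|z - u 0|.
Proof.
have [r r0 Hr] := tube_lipschitz uc uU.
have rl := ltW r0.
have [C C0 HC] : exists2 C, 0 <= C & forall (w w' : R -> 'rV[R]_n) e, 0 <= e ->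
    (forall t : R, 0 <= t <= T -> is_derive t 1 w (w' t)) ->
    (forall t, 0 <= t <= T -> `|w' t| <= r^-1 * `|w t| + e) ->
    forall t, 0 <= t <= T -> `|w t| <= C * (`|w 0| + e).
  by apply: gronwall => //; rewrite invr_ge0.
exists (r / (C + 1)); first by rewrite divr_gt0// ltr_wpDl.
exists C => // z; rewrite ltr_pdivlMr ?ltr_wpDl// => zr.
(* Clamping the time to [[0, T]] and the displacement to the tube gives a
   globally Lipschitz field; by [HC] its solutions never reach the clamps. *)
pose F t (w : 'rV[R]_n) :=
  X (u (clamp 0 T t) + clamp_row r w) - X (u (clamp 0 T t)).
have FL t a b : `|F t a - F t b| <= r^-1 * `|a - b|.
  rewrite /F opprB subrKA.
  have [_] := Hr _ (ct t) _ _ (norm_clamp_row rl a) (norm_clamp_row rl b).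
  move=> /le_trans; apply; rewrite ler_wpM2l ?invr_ge0//.
  exact: clamp_row_lipschitz.
have F0 t : F t 0 = 0.
  by rewrite /F clamp_row_id ?normr0// addr0 subrr.
have [|t|w w0 wd] := @picard _ _ F r^-1 (r^-1 * `|z - u 0|) (z - u 0) _ FL.
- move=> w wc t; apply: continuousB.
    apply: (@continuous_comp _ _ _ (fun t => u (clamp 0 T t) + clamp_row r (w t)) X).
      apply: continuousD; first exact: uct.
      apply/continuous_rowP => i; rewrite (_ : (fun s => _) = clamp (- r) r \o (fun s => w s 0 i)).
        apply: continuous_comp; first by have /continuous_rowP := wc t.
        by apply: clamp_continuous; rewrite ge0_cp.
      by apply/funext => s; rewrite mxE.
    apply: C1_map_continuous.
    have r00 : `|0 : 'rV[R]_n| <= r by rewrite normr0.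
    by case: (Hr _ (ct t) _ _ (norm_clamp_row rl (w t)) r00).
  apply: continuous_comp; first exact: uct.
  exact/C1_map_continuous/uU.
- by have := FL t (z - u 0) 0; rewrite F0 !subr0.
have wC t : 0 <= t <= T -> `|w t| <= C * `|z - u 0|.
  have := HC w (fun t => F t (w t)) 0 (lexx 0); rewrite addr0 w0; apply => // s _.
  by have := FL s (w s) 0; rewrite F0 !subr0 addr0.
(* The displacement [w] solves its equation on the whole line, so the sum has two-sided derivatives
   at [0] and [T] too, as [is_solution_at] demands. *)
exists (fun t => u t + w t); first by rewrite w0 addrC subrK.
move=> t tT; rewrite [u t + w t - _]addrAC subrr add0r; split; last exact: wC.
have wr : `|w t| <= r.
  rewrite (le_trans (wC t tT))//; have := normr_ge0 (z - u 0); lra.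
have r00 : `|0 : 'rV[R]_n| <= r by rewrite normr0.
split; first by case: (Hr _ tT _ _ wr r00).
have [_ ud] := us tT; have := wd t.
rewrite /F clamp_id// clamp_row_id// => ?.
by apply: is_derive_eq; rewrite addrC subrK.
Qed.

(** The variational equation along [u], with clamped time so that its coefficient is continuous and
    bounded on the whole line. *)
Lemma linear_solution (z : 'rV[R]_n) : exists2 v : R -> 'rV[R]_n, v 0 = z &
  forall t : R, is_derive t 1 v (v t *m J (u (clamp 0 T t))).
Proof.
have [M M0 HM] := tube_jac uc uU.
apply: (@picard _ _ (fun t v => v *m J (u (clamp 0 T t))) M (M * `|z|)).
- move=> w wc t; apply/continuous_epsP => e e0.
  have w1 : 0 < 2 * (`|w t| + 1) by rewrite mulr_gt0// ltr_wpDl.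
  have w2 : 0 < 2 * (M + 1) by rewrite mulr_gt0// ltr_wpDl.
  have ew : 0 < e / (2 * (`|w t| + 1)) by rewrite divr_gt0.
  have ew2 : 0 < e / (2 * (M + 1)) by rewrite divr_gt0.
  have [r r0 Hr] := XC (uU (ct t)) ew.
  have r2 : 0 < r / 2 by rewrite divr_gt0.
  have /continuous_epsP/(_ _ r2)[d d0 ud] := @uct t.
  have /continuous_epsP/(_ _ ew2)[d' d'0 wdd] := wc t.
  exists (Num.min d d'); first by rewrite lt_min d0.
  move=> s; rewrite lt_min => /andP[/ud/= us1 /wdd ws1].
  have h : `|u (clamp 0 T s) - u (clamp 0 T t)| < r by lra.
  have [_ _ /(_ (w t)) b] := Hr _ _ h h.
  have -> : w s *m J (u (clamp 0 T s)) - w t *m J (u (clamp 0 T t)) =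
    (w s - w t) *m J (u (clamp 0 T s)) +
    w t *m (J (u (clamp 0 T s)) - J (u (clamp 0 T t))).
    by rewrite mulmxBl mulmxBr subrKA.
  rewrite (le_trans (ler_normD _ _))// (splitr e) lerD//.
    rewrite (le_trans (HM _ (ct s) _))// (le_trans (ler_wpM2l M0 ws1))//.
    rewrite mulrA ler_pdivrMr// (_ : e / 2 * _ = (M + 1) * e); last by field.
    by rewrite ler_wpM2r ?(ltW e0)// lerDl.
  rewrite (le_trans b)// mulrAC ler_pdivrMr//.
  rewrite (_ : e / 2 * _ = e * (`|w t| + 1)); last by field.
  by rewrite ler_wpM2l ?(ltW e0)// lerDl.
- by move=> t a b; rewrite -mulmxBl HM.
- by move=> t; rewrite HM.
Qed.

Lemma linear_unique (v w : R -> 'rV[R]_n) :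
  (forall t : R, 0 <= t <= T -> is_derive t 1 v (v t *m J (u t))) ->
  (forall t : R, 0 <= t <= T -> is_derive t 1 w (w t *m J (u t))) ->
  v 0 = w 0 -> forall t, 0 <= t <= T -> v t = w t.
Proof.
move=> vd wd vw t tT; have [M M0 HM] := tube_jac uc uU.
have [C C0 HC] := @gronwall _ n M T M0 T0.
have := HC (fun s => v s - w s) (fun s => (v s - w s) *m J (u s)) 0 (lexx 0).
rewrite /= vw subrr normr0 addr0 mulr0 => H.
have : `|v t - w t| <= 0.
  apply: H => // s sT; last by rewrite addr0 HM.
  by have := vd s sT; have := wd s sT => ? ?; rewrite mulmxBl; exact: is_deriveB.
by rewrite normr_le0 subr_eq0 => /eqP.
Qed.

(** With [M] the fundamental matrix of the variational equation, [v - u - h M] starts at 0 and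
    solves that equation up to an error that is small compared with [|h|], so Gronwall gives the
    derivative. The second part lets it be evaluated on any solution of the variational equation
    found by other means. *)
Lemma flow_diff : differentiable (flow X U T) (u 0) /\
  forall v : R -> 'rV[R]_n,
    (forall t : R, 0 <= t <= T -> is_derive t 1 v (v t *m J (u t))) ->
    'd (flow X U T) (u 0) (v 0) = v T.
Proof.
have TT : 0 <= T <= T by rewrite T0 lexx.
have /choice[B HB] : forall i : 'I_n, exists v : R -> 'rV[R]_n, v 0 = delta_mx 0 i /\
    forall t : R, is_derive t 1 v (v t *m J (u (clamp 0 T t))).
  by move=> i; have [v v0 vd] := linear_solution (delta_mx 0 i); exists v.
pose M t := \matrix_i B i t.
have M0 (z : 'rV[R]_n) : z *m M 0 = z.
  rewrite mulmx_sum_row; apply/rowP => j; rewrite summxE (bigD1 j)//= big1 => [|i ij].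
    by rewrite mxE rowK (HB j).1 mxE !eqxx mulr1 addr0.
  by rewrite mxE rowK (HB i).1 mxE eqxx eq_sym (negPf ij) mulr0.
have Md (z : 'rV[R]_n) (t : R) : 0 <= t <= T ->
    is_derive t 1 (fun s => z *m M s) (z *m M t *m J (u t)).
  move=> tT; apply/is_derive_row => j.
  rewrite (_ : (fun s => _) = fun s => \sum_i z 0 i * B i s 0 j); last first.
    by apply/funext => s; rewrite mxE; apply: eq_bigr => i _; rewrite mxE.
  rewrite (_ : (z *m M t *m J (u t)) 0 j = \sum_i z 0 i * (B i t *m J (u t)) 0 j); last first.
    rewrite [z *m M t]mulmx_sum_row mulmx_suml summxE; apply: eq_bigr => i _.
    by rewrite rowK -scalemxAl mxE.
  apply: is_derive_big_sum => i; have [_ /(_ t)] := HB i.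
  rewrite clamp_id// => /is_derive_row/(_ j) h.
  by apply: is_derive_eq; rewrite /GRing.scale/=; ring.
have [r r0 [C C0 HC]] := flow_near.
have [MJ MJ0 HMJ] := tube_jac uc uU.
have [C2 C20 HC2] := @gronwall _ n MJ T MJ0 T0.
have uT : flow X U T (u 0) = u T by exact: flowE.
have [||df dE] := @differentiable_eps _ _ _ (flow X U T) (u 0) (mulmxr (M T)).
- exact: mulmx_row_continuous.
- move=> e e0.
  (* The error is multiplied by [C] when [v - u] is bounded by [h], and by [C2] in Gronwall; the
     summand 1 keeps the divisor positive. *)
  have CC : 0 < C2 * C + 1 by rewrite ltr_wpDl// mulr_ge0.
  have [r1 r10 Hr1] := tube_diff uc uU (divr_gt0 e0 CC).
  exists (Num.min r (r1 / (C + 1))).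
    by rewrite lt_min r0 divr_gt0// ltr_wpDl.
  move=> h; rewrite lt_min => /andP[hr]; rewrite ltr_pdivlMr ?ltr_wpDl// => hr1.
  have [|v v0 vs] := HC (u 0 + h).
    by rewrite addrAC subrr add0r.
  rewrite -v0 flowE//; last by move=> t /vs[].
  rewrite uT /=.
  have vu t : 0 <= t <= T -> `|v t - u t| <= C * `|h|.
    by move=> /vs[_]; rewrite [u 0 + h - _]addrAC subrr add0r.
  have := HC2 (fun s => v s - u s - h *m M s)
    (fun s => X (v s) - X (u s) - h *m M s *m J (u s)) (e / (C2 * C + 1) * (C * `|h|)).
  rewrite v0 M0 [u 0 + h - _]addrAC subrr add0r subrr normr0 add0r => H.
  apply: le_trans (H _ _ _ T TT) _.
  - by apply: mulr_ge0; [exact: ltW (divr_gt0 e0 CC)|exact: mulr_ge0].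
  - move=> t tT; have [[_ ?] _] := vs t tT; have [_ ?] := us tT.
    by have := Md h t tT => ?; do 2 apply: is_deriveB.
  - move=> t tT.
    have -> : X (v t) - X (u t) - h *m M t *m J (u t) =
        (v t - u t - h *m M t) *m J (u t) +
        (X (u t + (v t - u t)) - X (u t) - (v t - u t) *m J (u t)).
      rewrite [u t + _]addrC subrK mulmxBl; set a := X _ - _.
      by rewrite [RHS]addrC subrKA.
    rewrite (le_trans (ler_normD _ _))// lerD//; first exact: HMJ.
    have vr : `|v t - u t| <= r1.
      rewrite (le_trans (vu t tT))//; have := normr_ge0 h; lra.
    rewrite (le_trans (Hr1 t tT _ vr))// ler_wpM2l ?(ltW (divr_gt0 e0 CC))//.
    exact: vu.
  - rewrite (_ : C2 * _ = e * `|h| * (C2 * C / (C2 * C + 1))).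
      by rewrite ler_piMr ?mulr_ge0 ?(ltW e0)// ler_pdivrMr// mul1r lerDl.
    by field; rewrite gt_eqF.
split => // v vd; rewrite dE /=.
by rewrite -[RHS](linear_unique (Md (v 0)) vd)// M0.
Qed.

End Existence.
End Flow.

(** * Functions of class C^k *)

Section Ck.
Context {R : realType}.

(* The partial derivatives are only required to agree with [g] on [U], so
   that no value of ['D_v f] outside [U] matters. *)
Fixpoint Ck k n (U : set 'rV[R]_n) (f : 'rV[R]_n -> R) : Prop :=
  (forall x, U x -> {for x, continuous f}) /\
  if k is k'.+1 then forall i, exists2 g,
    forall x, U x -> is_derive x (delta_mx 0 i) f (g x) & Ck k' U g
  else True.

Lemma Ck_continuous k n (U : set 'rV[R]_n) f x : Ck k U f -> U x -> {for x, continuous f}.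
Proof. by case: k => [|k] [+ _] => /[apply]. Qed.

Lemma CkW k n (U : set 'rV[R]_n) f : Ck k.+1 U f -> Ck k U f.
Proof.
elim: k f => [|k IH] f [fc fd]; split => // i.
by have [g gd gC] := fd i; exists g => //; exact: IH.
Qed.

Lemma Ck_le k l n (U : set 'rV[R]_n) f : (l <= k)%N -> Ck k U f -> Ck l U f.
Proof. by move=> /subnK <-; elim: (k - l)%N => // j IH /CkW. Qed.

Lemma near_open n (U : set 'rV[R]_n) (P : 'rV[R]_n -> Prop) x : open U -> U x ->
  (forall y, U y -> P y) -> \forall y \near x, P y.
Proof. by move=> Uo Ux H; apply: filterS H _; exact: open_nbhs_nbhs. Qed.

Lemma continuous_near_eq (V W : normedModType R) (f g : V -> W) x :
  (\forall y \near x, f y = g y) -> {for x, continuous f} -> {for x, continuous g}.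
Proof.
move=> fg; have E := nbhs_singleton fg; move=> fc.
suff : g @ x --> f x by rewrite E.
apply: (@cvg_trans _ (f @ x)); last exact: fc.
exact: near_eq_cvg.
Qed.

Lemma Ck_ext k n (U : set 'rV[R]_n) f g : open U ->
  (forall x, U x -> f x = g x) -> Ck k U f -> Ck k U g.
Proof.
move=> Uo fg; have nfg (x : 'rV[R]_n) (Ux : U x) := @near_open _ U (fun y => f y = g y) x Uo Ux fg.
case: k => [|k] [fc fd].
  by split => // x Ux; exact: continuous_near_eq (nfg x Ux) (fc x Ux).
split=> [x Ux|i]; first exact: continuous_near_eq (nfg x Ux) (fc x Ux).
have [h hd hC] := fd i; exists h => // x Ux.
apply: near_eq_is_derive (hd x Ux); exact: nfg.
Qed.

Lemma Ck_partial k n (U : set 'rV[R]_n) f i : open U -> Ck k.+1 U f ->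
  (forall x, U x -> derivable f x (delta_mx 0 i)) /\
  Ck k U (fun x => 'D_(delta_mx 0 i) f x).
Proof.
move=> Uo [_ /(_ i)[g gd gC]]; split.
  by move=> x Ux; have [] := gd x Ux.
by apply: Ck_ext gC => // x Ux; have [_ ->] := gd x Ux.
Qed.

Lemma Ck_cst k n (U : set 'rV[R]_n) c : Ck k U (fun=> c).
Proof.
elim: k c => [|k IH] c; split => //; try by move=> x _; exact: cst_continuous.
by move=> i; exists (fun=> 0); [move=> x _; exact: is_derive_cst|exact: IH].
Qed.

Lemma is_derive_coord n (x v : 'rV[R]_n) i : is_derive x v (fun x => x 0 i) (v 0 i).
Proof.
apply/is_derive_epsP => e e0; exists 1 => // h _.
rewrite (_ : _ - _ - _ = 0) ?normr0 ?mulr_ge0 ?(ltW e0)//.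
by rewrite !mxE /GRing.scale/=; ring.
Qed.

Lemma Ck_coord k n (U : set 'rV[R]_n) i : Ck k U (fun x => x 0 i).
Proof.
case: k => [|k]; split => //; try by move=> x _; exact: coord_continuous.
move=> j; exists (fun=> (delta_mx 0 j : 'rV[R]_n) 0 i); last exact: Ck_cst.
by move=> x _; exact: is_derive_coord.
Qed.

Lemma CkD k n (U : set 'rV[R]_n) f g : Ck k U f -> Ck k U g -> Ck k U (fun x => f x + g x).
Proof.
elim: k f g => [|k IH] f g [fc fd] [gc gd].
  by split => // x Ux; apply: continuousD; [exact: fc|exact: gc].
split=> [x Ux|i]; first by apply: continuousD; [exact: fc|exact: gc].
have [df dfd dfC] := fd i; have [dg dgd dgC] := gd i.
exists (fun x => df x + dg x); last exact: IH.
by move=> x Ux; have := dfd x Ux; have := dgd x Ux => ? ?; exact: is_deriveD.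
Qed.

Lemma CkM k n (U : set 'rV[R]_n) f g : Ck k U f -> Ck k U g -> Ck k U (fun x => f x * g x).
Proof.
elim: k f g => [|k IH] f g fC gC; have [fc fd] := fC; have [gc gd] := gC.
  by split => // x Ux; apply: continuousM; [exact: fc|exact: gc].
split=> [x Ux|i]; first by apply: continuousM; [exact: fc|exact: gc].
have [df dfd dfC] := fd i; have [dg dgd dgC] := gd i.
exists (fun x => f x * dg x + g x * df x).
  by move=> x Ux; have := dfd x Ux; have := dgd x Ux => ? ?; exact: is_deriveM.
by apply: CkD; apply: IH => //; exact: CkW.
Qed.

Lemma CkN k n (U : set 'rV[R]_n) f : Ck k U f -> Ck k U (fun x => - f x).
Proof.
move=> fC; rewrite (_ : (fun x => - f x) = fun x => -1 * f x).
  by apply: CkM => //; exact: Ck_cst.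
by apply/funext => x; rewrite mulN1r.
Qed.

Lemma CkB k n (U : set 'rV[R]_n) f g : Ck k U f -> Ck k U g -> Ck k U (fun x => f x - g x).
Proof. by move=> fC gC; apply: CkD => //; exact: CkN. Qed.

Lemma Ck_sum k n m (U : set 'rV[R]_n) (f : 'I_m -> 'rV[R]_n -> R) :
  (forall i, Ck k U (f i)) -> Ck k U (fun x => \sum_i f i x).
Proof.
move=> fC; elim: m f fC => [|m IH] f fC.
  rewrite (_ : (fun x => _) = fun=> 0); first exact: Ck_cst.
  by apply/funext => x; rewrite big_ord0.
rewrite (_ : (fun x => _) = fun x => f ord0 x + \sum_(i < m) f (lift ord0 i) x).
  by apply: CkD => //; exact: (IH (fun i => f (lift ord0 i))).
by apply/funext => x; rewrite big_ord_recl.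
Qed.

Lemma Ck_prod k n m (U : set 'rV[R]_n) (f : 'I_m -> 'rV[R]_n -> R) :
  (forall i, Ck k U (f i)) -> Ck k U (fun x => \prod_i f i x).
Proof.
move=> fC; elim: m f fC => [|m IH] f fC.
  rewrite (_ : (fun x => _) = fun=> 1); first exact: Ck_cst.
  by apply/funext => x; rewrite big_ord0.
rewrite (_ : (fun x => _) = fun x => f ord0 x * \prod_(i < m) f (lift ord0 i) x).
  by apply: CkM => //; exact: (IH (fun i => f (lift ord0 i))).
by apply/funext => x; rewrite big_ord_recl.
Qed.

Lemma CkX k n (U : set 'rV[R]_n) f j : Ck k U f -> Ck k U (fun x => f x ^+ j).
Proof.
move=> fC; elim: j => [|j IH].
  by rewrite (_ : (fun x => _) = fun=> 1)//; exact: Ck_cst.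
rewrite (_ : (fun x => _) = fun x => f x * f x ^+ j); first exact: CkM.
by apply/funext => x; rewrite exprS.
Qed.

Lemma is_derive_inv (V : normedModType R) (f : V -> R) x v d : f x != 0 ->
  is_derive x v f d -> is_derive x v (fun y => (f y)^-1) (- (f x)^-1 ^+ 2 * d).
Proof.
move=> f0 [fd <-]; apply: DeriveDef; first exact: derivableV.
by rewrite deriveV// exprVn.
Qed.

Lemma CkV k n (U : set 'rV[R]_n) f : (forall x, U x -> f x != 0) ->
  Ck k U f -> Ck k U (fun x => (f x)^-1).
Proof.
move=> f0; elim: k => [|k IH] fC; have [fc fd] := fC.
  by split => // x Ux; apply: (continuousV (f0 x Ux)); exact: fc.
split=> [x Ux|i]; first by apply: (continuousV (f0 x Ux)); exact: fc.
have [df dfd dfC] := fd i.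
exists (fun x => - (f x)^-1 ^+ 2 * df x).
  by move=> x Ux; exact: is_derive_inv (f0 x Ux) (dfd x Ux).
by apply: CkM => //; apply: CkN; apply: CkX; apply: IH; exact: CkW.
Qed.

Lemma is_derive_lineP (V W : normedModType R) (f : V -> W) x v d :
  is_derive x v f d <-> is_derive (0 : R) 1 (fun s : R => f (x + s *: v)) d.
Proof.
split=> [fd|/is_derive_epsP H].
  by apply: is_derive_line; rewrite scale0r addr0.
apply/is_derive_epsP => e /H[r r0 Hr]; exists r => // h /Hr.
by rewrite scale0r addr0 add0r [h *: 1]mulr1.
Qed.

Lemma is_derive_chain (V : normedModType R) (f : V -> R) (h : R -> R) x v d a :
  is_derive x v f d -> is_derive (f x) 1 h a -> is_derive x v (fun y => h (f y)) (a * d).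
Proof.
move=> /is_derive_lineP fd hd; apply/is_derive_lineP.
apply: (@is_derive1_comp _ h (fun s : R => f (x + s *: v))) => //.
by rewrite scale0r addr0.
Qed.

Lemma is_derive_diff_comp (V W Z : normedModType R) (m : V -> W) (f : W -> Z) x v d :
  is_derive x v m d -> differentiable f (m x) ->
  is_derive x v (fun y => f (m y)) ('d f (m x) d).
Proof.
move=> /is_derive_lineP md fd; apply/is_derive_lineP.
have := @is_derive_comp_diff _ _ _ (fun s : R => m (x + s *: v)) f 0 d md.
by rewrite scale0r addr0; apply.
Qed.

Lemma Ck_sqrt k n (U : set 'rV[R]_n) f : (forall x, U x -> 0 < f x) ->
  Ck k U f -> Ck k U (fun x => Num.sqrt (f x)).
Proof.
move=> f0; elim: k => [|k IH] fC; have [fc fd] := fC.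
  split => // x Ux; apply: continuous_comp; [exact: fc|exact: sqrt_continuous].
split=> [x Ux|i]; first by apply: continuous_comp; [exact: fc|exact: sqrt_continuous].
have [df dfd dfC] := fd i.
exists (fun x => (2 * Num.sqrt (f x))^-1 * df x).
  by move=> x Ux; apply: is_derive_chain (dfd x Ux) (is_derive1_sqrt (f0 x Ux)).
apply: CkM => //; apply: CkV.
  by move=> x Ux; rewrite mulf_neq0// gt_eqF// sqrtr_gt0 f0.
by apply: CkM; [exact: Ck_cst|apply: IH; exact: CkW].
Qed.

(** From [b] to [a] one coordinate at a time, with the mean value theorem on every edge. The path
    stays in the ball because sup-norm balls are boxes; the divisor [n + 1] shares [e] among the [n]
    edges and is nonzero even for [n = 0]. *)
Lemma C1_strict n (U : set 'rV[R]_n) (f : 'rV[R]_n -> R) (g : 'I_n -> 'rV[R]_n -> R) x e :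
  open U -> U x -> (forall i y, U y -> is_derive y (delta_mx 0 i) f (g i y)) ->
  (forall i, {for x, continuous (g i)}) -> 0 < e ->
  exists2 r, 0 < r & forall a b, `|a - x| < r -> `|b - x| < r ->
    U a /\ `|f a - f b - \sum_i (a - b) 0 i * g i x| <= e * `|a - b|.
Proof.
move=> Uo Ux fd gc e0.
have n1 : 0 < n%:R + 1 :> R by rewrite ltr_wpDl.
have en : 0 < e / (n%:R + 1) by rewrite divr_gt0.
have : \forall y \near x, U y /\ forall i, `|g i y - g i x| <= e / (n%:R + 1).
  near=> y; split; first by near: y; exact: open_nbhs_nbhs.
  move=> i; move: i; near: y; apply: filter_forall => i.
  have /cvgrPdist_le/(_ _ en) := gc i.
  by apply: filterS => y; rewrite distrC.
move=> /nbhs_ballP[r /= r0 Hr].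
have {}Hr y : `|y - x| < r -> U y /\ forall i, `|g i y - g i x| <= e / (n%:R + 1).
  by move=> yr; apply: Hr; rewrite -ball_normE /= distrC.
exists r => // a b ar br; split; first by case: (Hr a ar).
pose c (j : nat) : 'rV[R]_n := \row_i (if (i < j)%N then a 0 i else b 0 i).
have cn : c n = a by apply/rowP => i; rewrite mxE ltn_ord.
have c0 : c 0%N = b by apply/rowP => i; rewrite mxE.
have E : f a - f b = \sum_(i < n) (f (c i.+1) - f (c i)).
  rewrite -(big_mkord xpredT (fun i => f (c i.+1) - f (c i))) telescope_sumr//.
  by rewrite cn c0.
rewrite E -sumrB (le_trans (ler_norm_sum _ _ _))//.
apply: (@le_trans _ _ (\sum_(i < n) e / (n%:R + 1) * `|a - b|)); last first.
  rewrite sumr_const card_ord -[leLHS]mulr_natl mulrA ler_wpM2r//.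
  by rewrite mulrA ler_pdivrMr// mulrC ler_pM2l// lerDl.
apply: ler_sum => i _.
have cS : c i.+1 = c i + 1 *: ((a 0 i - b 0 i) *: delta_mx 0 i).
  apply/rowP => j; rewrite scale1r !mxE eqxx ltnS leq_eqVlt /=.
  have [ji|ji] /= := eqVneq j i; last by rewrite mulr0 addr0 (negPf (_ : j != i :> nat)).
  by rewrite ji eqxx ltnn /= mulr1; ring.
have near_c s : 0 <= s <= 1 -> `|c i + s *: ((a 0 i - b 0 i) *: delta_mx 0 i) - x| < r.
  move=> /andP[s0 s1]; apply/norm_row_lt => // j; rewrite !mxE eqxx /=.
  have aj : `|a 0 j - x 0 j| < r by rewrite -rowB (le_lt_trans (norm_coord_le _ _)).
  have bj : `|b 0 j - x 0 j| < r by rewrite -rowB (le_lt_trans (norm_coord_le _ _)).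
  have [ji|_] := eqVneq j i; last by rewrite !mulr0 addr0; case: ifP.
  move: aj bj; rewrite ji ltnn mulr1; set A := a 0 i - x 0 i; set B := b 0 i - x 0 i.
  move=> Ar Br; have -> : b 0 i + s * (a 0 i - b 0 i) - x 0 i = s * A + (1 - s) * B.
    by rewrite /A /B; ring.
  rewrite (le_lt_trans (ler_normD _ _))// !normrM (ger0_norm s0) (@ger0_norm _ (1 - s)) ?subr_ge0//.
  have : Num.max `|A| `|B| < r by rewrite gt_max Ar.
  have : `|A| <= Num.max `|A| `|B| by rewrite le_max lexx.
  have : `|B| <= Num.max `|A| `|B| by rewrite le_max lexx orbT.
  set m := Num.max _ _ => Bm Am mr.
  have := ler_wpM2l s0 Am; have : (1 - s) * `|B| <= (1 - s) * m by rewrite ler_wpM2l ?subr_ge0.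
  lra.
have [||t /andP[t0 t1]] := @mean_value _ (fun s => f (c i + s *: ((a 0 i - b 0 i) *: delta_mx 0 i)))
  (fun s => (a 0 i - b 0 i) * g i (c i + s *: ((a 0 i - b 0 i) *: delta_mx 0 i))) 0 1.
- by [].
- move=> s sT; apply: is_derive_line; apply: is_deriveZv; apply: fd.
  by case: (Hr _ (near_c s sT)).
rewrite -cS scale0r addr0 subr0 mulr1 => ->.
rewrite rowB -mulrBr normrM mulrC ler_pM//.
  have tT : 0 <= t <= 1 by rewrite t0.
  by case: (Hr _ (near_c t tT)) => _.
by rewrite -rowB norm_coord_le.
Unshelve. all: by end_near. Qed.

Definition grad n (f : 'rV[R]_n -> R) x : 'cV[R]_n :=
  \col_i 'D_(delta_mx 0 i) f x.

Definition jac n m (f : 'rV[R]_n -> 'rV[R]_m) x : 'M[R]_(n, m) :=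
  \matrix_(i, j) 'D_(delta_mx 0 i) (fun y => f y 0 j) x.

Lemma C1_diff n (U : set 'rV[R]_n) (f : 'rV[R]_n -> R) x :
  open U -> Ck 1 U f -> U x ->
  differentiable f x /\ forall v, 'd f x v = (v *m grad f x) 0 0.
Proof.
move=> Uo fC Ux.
have fd i y : U y -> is_derive y (delta_mx 0 i) f ('D_(delta_mx 0 i) f y).
  by move=> Uy; apply: derivableP; apply: (Ck_partial i Uo fC).1.
have gc i : {for x, continuous (fun x => 'D_(delta_mx 0 i) f x)}.
  exact: Ck_continuous (Ck_partial i Uo fC).2 Ux.
pose L (v : 'rV[R]_n) := (v *m grad f x) 0 0.
have Ll : linear L by move=> a u v; rewrite /L mulmxDl -scalemxAl !mxE.
pose Lm := GRing.isLinear.Build R 'rV[R]_n R *%R L Ll.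
pose LL : {linear 'rV[R]_n -> R} := HB.pack L Lm.
have [||fd0 fE] := @differentiable_eps R _ _ f x LL; last by split => // v; rewrite fE.
  move=> v; apply: (@continuous_comp _ _ _ (mulmxr (grad f x)) (fun M : 'M[R]_(1, 1) => M 0 0)).
    exact: mulmx_row_continuous.
  exact: coord_continuous.
move=> e e0; have [r r0 Hr] := C1_strict Uo Ux fd gc e0.
exists r => // h hr; have xhr : `|x + h - x| < r by rewrite addrAC subrr add0r.
have xr : `|x - x| < r by rewrite subrr normr0.
have [_] := Hr _ _ xhr xr; rewrite [x + h - x]addrAC subrr add0r.
have -> // : LL h = \sum_i h 0 i * 'D_(delta_mx 0 i) f x.
by rewrite /LL /= /L mxE; apply: eq_bigr => i _; rewrite mxE.
Qed.

Lemma C1_derive n (U : set 'rV[R]_n) (f : 'rV[R]_n -> R) x v :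
  open U -> Ck 1 U f -> U x -> is_derive x v f ((v *m grad f x) 0 0).
Proof.
move=> Uo fC Ux; have [fd fE] := C1_diff Uo fC Ux.
by rewrite -fE -deriveE//; apply: derivableP; exact: diff_derivable.
Qed.

Lemma Ck_comp k n m (U : set 'rV[R]_n) (W : set 'rV[R]_m) (f : 'rV[R]_m -> R)
    (h : 'rV[R]_n -> 'rV[R]_m) :
  open U -> open W -> (forall x, U x -> W (h x)) -> (forall i, Ck k U (fun x => h x 0 i)) ->
  Ck k W f -> Ck k U (fun x => f (h x)).
Proof.
move=> Uo Wo UW; elim: k f => [|k IH] f hC fC.
  split => // x Ux; apply: (@continuous_comp _ _ _ h f).
    by apply/continuous_rowP => i; exact: Ck_continuous (hC i) Ux.
  exact: Ck_continuous fC (UW x Ux).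
split=> [x Ux|i].
  apply: (@continuous_comp _ _ _ h f).
    by apply/continuous_rowP => j; exact: Ck_continuous (hC j) Ux.
  exact: Ck_continuous fC (UW x Ux).
exists (fun x => \sum_j 'D_(delta_mx 0 i) (fun x => h x 0 j) x * 'D_(delta_mx 0 j) f (h x)).
  move=> x Ux; have [fd fE] := C1_diff Wo (Ck_le (ltn0Sn k) fC) (UW x Ux).
  have hd : is_derive x (delta_mx 0 i) h (\row_j 'D_(delta_mx 0 i) (fun x => h x 0 j) x).
    apply/is_derive_lineP/is_derive_row => j; rewrite mxE.
    apply/(@is_derive_lineP _ _ (fun y => h y 0 j)); apply: derivableP.
    exact: (Ck_partial i Uo (hC j)).1.
  have := is_derive_diff_comp hd fd; rewrite fE mxE.
  by under eq_bigr => j _ do rewrite !mxE.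
apply: Ck_sum => j; apply: CkM; first exact: (Ck_partial i Uo (hC j)).2.
apply: (IH (fun y => 'D_(delta_mx 0 j) f y)); last exact: (Ck_partial j Wo fC).2.
by move=> l; exact: CkW.
Qed.

Lemma C1_map_Ck n m (X : 'rV[R]_n -> 'rV[R]_m) (U : set 'rV[R]_n) : open U ->
  (forall j, Ck 1 U (fun x => X x 0 j)) -> C1_map X U (jac X).
Proof.
move=> Uo XC x Ux e e0.
have n1 : 0 < n%:R + 1 :> R by rewrite ltr_wpDl.
have en : 0 < e / (n%:R + 1) by rewrite divr_gt0.
have fd i j y : U y -> is_derive y (delta_mx 0 i) (fun y => X y 0 j) (jac X y i j).
  by move=> Uy; rewrite mxE; apply: derivableP; apply: (Ck_partial i Uo (XC j)).1.
have gc i j : {for x, continuous (fun y => jac X y i j)}.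
  rewrite (_ : (fun y => _) = fun y => 'D_(delta_mx 0 i) (fun y => X y 0 j) y).
    exact: Ck_continuous (Ck_partial i Uo (XC j)).2 Ux.
  by apply/funext => y; rewrite mxE.
have near_f : \forall r \near (0 : R)^'+, forall j a b, `|a - x| < r -> `|b - x| < r ->
    `|X a 0 j - X b 0 j - \sum_i (a - b) 0 i * jac X x i j| <= e * `|a - b|.
  apply: filter_forall => j.
  have [r r0 Hr] := C1_strict Uo Ux (fun i y => @fd i j y) (fun i => gc i j) e0.
  apply: filterS (nbhs_right_lt r0) => q qr a b aq bq.
  by case: (Hr a b); rewrite ?(lt_trans _ qr).
have near_J : \forall r \near (0 : R)^'+, forall i j a, `|a - x| < r ->
    `|jac X a i j - jac X x i j| <= e / (n%:R + 1).
  apply: filter_forall => i; apply: filter_forall => j.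
  have /continuous_epsP/(_ _ en)[r r0 Hr] := gc i j.
  by apply: filterS (nbhs_right_lt r0) => q qr a aq; apply: Hr; exact: lt_trans qr.
have near_U : \forall r \near (0 : R)^'+, forall a, `|a - x| < r -> U a.
  have /nbhs_ballP[r /= r0 Hr] : nbhs x U by exact: open_nbhs_nbhs.
  apply: filterS (nbhs_right_lt r0) => q qr a aq; apply: Hr.
  by rewrite -ball_normE /= distrC (lt_trans aq).
have [r [/= r0 [[rf rJ] rU]]] :=
  filter_ex (filterI (nbhs_right_gt 0) (filterI (filterI near_f near_J) near_U)).
exists r => // a b ar br; split; first exact: rU.
- apply/norm_row_le; first by rewrite mulr_ge0// ltW.
  move=> j; rewrite !rowB mxE.
  exact: rf.
- move=> v; apply/norm_row_le; first by rewrite mulr_ge0// ltW.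
  move=> j; rewrite mxE (le_trans (ler_norm_sum _ _ _))//.
  apply: (@le_trans _ _ (\sum_(i < n) e / (n%:R + 1) * `|v|)); last first.
    rewrite sumr_const card_ord -[leLHS]mulr_natl mulrA ler_wpM2r//.
    by rewrite mulrA ler_pdivrMr// mulrC ler_pM2l// lerDl.
  apply: ler_sum => i _; rewrite normrM mulrC ler_pM// ?norm_coord_le//.
  have -> : (jac X a - jac X x) i j = jac X a i j - jac X x i j by rewrite !mxE.
  exact: rJ.
Qed.

Lemma C1_map_diff n m (X : 'rV[R]_n -> 'rV[R]_m) (U : set 'rV[R]_n) J x :
  C1_map X U J -> U x -> differentiable X x /\ 'd X x = mulmxr (J x) :> ('rV_n -> 'rV_m).
Proof.
move=> XC Ux; apply: differentiable_eps; first exact: mulmx_row_continuous.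
move=> e e0; have [r r0 Hr] := XC x Ux e e0; exists r => // h hr.
have xhr : `|x + h - x| < r by rewrite addrAC subrr add0r.
have xr : `|x - x| < r by rewrite subrr normr0.
by have [_ + _] := Hr _ _ xhr xr; rewrite [x + h - x]addrAC subrr add0r.
Qed.

End Ck.

(** * Analytic functions are smooth *)

Section Analytic.
Context {R : realType} {n : nat}.
Local Notation T := ('I_n -> nat).
Implicit Types (A F G : T -> R) (m : T -> T).

Lemma box_sumW F N M : (N <= M)%N ->
  box_sum F N = \sum_(alpha : {ffun 'I_n -> 'I_M} | [forall i, (alpha i < N)%N])
                   F (fun i => alpha i : nat).
Proof.
move=> NM; rewrite /box_sum.
(* The reindexing by [inord] needs a nonempty ['I_N]. For [N = 0] the box is empty unless [n = 0],
   when it still contains the one empty multi-index. *)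
case: N NM => [|N] NM.
  have [n0|n0] := posnP n.
    have f0 : forall i : 'I_n, False by rewrite n0 => -[].
    rewrite (eq_bigr (fun=> F (fun=> 0%N))); last first.
      by move=> a _; congr F; apply/funext => i; case: (f0 i).
    rewrite [RHS](eq_big predT (fun=> F (fun=> 0%N))); last 2 first.
    - by move=> a; apply/forallP => i; case: (f0 i).
    - by move=> a _; congr F; apply/funext => i; case: (f0 i).
    rewrite !sumr_const !card_ffun !card_ord.
    by have -> : (0 ^ n = M ^ n)%N by rewrite n0 !expn0.
  rewrite !big1// => [a /forallP/(_ (Ordinal n0))//|a _].
  by case: (a (Ordinal n0)).
pose h (a : {ffun 'I_n -> 'I_N.+1}) : {ffun 'I_n -> 'I_M} := [ffun i => widen_ord NM (a i)].
pose h' (b : {ffun 'I_n -> 'I_M}) : {ffun 'I_n -> 'I_N.+1} := [ffun i => inord (b i)].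
rewrite [RHS](reindex_onto h h') /=; last first.
  move=> b /forallP bN; apply/ffunP => i; rewrite !ffunE; apply/val_inj => /=.
  by rewrite inordK.
apply: eq_big => [a|a _]; last by congr F; apply/funext => i; rewrite ffunE.
apply/esym/andP; split; first by apply/forallP => i; rewrite ffunE /=.
by apply/eqP/ffunP => i; rewrite !ffunE; apply/val_inj => /=; rewrite inordK.
Qed.

Lemma box_sum_tail F G N M : (N <= M)%N -> (forall a, `|F a| <= G a) ->
  `|box_sum F M - box_sum F N| <= box_sum G M - box_sum G N.
Proof.
move=> NM FG; rewrite !(box_sumW _ NM) /box_sum.
rewrite [X in X - _](bigID (fun a : {ffun 'I_n -> 'I_M} => [forall i, (a i < N)%N]))/=.
rewrite [X in _ <= X - _](bigID (fun a : {ffun 'I_n -> 'I_M} => [forall i, (a i < N)%N]))/=.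
rewrite [X in `|X|]addrAC subrr add0r [leRHS]addrAC subrr add0r.
rewrite (le_trans (ler_norm_sum _ _ _))//.
by apply: ler_sum => a _; exact: FG.
Qed.

Lemma box_sum_nondecreasing G : (forall a, 0 <= G a) ->
  nondecreasing_seq (box_sum G).
Proof.
move=> G0 N M NM; rewrite -subr_ge0.
apply: le_trans (@box_sum_tail G G N M NM _) => // a; rewrite ger0_norm//.
Qed.

(* Differentiating term by term preserves the shape
   [\sum_alpha A alpha * \prod_i h_i ^+ m alpha i] without reindexing: the
   exponent [m alpha i] is decremented, and where it was 0 the new coefficient
   vanishes. *)
Definition psum A m N (h : 'rV[R]_n) : R :=
  box_sum (fun a => A a * \prod_i h 0 i ^+ m a i) N.

Definition weight A m (p : R) a : R := `|A a| * p ^+ (\sum_i m a i)%N.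

Variable r : R.

(** Absolute summability on every smaller polydisc, phrased as bounded partial sums: term-by-term
    differentiation can then be controlled box by box. *)
Definition summable A m := forall p, 0 < p < r ->
  exists M, forall N, box_sum (weight A m p) N <= M.

Lemma weight_ge0 A m p a : 0 < p -> 0 <= weight A m p a.
Proof. by move=> p0; rewrite mulr_ge0// exprn_ge0// ltW. Qed.

Lemma weight_cvg A m p : summable A m -> 0 < p < r -> cvgn (box_sum (weight A m p)).
Proof.
move=> Am pr; have [M HM] := Am p pr; case/andP: pr => p0 _.
apply: nondecreasing_is_cvgn; first by apply: box_sum_nondecreasing => a; exact: weight_ge0.
by exists M => _ [N _ <-].
Qed.

Definition rest A m p N : R := limn (box_sum (weight A m p)) - box_sum (weight A m p) N.

Lemma rest_cvg0 A m p : summable A m -> 0 < p < r -> rest A m p @ \oo --> 0.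
Proof.
move=> Am pr; rewrite -(subrr (limn (box_sum (weight A m p)))).
by apply: cvgB; [exact: cvg_cst|exact: weight_cvg].
Qed.

Lemma psum_tail A m p h N M : summable A m -> 0 < p < r -> `|h| <= p -> (N <= M)%N ->
  `|psum A m M h - psum A m N h| <= rest A m p N.
Proof.
move=> Am pr hp NM; have /andP[p0 _] := pr.
apply: (@le_trans _ _ (box_sum (weight A m p) M - box_sum (weight A m p) N)).
  apply: box_sum_tail => // a; rewrite normrM ler_wpM2l// normr_prod -prodrXr.
  by apply: ler_prod => i _; rewrite normr_ge0 normrX lerXn2r ?nnegrE ?(ltW p0)// (le_trans (norm_coord_le _ _)).
rewrite lerD2r; apply: nondecreasing_cvgn_le; last exact: weight_cvg.
by apply: box_sum_nondecreasing => a; exact: weight_ge0.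
Qed.

Lemma psum_cvg A m p h : summable A m -> 0 < p < r -> `|h| <= p -> cvgn (psum A m ^~ h).
Proof.
move=> Am pr hp; apply: (@cvg_tail _ _ (rest A m p)); last exact: rest_cvg0.
by move=> k l kl; exact: psum_tail.
Qed.

Lemma psum_lim A m p h l N : summable A m -> 0 < p < r -> `|h| <= p ->
  psum A m ^~ h @ \oo --> l -> `|psum A m N h - l| <= rest A m p N.
Proof.
move=> Am pr hp hl; rewrite distrC.
have cv : (fun M => `|psum A m M h - psum A m N h|) @ \oo --> `|l - psum A m N h|.
  by apply: cvg_norm; apply: cvgB hl _; exact: cvg_cst.
by apply: (le_lim cv); exists N => // M /= NM; exact: psum_tail.
Qed.

Definition dcoef i A m a := A a * (m a i)%:R.
Definition dexp i m a j := if j == i then (m a j).-1 else m a j.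

(** A single term of the binomial expansion. It absorbs the factor produced by differentiation at
    the cost of enlarging the radius from [p] to [p + d], which must stay below [r]. *)
Lemma bernoulli_deriv (p d : R) s : 0 <= p -> 0 <= d ->
  s%:R * p ^+ s.-1 * d <= (p + d) ^+ s.
Proof.
move=> p0 d0; elim: s => [|s IH]; first by rewrite !mul0r expr0.
rewrite exprS /= -natr1 mulrDl mul1r mulrDl.
have h1 : p ^+ s <= (p + d) ^+ s by rewrite lerXn2r ?nnegrE ?addr_ge0// lerDl.
have h2 : s%:R * p ^+ s * d <= p * (p + d) ^+ s.
  case: s IH {h1} => [|s] IH; first by rewrite !mul0r mulr_ge0// exprn_ge0// addr_ge0.
  rewrite exprS (_ : _ * d = p * (s.+1%:R * p ^+ s * d)); last by ring.
  by rewrite ler_wpM2l.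
by rewrite mulrDl lerD// mulrC ler_wpM2l.
Qed.

Lemma summable_deriv i A m : summable A m -> summable (dcoef i A m) (dexp i m).
Proof.
move=> Am p /andP[p0 pr].
pose d := (r - p) / 2; have d0 : 0 < d by rewrite divr_gt0// subr_gt0.
have pd : 0 < p + d < r by rewrite /d; apply/andP; split; lra.
have [M HM] := Am _ pd; exists (d^-1 * M) => N.
apply: (@le_trans _ _ (d^-1 * box_sum (weight A m (p + d)) N)); last first.
  by rewrite ler_wpM2l// invr_ge0 ltW.
rewrite /box_sum mulr_sumr; apply: ler_sum => b _.
set a : T := fun i => b i : nat; rewrite /weight /dcoef.
rewrite normrM -mulrA [leRHS]mulrCA ler_wpM2l// [`|_%:R|]ger0_norm//.
rewrite [leRHS]mulrC ler_pdivlMr//.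
set s := (\sum_j m a j)%N.
have [m0|m0] := posnP (m a i).
  by rewrite m0 !mul0r exprn_ge0// ltW//; case/andP: pd.
have E : (\sum_j dexp i m a j)%N = s.-1.
  rewrite /s (bigD1 i)//= [in RHS](bigD1 i)//= /dexp eqxx.
  rewrite (eq_bigr (m a)) => [|j /negPf ->//].
  by case: (m a i) m0.
rewrite E; apply: le_trans (bernoulli_deriv s (ltW p0) (ltW d0)).
rewrite ler_wpM2r ?(ltW d0)// ler_wpM2r ?exprn_ge0 ?(ltW p0)// ler_nat.
by rewrite /s (bigD1 i)//= leq_addr.
Qed.

Lemma is_derive_pow (V : normedModType R) (f : V -> R) k x v d :
  is_derive x v f d -> is_derive x v (fun y => f y ^+ k) (k%:R * f x ^+ k.-1 * d).
Proof.
move=> fd; elim: k => [|k IH].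
  by rewrite !mul0r (_ : (fun y => _) = cst 1)//; exact: is_derive_cst.
have -> : (fun y => f y ^+ k.+1) = f * (fun y => f y ^+ k).
  by apply/funext => y; rewrite exprS.
apply: is_derive_eq; rewrite /GRing.scale /= -natr1.
by case: k {IH} => [|k] /=; rewrite ?exprS ?expr0; ring.
Qed.

Lemma psum_deriv i A m N (h : 'rV[R]_n) :
  is_derive h (delta_mx 0 i) (psum A m N) (psum (dcoef i A m) (dexp i m) N h).
Proof.
apply/(@is_derive_lineP _ _ _ (psum A m N)).
pose C (a : T) := \prod_(j | j != i) h 0 j ^+ m a j.
have E (s : R) : psum A m N (h + s *: delta_mx 0 i) =
    \sum_(b : {ffun 'I_n -> 'I_N}) A (fun i => b i : nat) *
      ((h 0 i + s) ^+ m (fun i => b i : nat) i * C (fun i => b i : nat)).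
  apply: eq_bigr => b _; congr (_ * _); rewrite (bigD1 i)//=; congr (_ * _).
    by rewrite !mxE !eqxx mulr1.
  by apply: eq_bigr => j ji; rewrite !mxE (negPf ji) andbF mulr0 addr0.
rewrite (funext E).
rewrite /psum /box_sum.
pose f (b : {ffun 'I_n -> 'I_N}) (s : R) := A (fun i => b i : nat) *
      ((h 0 i + s) ^+ m (fun i => b i : nat) i * C (fun i => b i : nat)).
rewrite (_ : (fun s => _) = fun s => \sum_b f b s)//.
have fd (b : {ffun 'I_n -> 'I_N}) (a : T := fun i => b i : nat) :
  is_derive (0 : R) 1 (f b) (dcoef i A m a * \prod_j h 0 j ^+ dexp i m a j).
  rewrite /f -/a (bigD1 i)//= /dexp eqxx.
  rewrite (eq_bigr (fun j => h 0 j ^+ m a j)) => [|j /negPf ->//].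
  rewrite -/(C a).
  have x1 : is_derive (0 : R) 1 (fun s : R => h 0 i + s) 1.
    by have := is_deriveD (is_derive_cst (h 0 i) (0 : R) 1) (is_derive_id (0 : R) 1); rewrite add0r.
  have := is_derive_pow (m a i) x1; rewrite addr0 => x2.
  by apply: is_derive_eq; rewrite /dcoef /GRing.scale/=; ring.
exact: is_derive_big_sum.
Qed.

Lemma psum_continuous A m N : continuous (psum A m N).
Proof.
move=> h; apply: continuous_sum => b.
apply: continuousM; first exact: cst_continuous.
by apply: (Ck_continuous (k := 0) (U := setT)) => //; apply: Ck_prod => i; apply: CkX; exact: Ck_coord.
Qed.

Lemma row_ball_open : open [set h : 'rV[R]_n | `|h| < r].
Proof.
rewrite openE => h /= hr; apply/nbhs_ballP; exists (r - `|h|); first by rewrite /= subr_gt0.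
move=> y; rewrite -ball_normE /= distrC ltrBrDr => /(le_lt_trans _); apply.
by rewrite -[X in `|X| <= _](subrK h) ler_normD.
Qed.

(** On [|h| <= p] with [p < r] the partial sums converge uniformly, and so do their derivatives,
    which have the same shape; the induction on [k] therefore applies to the differentiated
    family. *)
Lemma psum_Ck k A m (f : 'rV[R]_n -> R) : summable A m ->
  (forall h, `|h| < r -> psum A m ^~ h @ \oo --> f h) ->
  Ck k [set h | `|h| < r] f.
Proof.
elim: k A m f => [|k IH] A m f Am fl.
  split => // h /= hr; apply/continuous_epsP => e e0.
  (* A radius strictly between [|h|] and [r] leaves room for the points near [h]. *)
  pose p := (`|h| + r) / 2.
  have pr : 0 < p < r by have := normr_ge0 h; rewrite /p => ?; apply/andP; split; lra.
  have hp : `|h| < p by rewrite /p; lra.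
  have e3 : 0 < e / 3 by rewrite divr_gt0.
  have /cvgrPdist_le/(_ _ e3)[N _ /(_ N (leqnn N))] := rest_cvg0 Am pr.
  rewrite sub0r normrN => /(le_trans (ler_norm _)) restN.
  have /continuous_epsP/(_ _ e3)[d d0 Hd] := @psum_continuous A m N h.
  exists (Num.min d (p - `|h|)); first by rewrite lt_min d0 subr_gt0.
  move=> y; rewrite lt_min => /andP[yd yp].
  have y_p : `|y| <= p.
    have : `|y| <= `|y - h| + `|h| by rewrite -[X in `|X| <= _](subrK h) ler_normD.
    lra.
  have /andP[_ pr'] := pr.
  have b1 := @psum_lim _ _ _ _ _ N Am pr y_p (fl y (le_lt_trans y_p pr')).
  have b2 := @psum_lim _ _ _ _ _ N Am pr (ltW hp) (fl h hr).
  have b3 := Hd y yd.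
  have -> : f y - f h = (psum A m N y - psum A m N h) - (psum A m N y - f y) + (psum A m N h - f h) by ring.
  rewrite (le_trans (ler_normD _ _))// (_ : e = e / 3 + e / 3 + e / 3); last by field.
  apply: lerD; last exact: le_trans restN.
  by rewrite (le_trans (ler_normB _ _))// lerD// (le_trans b1).
have fc := IH A m f Am fl.
split=> [h hr|i]; first exact: Ck_continuous fc hr.
have Dm := summable_deriv i Am.
pose g h := limn (psum (dcoef i A m) (dexp i m) ^~ h).
have gl h : `|h| < r -> psum (dcoef i A m) (dexp i m) ^~ h @ \oo --> g h.
  move=> hr; pose p := (`|h| + r) / 2.
  have pr : 0 < p < r by have := normr_ge0 h; rewrite /p => ?; apply/andP; split; lra.
  by apply: (psum_cvg Dm pr); rewrite /p; lra.
have gC : Ck k [set h | `|h| < r] g := IH _ _ _ Dm gl.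
exists g => // h /= hr; apply/is_derive_lineP.
pose p := (`|h| + r) / 2.
have pr : 0 < p < r by have := normr_ge0 h; rewrite /p => ?; apply/andP; split; lra.
have hp : 0 < p - `|h| by rewrite /p; lra.
have /andP[_ pr'] := pr.
have line s : `|s - 0| < p - `|h| -> `|h + s *: delta_mx 0 i| <= p.
  rewrite subr0 => sp; rewrite (le_trans (ler_normD _ _))// normrZ.
  have d1 : `|delta_mx 0 i : 'rV[R]_n| <= 1.
    by apply/norm_row_le => // j; rewrite mxE eqxx /=; case: eqP => _; rewrite ?normr1 ?normr0.
  by have := ler_wpM2l (normr_ge0 s) d1; lra.
have := @is_derive_unif_limit R (fun N s => psum A m N (h + s *: delta_mx 0 i))
  (fun N s => psum (dcoef i A m) (dexp i m) N (h + s *: delta_mx 0 i))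
  (fun s => f (h + s *: delta_mx 0 i)) (fun s => g (h + s *: delta_mx 0 i))
  (rest (dcoef i A m) (dexp i m) p) 0 (p - `|h|) hp.
rewrite scale0r addr0; apply.
- by move=> N s _; apply: is_derive_line; exact: psum_deriv.
- move=> N s sp; have hs := line s sp.
  exact: (psum_lim N Dm pr hs (gl _ (le_lt_trans hs pr'))).
- exact: rest_cvg0.
- by move=> s sp; apply: fl; exact: le_lt_trans (line s sp) pr'.
- apply: (@continuous_comp _ _ _ (fun s : R => h + s *: delta_mx 0 i) g).
    by apply: continuousD; [exact: cst_continuous|exact: scalel_continuous].
  by rewrite scale0r addr0; exact: Ck_continuous gC hr.
Qed.

End Analytic.

Section AnalyticCk.
Context {R : realType} {n : nat}.

(** A power series lives on a ball that depends on its centre, so smoothness has to be glued; the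
    derivatives ['D] provide one choice of witnesses for all neighbourhoods. *)
Lemma Ck_local k (U : set 'rV[R]_n) f : open U ->
  (forall x, U x -> exists2 W : set 'rV[R]_n, open W /\ W x & Ck k W f) -> Ck k U f.
Proof.
move=> Uo; elim: k f => [|k IH] f H.
  by split => // x /H[W [_ Wx] fC]; exact: Ck_continuous fC Wx.
split=> [x /H[W [_ Wx] fC]|i]; first exact: Ck_continuous fC Wx.
exists (fun x => 'D_(delta_mx 0 i) f x).
  move=> x /H[W [Wo Wx] fC]; apply: derivableP; exact: (Ck_partial i Wo fC).1.
apply: IH => x /H[W [Wo Wx] fC]; exists W => //.
exact: (Ck_partial i Wo fC).2.
Qed.

Lemma real_analytic_Ck k (D : set 'rV[R]_n) (f : 'rV[R]_n -> R) :
  open D -> real_analytic_on D f -> Ck k D f.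
Proof.
move=> Do fa; apply: Ck_local => // a /fa[c [r [r0 H]]].
exists [set x | `|x - a| < r].
  split; last by rewrite /= subrr normr0.
  rewrite (_ : [set x | _] = ball a r); first exact: ball_open.
  by apply/seteqP; split => x; rewrite -ball_normE /= distrC.
have Bo : open [set x : 'rV[R]_n | `|x - a| < r].
  rewrite (_ : [set x | _] = ball a r); first exact: ball_open.
  by apply/seteqP; split => x; rewrite -ball_normE /= distrC.
(* Absolute convergence at the diagonal point [(p, ..., p)] is exactly summability of the weights at
   radius [p]. *)
have cs : summable r c id.
  move=> p /andP[p0 pr].
  have [|cv _] := H (const_mx p).
    by move=> i; rewrite mxE gtr0_norm.
  exists (limn (box_sum (fun alpha => `|c alpha * \prod_i (const_mx p : 'rV[R]_n) 0 i ^+ alpha i|))) => N.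
  rewrite (_ : weight c id p = fun alpha => `|c alpha * \prod_i (const_mx p : 'rV[R]_n) 0 i ^+ alpha i|).
    apply: nondecreasing_cvgn_le; last exact: cv.
    by apply: box_sum_nondecreasing => alpha.
  apply/funext => alpha; rewrite normrM normr_prod /weight -prodrXr; congr (_ * _).
  by apply: eq_bigr => i _; rewrite mxE normrX gtr0_norm.
have fl (h : 'rV[R]_n) : `|h| < r -> psum c id ^~ h @ \oo --> f (a + h).
  by move=> hr; have [|_] := H h; first by move=> i; exact: le_lt_trans (norm_coord_le _ _) hr.
have := psum_Ck k cs fl.
move=> /(@Ck_comp _ k n n [set x | `|x - a| < r] _ _ (fun x => x - a) Bo (@row_ball_open _ _ r)).
rewrite (_ : (fun x => f (a + (x - a))) = f); last first.
  by apply/funext => x; rewrite addrC subrK.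
apply => // i; rewrite (_ : (fun x => _) = fun x : 'rV[R]_n => x 0 i - a 0 i).
  by apply: CkB; [exact: Ck_coord|exact: Ck_cst].
by apply/funext => x; rewrite rowB.
Qed.

End AnalyticCk.

(** * Scalar products and Hamiltonian fields *)

Section Dot.
Context {R : realType} {n : nat}.
Implicit Types u v w : 'rV[R]_n.

Lemma dotvC u v : dotv u v = dotv v u.
Proof. by apply: eq_bigr => i _; rewrite mulrC. Qed.

Lemma dotvDl u v w : dotv (u + v) w = dotv u w + dotv v w.
Proof. by rewrite /dotv -big_split/=; apply: eq_bigr => i _; rewrite mxE mulrDl. Qed.

Lemma dotvZl k u v : dotv (k *: u) v = k * dotv u v.
Proof. by rewrite /dotv mulr_sumr; apply: eq_bigr => i _; rewrite mxE mulrA. Qed.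

Lemma dotvDr u v w : dotv u (v + w) = dotv u v + dotv u w.
Proof. by rewrite dotvC dotvDl !(dotvC u). Qed.

Lemma dotvZr k u v : dotv u (k *: v) = k * dotv u v.
Proof. by rewrite dotvC dotvZl dotvC. Qed.

Lemma dotvNl u v : dotv (- u) v = - dotv u v.
Proof. by rewrite -scaleN1r dotvZl mulN1r. Qed.

Lemma dotvNr u v : dotv u (- v) = - dotv u v.
Proof. by rewrite dotvC dotvNl dotvC. Qed.

Lemma dotv0 u : dotv u 0 = 0.
Proof. by apply: big1 => i _; rewrite mxE mulr0. Qed.

Lemma dot0v u : dotv 0 u = 0.
Proof. by rewrite dotvC dotv0. Qed.

Lemma dotv_delta u i : dotv u (delta_mx 0 i) = u 0 i.
Proof.
rewrite /dotv (bigD1 i)//= mxE !eqxx mulr1 big1 ?addr0// => j ji.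
by rewrite mxE (negPf ji) andbF mulr0.
Qed.

Lemma dotv_ge0 u : 0 <= dotv u u.
Proof. by apply: sumr_ge0 => i _; rewrite -expr2 sqr_ge0. Qed.

Lemma dotv_gt0 u : u != 0 -> 0 < dotv u u.
Proof.
move=> u0; rewrite lt_neqAle dotv_ge0 andbT eq_sym; apply: contra u0.
rewrite psumr_eq0 => [/allP H|i _]; last by rewrite -expr2 sqr_ge0.
apply/eqP/rowP => i; rewrite mxE; have := H i (mem_index_enum _).
by rewrite mulf_eq0 orbb => /eqP.
Qed.

Lemma enorm_sqr u : enorm u ^+ 2 = dotv u u.
Proof. by rewrite sqr_sqrtr// dotv_ge0. Qed.

Lemma enorm_gt0 u : u != 0 -> 0 < enorm u.
Proof. by move=> u0; rewrite sqrtr_gt0 dotv_gt0. Qed.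

End Dot.

Definition dotvE := (@dotvDl, @dotvDr, @dotvNl, @dotvNr, @dotvZl, @dotvZr, @dotv0, @dot0v).

Section Dot2.
Context {R : realType}.

Lemma dotv_row_mx n m (a c : 'rV[R]_n) (b d : 'rV[R]_m) :
  dotv (row_mx a b) (row_mx c d) = dotv a c + dotv b d.
Proof.
rewrite /dotv big_split_ord/=; congr (_ + _); apply: eq_bigr => i _.
  by rewrite !row_mxEl.
by rewrite !row_mxEr.
Qed.

Lemma dotv_cons4 (a b : R) v w : dotv (cons4 a v) (cons4 b w) = a * b + dotv v w.
Proof.
apply: etrans (@dotv_row_mx 1 3 _ _ _ _) _.
by rewrite /dotv big_ord1 !mxE eqxx !mulr1n.
Qed.

Lemma cons4_eta (v : 'rV[R]_4) : v = cons4 (v 0 0) (vec3 v).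
Proof.
have E : lsubmx (v : 'rV[R]_(1 + 3)) = (v 0 0)%:M.
  by apply/rowP => i; rewrite ord1 !mxE eqxx mulr1n; congr (v 0 _); exact/val_inj.
by rewrite /cons4 /vec3 -E (@hsubmxK _ 1 1 3).
Qed.

Lemma cons40 (a : R) v : cons4 a v 0 0 = a.
Proof.
rewrite /cons4 (_ : 0 = lshift 3 (0 : 'I_1)); last exact/val_inj.
by rewrite (@row_mxEl _ 1 1 3) mxE eqxx mulr1n.
Qed.

Lemma cons4S (a : R) v (i : 'I_3) : cons4 a v 0 (rshift 1 i) = v 0 i.
Proof. by rewrite /cons4 (@row_mxEr _ 1 1 3). Qed.

Lemma vec3_cons4 (a : R) v : vec3 (cons4 a v) = v.
Proof. by rewrite /vec3 /cons4 row_mxKr. Qed.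

Lemma cons4D (a b : R) v w : cons4 a v + cons4 b w = cons4 (a + b) (v + w).
Proof. by rewrite /cons4 (@add_row_mx _ 1 1 3) raddfD. Qed.

Lemma cons4Z k (a : R) v : k *: cons4 a v = cons4 (k * a) (k *: v).
Proof. by rewrite /cons4 (@scale_row_mx _ 1 1 3) scale_scalar_mx. Qed.

Lemma cons4N (a : R) v : - cons4 a v = cons4 (- a) (- v).
Proof. by rewrite -scaleN1r cons4Z mulN1r scaleN1r. Qed.

End Dot2.

Section VectorDerivative.
Context {R : realType} {V : normedModType R}.
Implicit Types (x v : V).

Lemma is_derive_dotv n (F G : V -> 'rV[R]_n) dF dG x v :
  is_derive x v F dF -> is_derive x v G dG ->
  is_derive x v (fun y => dotv (F y) (G y)) (dotv dF (G x) + dotv (F x) dG).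
Proof.
move=> /is_derive_row Fd /is_derive_row Gd; rewrite /dotv -big_split/=.
apply: is_derive_big_sum => i; have := Fd i; have := Gd i => ? ?.
by apply: is_derive_eq; rewrite /GRing.scale/=; ring.
Qed.

Lemma is_derive_scale n (k : V -> R) (F : V -> 'rV[R]_n) dk dF x v :
  is_derive x v k dk -> is_derive x v F dF ->
  is_derive x v (fun y => k y *: F y) (dk *: F x + k x *: dF).
Proof.
move=> kd /is_derive_row Fd; apply/is_derive_row => i.
rewrite (_ : (fun y => _) = fun y => k y * F y 0 i); last by apply/funext => y; rewrite mxE.
by have := Fd i => ?; apply: is_derive_eq; rewrite !mxE /GRing.scale/=; ring.
Qed.

Lemma is_derive_row_mx n m (F : V -> 'rV[R]_n) (G : V -> 'rV[R]_m) dF dG x v :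
  is_derive x v F dF -> is_derive x v G dG ->
  is_derive x v (fun y => row_mx (F y) (G y)) (row_mx dF dG).
Proof.
move=> /is_derive_row Fd /is_derive_row Gd; apply/is_derive_row => i.
rewrite mxE; case: splitP => j ij.
  have := Fd j; congr (is_derive _ _ _ _); apply/funext => y.
  by rewrite (_ : i = lshift m j) ?row_mxEl//; exact/val_inj.
have := Gd j; congr (is_derive _ _ _ _); apply/funext => y.
by rewrite (_ : i = rshift n j) ?row_mxEr//; exact/val_inj.
Qed.

Lemma is_derive_cons4 (a : V -> R) (F : V -> 'rV[R]_3) da dF x v :
  is_derive x v a da -> is_derive x v F dF ->
  is_derive x v (fun y => cons4 (a y) (F y)) (cons4 da dF).
Proof.
move=> ad Fd; apply: (@is_derive_row_mx 1 3) => //; apply/is_derive_row => i.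
rewrite (_ : (fun y => _) = a); first by rewrite ord1 mxE eqxx mulr1n.
by apply/funext => y; rewrite ord1 mxE eqxx mulr1n.
Qed.

Lemma is_derive_lsubmx n m (z v : 'rV[R]_(n + m)) : is_derive z v lsubmx (lsubmx v).
Proof.
apply/is_derive_row => i; rewrite mxE.
rewrite (_ : (fun y => _) = fun y : 'rV[R]_(n + m) => y 0 (lshift m i)); first exact: is_derive_coord.
by apply/funext => y; rewrite mxE.
Qed.

Lemma is_derive_rsubmx n m (z v : 'rV[R]_(n + m)) : is_derive z v rsubmx (rsubmx v).
Proof.
apply/is_derive_row => i; rewrite mxE.
rewrite (_ : (fun y => _) = fun y : 'rV[R]_(n + m) => y 0 (rshift n i)); first exact: is_derive_coord.
by apply/funext => y; rewrite mxE.
Qed.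

End VectorDerivative.

Section HamGeneral.
Context {R : realType} {n : nat}.
Implicit Types (f : 'rV[R]_(n + n) -> R) (U : set 'rV[R]_(n + n)).

Lemma grad_row_mx f z (a b : 'rV[R]_n) :
  (row_mx a b *m grad f z) 0 0 = dotv a (dpos f z) + dotv b (dmom f z).
Proof.
rewrite mxE big_split_ord/=; congr (_ + _); apply: eq_bigr => i _.
  by rewrite row_mxEl !mxE delta_mx_lshift.
by rewrite row_mxEr !mxE delta_mx_rshift.
Qed.

Lemma grad_ham_field f z : (ham_field f z *m grad f z) 0 0 = 0.
Proof. by rewrite grad_row_mx dotvNl dotvC subrr. Qed.

Lemma Ck_dpos k f U i : open U -> Ck k.+1 U f -> Ck k U (fun z => dpos f z 0 i).
Proof.
move=> Uo fC; rewrite (_ : (fun z => _) = fun z => 'D_(delta_mx 0 (lshift n i)) f z).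
  exact: (Ck_partial _ Uo fC).2.
by apply/funext => z; rewrite mxE delta_mx_lshift.
Qed.

Lemma Ck_dmom k f U i : open U -> Ck k.+1 U f -> Ck k U (fun z => dmom f z 0 i).
Proof.
move=> Uo fC; rewrite (_ : (fun z => _) = fun z => 'D_(delta_mx 0 (rshift n i)) f z).
  exact: (Ck_partial _ Uo fC).2.
by apply/funext => z; rewrite mxE delta_mx_rshift.
Qed.

Lemma Ck_ham_field k f U i : open U -> Ck k.+1 U f -> Ck k U (fun z => ham_field f z 0 i).
Proof.
move=> Uo fC; case: (split_ordP i) => j ->.
  rewrite (_ : (fun z => _) = fun z => dmom f z 0 j); first exact: Ck_dmom.
  by apply/funext => z; rewrite row_mxEl.
rewrite (_ : (fun z => _) = fun z => - dpos f z 0 j); first by apply: CkN; exact: Ck_dpos.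
by apply/funext => z; rewrite row_mxEr mxE.
Qed.

End HamGeneral.

(** * The Moser map *)

Section MoserAlgebra.
Context {R : realType}.

(* [x = - p], [y = q] and [r = (|x|^2 + 1) / 2 = 1 / (1 - xi_0)]. *)
Definition moser_vec (x y : 'rV[R]_3) (r : R) : 'rV[R]_(4 + 4) :=
  row_mx (cons4 (1 - r^-1) (r^-1 *: x))
         (cons4 (dotv x y) (r *: y - dotv x y *: x)).

(** The differential of [moser_vec] with [r] bound to [(|x|^2 + 1) / 2]: then [r] has derivative
    [dotv x dx], and [1 - r^-1] has derivative [r^-1 ^+ 2 * dotv x dx]. *)
Definition dmoser_vec (x y dx dy : 'rV[R]_3) (r : R) : 'rV[R]_(4 + 4) :=
  row_mx (cons4 (r^-1 ^+ 2 * dotv x dx) (r^-1 *: dx - (r^-1 ^+ 2 * dotv x dx) *: x))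
         (cons4 (dotv dx y + dotv x dy)
                (dotv x dx *: y + r *: dy - (dotv dx y + dotv x dy) *: x - dotv x y *: dx)).

(** The field [constrained_field] in explicit form, with [a] and [b] standing for the derivatives of
    [Q] in [xi] and [eta]; [alpha] and [beta] are the Lagrange multipliers of the constraints [f1]
    and [f2], up to constant factors. *)
Definition projected_vec (xi eta a b : 'rV[R]_4) : 'rV[R]_(4 + 4) :=
  let alpha := (dotv eta b - dotv xi a) / dotv xi xi in
  let beta := dotv xi b / dotv xi xi in
  row_mx (b - beta *: xi) (- a - alpha *: xi + beta *: eta).

(* [gy] and [gx] are the derivatives of [Q \o moser] in [y] and [x], where
   [(a0, A)] and [(b0, B)] are the derivatives of [Q] in [xi] and [eta]; the
   identity says that the Moser map is symplectic onto T*S^3. *)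
Lemma dmoser_vec_hamiltonian (x y A B : 'rV[R]_3) (a0 b0 r : R) : r != 0 -> dotv x x = 2 * r - 1 ->
  let u := dotv x y in
  let gy := b0 *: x + r *: B - dotv B x *: x in
  let gx := (r^-1 ^+ 2 * a0) *: x + r^-1 *: A - (r^-1 ^+ 2 * dotv A x) *: x
            + b0 *: y + dotv B y *: x - dotv B x *: y - u *: B in
  dmoser_vec x y gy (- gx) r =
  projected_vec (cons4 (1 - r^-1) (r^-1 *: x)) (cons4 u (r *: y - u *: x))
    (cons4 a0 A) (cons4 b0 B).
Proof.
move=> r0 xx u gy gx; rewrite /dmoser_vec /projected_vec.
have xi1 : dotv (cons4 (1 - r^-1) (r^-1 *: x)) (cons4 (1 - r^-1) (r^-1 *: x)) = 1.
  by rewrite dotv_cons4 !dotvE xx; field.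
rewrite xi1 !divr1 !dotv_cons4 !cons4Z !cons4N !cons4D /gy /gx !dotvE -/u.
rewrite ?(dotvC y x) ?(dotvC B x) ?(dotvC A x) ?(dotvC y B) ?(dotvC y A) ?xx -?/u.
congr row_mx; congr cons4; try (apply/rowP => i; rewrite !mxE); field => //.
Qed.


Implicit Types z v : 'rV[R]_(3 + 3).

Definition moser_r z : R := (dotv (rsubmx z) (rsubmx z) + 1) / 2.

Lemma moser_r_gt0 z : 0 < moser_r z.
Proof. by rewrite divr_gt0// ltr_wpDl// dotv_ge0. Qed.

Lemma moserE z : moser z = moser_vec (- rsubmx z) (lsubmx z) (moser_r z).
Proof.
rewrite /moser /moser_vec enorm_sqr !dotvE opprK; set n2 := dotv _ _.
have n0 : n2 + 1 != 0 by rewrite gt_eqF// ltr_wpDl// dotv_ge0.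
rewrite /moser_r -/n2; congr (row_mx (cons4 _ (_ *: _)) _); first by field.
by rewrite invf_div.
Qed.

Definition dmoser z v :=
  dmoser_vec (- rsubmx z) (lsubmx z) (- rsubmx v) (lsubmx v) (moser_r z).

Lemma is_derive_moser z v : is_derive z v moser (dmoser z v).
Proof.
rewrite (funext moserE) /moser_vec /dmoser /dmoser_vec.
have yd := is_derive_lsubmx z v; have pd := is_derive_rsubmx z v.
have xd : is_derive z v (fun z => - rsubmx z) (- rsubmx v) by exact: is_deriveN.
set x := - rsubmx z; set dx := - rsubmx v; set y := lsubmx z; set dy := lsubmx v.
have rd : is_derive z v moser_r (dotv x dx).
  have h := is_derive_dotv pd pd.
  rewrite (_ : moser_r = fun z => (dotv (rsubmx z) (rsubmx z) + 1) * 2^-1)//.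
  apply: is_derive_eq; rewrite /GRing.scale/= /x /dx !dotvE (dotvC (rsubmx v)).
  by field.
have r0 : moser_r z != 0 by rewrite gt_eqF// moser_r_gt0.
have rid := is_derive_inv r0 rd; set r := moser_r z in rid *.
have ud := is_derive_dotv xd yd.
apply: is_derive_row_mx; apply: is_derive_cons4.
- apply: is_derive_eq; ring.
- have h := is_derive_scale rid xd; apply: is_derive_eq.
  by rewrite -/x -/dx -/r; apply/rowP => i; rewrite !mxE; ring.
- have h := is_derive_scale rd yd; have h2 := is_derive_scale ud xd.
  apply: is_derive_eq; rewrite -/x -/dx -/y -/dy -/r.
  by apply/rowP => i; rewrite !mxE; ring.
Qed.

Lemma moser_q_moser z : moser_q (moser z) = lsubmx z.
Proof.
rewrite moserE /moser_q /moser_vec row_mxKl row_mxKr !cons40 !vec3_cons4.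
have r0 : moser_r z != 0 by rewrite gt_eqF// moser_r_gt0.
set x := - rsubmx z; set y := lsubmx z; set r := moser_r z in r0 *.
by apply/rowP => i; rewrite !mxE; field.
Qed.

Lemma dotv_moser z : dotv (rsubmx z) (rsubmx z) = 2 * moser_r z - 1.
Proof. by rewrite /moser_r; field. Qed.

Lemma dotv_xi_moser z : dotv (lsubmx (moser z)) (lsubmx (moser z)) = 1.
Proof.
rewrite moserE row_mxKl dotv_cons4 !dotvE ?opprK dotv_moser.
by have := moser_r_gt0 z => /lt0r_neq0 r0; field.
Qed.

Lemma dotv_xi_eta_moser z : dotv (lsubmx (moser z)) (rsubmx (moser z)) = 0.
Proof.
rewrite moserE row_mxKl row_mxKr dotv_cons4 !dotvE ?opprK dotv_moser.
by have := moser_r_gt0 z => /lt0r_neq0 r0; field.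
Qed.

(** Along the Moser map [1 - xi_0 = 1 / r], [|eta| = r |q|] and [xi_2 eta_1 - xi_1 eta_2 = p_1 q_2 -
    p_2 q_1]. Since [r - 1/2 = |p|^2 / 2], the base of the square in [Qreg] is
    [(H - c + g / |q|) / r], and multiplication by [|eta|] clears both denominators. *)
Lemma Qreg_moser g c V z : g != 0 -> lsubmx z != 0 ->
  Qreg g c V (moser z) =
  (2 * g)^-1 * (enorm (lsubmx z) * (Ham g V z - c) + g) ^+ 2.
Proof.
move=> g0 q0; rewrite /Qreg moser_q_moser enorm_sqr moserE /moser_vec row_mxKl row_mxKr.
have r0 : moser_r z != 0 by rewrite gt_eqF// moser_r_gt0.
have xx := dotv_moser z.
have Hq : Ham g V z = 2^-1 * (2 * moser_r z - 1) + rsubmx z 0 0 * lsubmx z 0 1 -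
    rsubmx z 0 1 * lsubmx z 0 0 - g / enorm (lsubmx z) + V (lsubmx z).
  by rewrite /Ham enorm_sqr -xx.
rewrite Hq; have N0 : enorm (lsubmx z) != 0 by rewrite gt_eqF// enorm_gt0.
have := enorm_sqr (lsubmx z); move: r0 xx N0 {Hq q0}.
move: (moser_r z) (rsubmx z) (lsubmx z) => r p q r0 xx N0.
rewrite (_ : (2 : 'I_4) = rshift 1 (1 : 'I_3)); last exact/val_inj.
rewrite (_ : (1 : 'I_4) = rshift 1 (0 : 'I_3)); last exact/val_inj.
move: (enorm q) N0 => N N0 NE.
rewrite !cons40 !cons4S dotv_cons4 !mxE !dotvE (dotvC q p) xx -NE.
by field; rewrite g0 N0.
Qed.

End MoserAlgebra.

(** * The constrained field along the Moser map *)

Section Constraints.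
Context {R : realType}.
Implicit Types (w v : 'rV[R]_(4 + 4)) (Q : 'rV[R]_(4 + 4) -> R).

Lemma is_derive_f1 w v : is_derive w v (@f1 R) (2 * dotv (lsubmx w) (lsubmx v)).
Proof.
have wd := is_derive_lsubmx w v; have h := is_derive_dotv wd wd.
rewrite (_ : f1 = fun w => dotv (lsubmx w) (lsubmx w) - 1); last first.
  by apply/funext => x; rewrite /f1 enorm_sqr.
by apply: is_derive_eq; rewrite subr0 (dotvC (lsubmx v)) mulr_natl.
Qed.

Lemma is_derive_f2 w v :
  is_derive w v (@f2 R) (dotv (lsubmx v) (rsubmx w) + dotv (lsubmx w) (rsubmx v)).
Proof. exact: is_derive_dotv (is_derive_lsubmx w v) (is_derive_rsubmx w v). Qed.

Lemma dpos_f1 w : dpos f1 w = 2 *: lsubmx w.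
Proof.
apply/rowP => i; rewrite mxE.
have [_ ->] := is_derive_f1 w (row_mx (delta_mx 0 i) 0).
by rewrite row_mxKl dotv_delta !mxE.
Qed.

Lemma dmom_f1 w : dmom f1 w = 0.
Proof.
apply/rowP => i; rewrite mxE.
have [_ ->] := is_derive_f1 w (row_mx 0 (delta_mx 0 i)).
by rewrite row_mxKl dotv0 mulr0 mxE.
Qed.

Lemma dpos_f2 w : dpos f2 w = rsubmx w.
Proof.
apply/rowP => i; rewrite mxE.
have [_ ->] := is_derive_f2 w (row_mx (delta_mx 0 i) 0).
by rewrite row_mxKl row_mxKr dotv0 addr0 dotvC dotv_delta.
Qed.

Lemma dmom_f2 w : dmom f2 w = lsubmx w.
Proof.
apply/rowP => i; rewrite mxE.
have [_ ->] := is_derive_f2 w (row_mx 0 (delta_mx 0 i)).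
by rewrite row_mxKl row_mxKr dot0v add0r dotv_delta.
Qed.

Lemma poisson_f1f2 w : poisson f1 f2 w = 2 * dotv (lsubmx w) (lsubmx w).
Proof. by rewrite /poisson dpos_f1 dmom_f1 dmom_f2 dot0v subr0 dotvZl. Qed.

Lemma constrained_fieldE Q w : constrained_field Q w =
  projected_vec (lsubmx w) (rsubmx w) (dpos Q w) (dmom Q w).
Proof.
rewrite /constrained_field /projected_vec /ham_field /poisson.
rewrite dpos_f1 dmom_f1 dpos_f2 dmom_f2.
set a := dpos Q w; set b := dmom Q w; set xi := lsubmx w; set eta := rsubmx w.
rewrite !dotvE !subr0 !scale_row_mx !opp_row_mx !add_row_mx; congr row_mx.
  rewrite scaler0 subr0 -mulf_div divff ?mul1r//.
apply/rowP => i; rewrite !mxE sub0r -mulrN.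
move: (dotv xi xi) (dotv eta b) (dotv xi a) (dotv xi b) => X e1 e2 e3.
move: (xi 0 i) (eta 0 i) (a 0 i) => x1 x2 x3.
(* With inverses of 0 equal to 0 the formula also holds where [xi = 0], so it can be used as an
   equality of functions. *)
have [->|x0] := eqVneq X 0.
  by rewrite mulr0 oppr0 invr0; ring.
by field.
Qed.

(** Valid wherever [xi] is nonzero, hence off T*S^3 as well: the 8x8 monodromy matrix also
    differentiates across the level sets of [f1] and [f2]. *)
Lemma constrained_field_f1 Q w : dotv (lsubmx w) (lsubmx w) != 0 ->
  2 * dotv (lsubmx w) (lsubmx (constrained_field Q w)) = 0.
Proof.
move=> x0; rewrite constrained_fieldE row_mxKl !dotvE; move: x0.
by move: (dotv _ _) (dotv _ _) => *; field.
Qed.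

Lemma constrained_field_f2 Q w : dotv (lsubmx w) (lsubmx w) != 0 ->
  dotv (lsubmx (constrained_field Q w)) (rsubmx w) +
  dotv (lsubmx w) (rsubmx (constrained_field Q w)) = 0.
Proof.
move=> x0; rewrite constrained_fieldE row_mxKl row_mxKr !dotvE (dotvC _ (rsubmx w)).
move: x0; move: (dotv _ _) (dotv _ _) (dotv _ _) (dotv _ _) (dotv _ _).
by move=> *; field.
Qed.

(** The chain rule expresses the two halves of the pulled-back Hamiltonian field by the derivatives
    of [Q] at [moser z]; they are the vectors [gy] and [- gx] of [dmoser_vec_hamiltonian]. No energy
    level is fixed. *)
Lemma moser_constrained Q W z : open W -> Ck 1 W Q -> W (moser z) ->
  dmoser z (ham_field (Q \o moser) z) = constrained_field Q (moser z).
Proof.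
move=> Wo QC Wz.
have [a0 [A aE]] : exists a0 A, dpos Q (moser z) = cons4 a0 A.
  by do 2 eexists; exact: cons4_eta.
have [b0 [B bE]] : exists b0 B, dmom Q (moser z) = cons4 b0 B.
  by do 2 eexists; exact: cons4_eta.
have [x xE] : exists x, x = - rsubmx z by exists (- rsubmx z).
have [y yE] : exists y, y = lsubmx z by exists (lsubmx z).
have [r rE] : exists r, r = moser_r z by exists (moser_r z).
have r0 : r != 0 by rewrite rE gt_eqF// moser_r_gt0.
have DG (v : 'rV[R]_(3 + 3)) : 'D_v (Q \o moser) z =
    dotv (lsubmx (dmoser z v)) (cons4 a0 A) + dotv (rsubmx (dmoser z v)) (cons4 b0 B).
  have [Qd QE] := C1_diff Wo QC Wz.
  have [_ ->] := is_derive_diff_comp (is_derive_moser z v) Qd.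
  by rewrite QE -aE -bE -grad_row_mx hsubmxK.
have ix i (c : 'rV[R]_3) : dotv (delta_mx 0 i) c = c 0 i by rewrite dotvC dotv_delta.
have gy : dpos (Q \o moser) z = b0 *: x + r *: B - dotv B x *: x.
  apply/rowP => i; rewrite mxE DG /dmoser row_mxKl row_mxKr oppr0 -xE -yE -rE.
  rewrite /dmoser_vec row_mxKl row_mxKr !dotv_cons4 !dotvE !dotv_delta !ix (dotvC x B).
  by rewrite !mxE; ring.
have gx : dmom (Q \o moser) z = - ((r^-1 ^+ 2 * a0) *: x + r^-1 *: A - (r^-1 ^+ 2 * dotv A x) *: x
            + b0 *: y + dotv B y *: x - dotv B x *: y - dotv x y *: B).
  apply/rowP => i; rewrite mxE DG /dmoser row_mxKl row_mxKr -xE -yE -rE.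
  rewrite /dmoser_vec row_mxKl row_mxKr !dotv_cons4 !dotvE !dotv_delta !ix.
  rewrite (dotvC x B) (dotvC y B) (dotvC x A).
  by rewrite !mxE; ring.
rewrite constrained_fieldE aE bE /dmoser /ham_field row_mxKl row_mxKr opprK gy gx.
rewrite moserE /moser_vec row_mxKl row_mxKr -xE -yE -rE.
by apply: dmoser_vec_hamiltonian => //; rewrite xE rE !dotvE opprK dotv_moser.
Qed.

End Constraints.

(** * Smoothness of the Hamiltonians *)

Section RowCk.
Context {R : realType} {n : nat} (k : nat) (U : set 'rV[R]_n).

Definition Ck_row m (F : 'rV[R]_n -> 'rV[R]_m) := forall i, Ck k U (fun z => F z 0 i).

Lemma Ck_rowD m (F G : 'rV[R]_n -> 'rV[R]_m) : Ck_row F -> Ck_row G ->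
  Ck_row (fun z => F z + G z).
Proof.
move=> FC GC i; rewrite (_ : (fun z => _) = fun z => F z 0 i + G z 0 i); first exact: CkD.
by apply/funext => z; rewrite mxE.
Qed.

Lemma Ck_rowN m (F : 'rV[R]_n -> 'rV[R]_m) : Ck_row F -> Ck_row (fun z => - F z).
Proof.
move=> FC i; rewrite (_ : (fun z => _) = fun z => - F z 0 i); first exact: CkN.
by apply/funext => z; rewrite mxE.
Qed.

Lemma Ck_rowZ m f (F : 'rV[R]_n -> 'rV[R]_m) : Ck k U f -> Ck_row F ->
  Ck_row (fun z => f z *: F z).
Proof.
move=> fC FC i; rewrite (_ : (fun z => _) = fun z => f z * F z 0 i); first exact: CkM.
by apply/funext => z; rewrite mxE.
Qed.

Lemma Ck_row_mx m l (F : 'rV[R]_n -> 'rV[R]_m) (G : 'rV[R]_n -> 'rV[R]_l) :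
  Ck_row F -> Ck_row G -> Ck_row (fun z => row_mx (F z) (G z)).
Proof.
move=> FC GC i; case: (split_ordP i) => j ->.
  by rewrite (_ : (fun z => _) = fun z => F z 0 j)//; apply/funext => z; rewrite row_mxEl.
by rewrite (_ : (fun z => _) = fun z => G z 0 j)//; apply/funext => z; rewrite row_mxEr.
Qed.

Lemma Ck_cons4 f (F : 'rV[R]_n -> 'rV[R]_3) : Ck k U f -> Ck_row F ->
  Ck_row (fun z => cons4 (f z) (F z)).
Proof.
move=> fC FC; apply: (@Ck_row_mx 1 3) => // i; rewrite ord1.
by rewrite (_ : (fun z => _) = f)//; apply/funext => z; rewrite mxE eqxx mulr1n.
Qed.

Lemma Ck_dotv m (F G : 'rV[R]_n -> 'rV[R]_m) : Ck_row F -> Ck_row G ->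
  Ck k U (fun z => dotv (F z) (G z)).
Proof. by move=> FC GC; apply: Ck_sum => i; exact: CkM. Qed.

Lemma Ck_row_vec3 (F : 'rV[R]_n -> 'rV[R]_4) : Ck_row F -> Ck_row (fun z => vec3 (F z)).
Proof.
move=> FC i; rewrite (_ : (fun z => _) = fun z => F z 0 (rshift 1 i))//.
by apply/funext => z; rewrite mxE.
Qed.

End RowCk.

Section RowCk2.
Context {R : realType} {n m : nat} (k : nat) (U : set 'rV[R]_(n + m)).

Lemma Ck_lsubmx : Ck_row k U (@lsubmx R 1 n m).
Proof.
move=> i; rewrite (_ : (fun z => _) = fun z : 'rV[R]_(n + m) => z 0 (lshift m i)); first exact: Ck_coord.
by apply/funext => z; rewrite mxE.
Qed.

Lemma Ck_rsubmx : Ck_row k U (@rsubmx R 1 n m).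
Proof.
move=> i; rewrite (_ : (fun z => _) = fun z : 'rV[R]_(n + m) => z 0 (rshift n i)); first exact: Ck_coord.
by apply/funext => z; rewrite mxE.
Qed.

End RowCk2.

Section Smoothness.
Context {R : realType}.
Variables (g c : R) (D : set 'rV[R]_3) (V : 'rV[R]_3 -> R).
Hypotheses (Do : open D) (VC : Ck 2 D V).

Lemma continuous_open_preimage n m (F : 'rV[R]_n -> 'rV[R]_m) (W : set 'rV[R]_m) :
  Ck_row 0 setT F -> open W -> open (F @^-1` W).
Proof.
move=> FC; apply: open_comp => x _; apply/continuous_rowP => i.
exact: Ck_continuous (FC i) I.
Qed.

Lemma Ck_neq0_open n (f : 'rV[R]_n -> R) : Ck 0 setT f -> open [set x | f x != 0].
Proof.
move=> fC; apply: (@open_comp _ _ f [set x | x != 0]); last exact: open_neq.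
by move=> x _; exact: Ck_continuous fC I.
Qed.

Lemma dotv_eq0 n (u : 'rV[R]_n) : (dotv u u == 0) = (u == 0).
Proof.
have [->|u0] := eqVneq u 0; first by rewrite dotv0 eqxx.
by rewrite gt_eqF// dotv_gt0.
Qed.

Lemma Ham_dom_open : open (Ham_dom D).
Proof.
rewrite (_ : Ham_dom D = [set z | dotv (lsubmx z) (lsubmx z) != 0] `&` lsubmx @^-1` D).
  apply: openI; last by apply: continuous_open_preimage => //; exact: Ck_lsubmx.
  by apply: Ck_neq0_open; apply: Ck_dotv; exact: Ck_lsubmx.
by apply/seteqP; split => z /= []; rewrite dotv_eq0.
Qed.

Lemma Ck_moser k U : Ck_row k U (@moser R).
Proof.
rewrite (funext moserE) /moser_vec.
have xC : Ck_row k U (fun z : 'rV[R]_(3 + 3) => - rsubmx z).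
  by apply: Ck_rowN; exact: Ck_rsubmx.
have rC : Ck k U (@moser_r R).
  apply: CkM; last exact: Ck_cst.
  by apply: CkD; [apply: Ck_dotv; exact: Ck_rsubmx|exact: Ck_cst].
have rVC : Ck k U (fun z => (moser_r z)^-1).
  by apply: CkV => // z _; rewrite gt_eqF// moser_r_gt0.
have uC : Ck k U (fun z : 'rV[R]_(3 + 3) => dotv (- rsubmx z) (lsubmx z)).
  by apply: Ck_dotv => //; exact: Ck_lsubmx.
apply: Ck_row_mx; apply: Ck_cons4 => //.
- by apply: CkB => //; exact: Ck_cst.
- exact: Ck_rowZ.
- apply: Ck_rowD; first by apply: Ck_rowZ => //; exact: Ck_lsubmx.
  by apply: Ck_rowN; exact: Ck_rowZ.
Qed.

Lemma Ck_moser_q k U : Ck_row k U (@moser_q R).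
Proof.
apply: Ck_rowD; apply: Ck_rowZ.
- exact: Ck_rsubmx.
- by apply: Ck_row_vec3; exact: Ck_lsubmx.
- by apply: CkB; [exact: Ck_cst|exact: Ck_lsubmx].
- by apply: Ck_row_vec3; exact: Ck_rsubmx.
Qed.

Lemma Qreg_dom_open : open (Qreg_dom D).
Proof.
rewrite (_ : Qreg_dom D = [set w | poisson f1 f2 w != 0] `&` (@moser_q R) @^-1` D).
  apply: openI; last by apply: continuous_open_preimage => //; exact: Ck_moser_q.
  apply: Ck_neq0_open; rewrite (funext (@poisson_f1f2 R)).
  by apply: CkM; [exact: Ck_cst|apply: Ck_dotv; exact: Ck_lsubmx].
by apply/seteqP; split => z /= [].
Qed.

Lemma moser_dom z : Ham_dom D z -> Qreg_dom D (moser z).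
Proof.
move=> [_ Dq]; split; last by rewrite moser_q_moser.
by rewrite poisson_f1f2 dotv_xi_moser mulr1.
Qed.

Lemma Ck_Ham : Ck 2 (Ham_dom D) (Ham g V).
Proof.
have qC k U := @Ck_lsubmx R 3 3 k U; have pC k U := @Ck_rsubmx R 3 3 k U.
apply: CkD; last first.
  by apply: (Ck_comp Ham_dom_open Do) => [z []//|i|//]; exact: qC.
apply: CkB; last first.
  apply: CkM; first exact: Ck_cst.
  apply: CkV => [z [q0 _]|]; first by rewrite gt_eqF// enorm_gt0.
  by apply: Ck_sqrt => [z [q0 _]|]; [exact: dotv_gt0|exact: Ck_dotv].
apply: CkB; last by apply: CkM; [exact: pC|exact: qC].
apply: CkD; last by apply: CkM; [exact: pC|exact: qC].
apply: CkM; first exact: Ck_cst.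
rewrite (_ : (fun z => _) = fun z : 'rV[R]_(3 + 3) => dotv (rsubmx z) (rsubmx z)); first exact: Ck_dotv.
by apply/funext => z; rewrite enorm_sqr.
Qed.

Lemma Ck_Qreg : Ck 2 (Qreg_dom D) (Qreg g c V).
Proof.
have xC k U := @Ck_lsubmx R 4 4 k U; have eC k U := @Ck_rsubmx R 4 4 k U.
have x0C : Ck 2 (Qreg_dom D) (fun w => 1 - lsubmx w 0 0).
  by apply: CkB; [exact: Ck_cst|exact: xC].
apply: CkM; last first.
  rewrite (_ : (fun z => _) = fun z : 'rV[R]_(4 + 4) => dotv (rsubmx z) (rsubmx z)); first exact: Ck_dotv.
  by apply/funext => z; rewrite enorm_sqr.
apply: CkM; first exact: Ck_cst.
apply: CkX; apply: CkD; last first.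
  apply: CkM => //; apply: (Ck_comp Qreg_dom_open Do) => // [z []//|i].
  exact: Ck_moser_q.
apply: CkD.
  by apply: CkB; [exact: Ck_cst|apply: CkM => //; exact: Ck_cst].
by apply: CkM => //; apply: CkB; apply: CkM; [exact: xC|exact: eC|exact: xC|exact: eC].
Qed.

Lemma Ck_constrained_field : Ck_row 1 (Qreg_dom D) (constrained_field (Qreg g c V)).
Proof.
rewrite (funext (constrained_fieldE _)) /projected_vec.
have xC := @Ck_lsubmx R 4 4 1 (Qreg_dom D); have eC := @Ck_rsubmx R 4 4 1 (Qreg_dom D).
have aC : Ck_row 1 (Qreg_dom D) (dpos (Qreg g c V)).
  by move=> i; apply: Ck_dpos; [exact: Qreg_dom_open|exact: Ck_Qreg].
have bC : Ck_row 1 (Qreg_dom D) (dmom (Qreg g c V)).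
  by move=> i; apply: Ck_dmom; [exact: Qreg_dom_open|exact: Ck_Qreg].
have iC : Ck 1 (Qreg_dom D) (fun w => (dotv (lsubmx w) (lsubmx w))^-1).
  apply: CkV; last exact: Ck_dotv.
  by move=> w [] + _; rewrite poisson_f1f2 mulf_eq0 pnatr_eq0.
have alC : Ck 1 (Qreg_dom D) (fun w => (dotv (rsubmx w) (dmom (Qreg g c V) w) -
    dotv (lsubmx w) (dpos (Qreg g c V) w)) / dotv (lsubmx w) (lsubmx w)).
  by apply: CkM => //; apply: CkB; exact: Ck_dotv.
have beC : Ck 1 (Qreg_dom D) (fun w => dotv (lsubmx w) (dmom (Qreg g c V) w) /
    dotv (lsubmx w) (lsubmx w)).
  by apply: CkM => //; exact: Ck_dotv.
apply: Ck_row_mx.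
  by apply: Ck_rowD => //; apply: Ck_rowN; exact: Ck_rowZ.
apply: Ck_rowD; last exact: Ck_rowZ.
apply: Ck_rowD; first exact: Ck_rowN.
by apply: Ck_rowN; exact: Ck_rowZ.
Qed.

Lemma Ck_Qreg_moser : Ck 2 (Ham_dom D) (Qreg g c V \o @moser R).
Proof.
apply: (Ck_comp Ham_dom_open Qreg_dom_open).
- exact: moser_dom.
- by move=> i; exact: Ck_moser.
- exact: Ck_Qreg.
Qed.

End Smoothness.

(** * Characteristic polynomials *)

Section CharPoly.
Context {K : fieldType}.

(** The matrix determinant lemma for a nilpotent rank-one term. It is stated over a domain because
    it is applied with [c = 'X - 1], which is not invertible in [{poly K}]. *)
Lemma det_sub_rank1 (L : idomainType) n (c : L) (u : 'cV[L]_n) (v : 'rV[L]_n) :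
  c != 0 -> v *m u = 0 -> \det (c%:M - u *m v) = c ^+ n.
Proof.
move=> c0 vu.
(* [S] is triangularised from both sides. *)
pose S := block_mx (1%:M : 'M[L]_1) v u (c%:M : 'M[L]_n).
have S1 : S = block_mx 1%:M 0 u 1%:M *m block_mx 1%:M v 0 (c%:M - u *m v).
  rewrite mulmx_block !mul1mx !mulmx1 !mul0mx ?mulmx0 !addr0 ?add0r.
  by rewrite [u *m v + _]addrC subrK.
have S2 : S *m block_mx c%:M 0 (- u) 1%:M = block_mx c%:M v 0 c%:M.
  rewrite mulmx_block !mul1mx !mulmx1 ?mulmx0 !add0r mulmxN vu oppr0 addr0.
  by rewrite mulmxN mul_mx_scalar mul_scalar_mx subrr.
have d1 : \det S = \det (c%:M - u *m v).
  by rewrite S1 det_mulmx det_lblock det_ublock !det1 !mul1r.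
have := congr1 determinant S2; rewrite det_mulmx det_lblock det_ublock d1 det1 mulr1 mulrC.
by rewrite !det_scalar expr1 => /(mulfI c0).
Qed.

(* [A] and [B] preserve the flag generated by [e] inside the kernel of [h] and
   agree on its graded pieces; equivalently [B - A = h r + s e] with
   [r h = e s = e h = 0], and each rank-one term leaves the determinant of
   ['X - A] unchanged by [det_sub_rank1]. *)
Lemma char_poly_flag n (A B : 'M[K]_n) (e : 'rV[K]_n) (h : 'cV[K]_n) :
  e *m A = e -> e *m B = e -> A *m h = h -> B *m h = h -> e *m h = 0 ->
  (h = 0 -> e = 0) ->
  (forall v : 'rV[K]_n, v *m h = 0 -> exists k, v *m (B - A) = k *: e) ->
  char_poly A = char_poly B.
Proof.
move=> eA eB Ah Bh eh h0e H.
have [r [s [E rh es]]] : exists (r : 'rV[K]_n) (s : 'cV[K]_n),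
    [/\ B - A = h *m r + s *m e, r *m h = 0 & e *m s = 0].
  (* If [h = 0] then [e = 0], and the last hypothesis, now about all vectors, forces [A = B]. *)
  have [h0|/cV0Pn[i0 hi0]] := eqVneq h 0.
    exists 0, 0; split; rewrite ?mulmx0 ?mul0mx ?addr0//.
    apply/row_matrixP => i; rewrite row0 rowE.
    by have [|k ->] := H (delta_mx 0 i); rewrite ?h0 ?mulmx0// (h0e h0) scaler0.
  have hd i : (delta_mx 0 i : 'rV[K]_n) *m h = (h i 0)%:M.
    by rewrite -rowE; apply/rowP => j; rewrite ord1 !mxE eqxx.
  (* [v0] splits the space into [ker h] and a line. The row [r] is [v0] times [B - A], and [s]
     collects the coefficients [k i] of the projections of the basis vectors to [ker h]. *)
  have [v0 v0h] : exists v0 : 'rV[K]_n, v0 *m h = 1%:M.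
    by exists ((h i0 0)^-1 *: delta_mx 0 i0); rewrite -scalemxAl hd scale_scalar_mx mulVf.
  have /fin_all_exists[k kE] i : exists k, (delta_mx 0 i - h i 0 *: v0) *m (B - A) = k *: e.
    by apply: H; rewrite mulmxBl -scalemxAl v0h hd scale_scalar_mx mulr1 subrr.
  have rh : v0 *m (B - A) *m h = 0 by rewrite -mulmxA mulmxBl Ah Bh subrr mulmx0.
  have E (s : 'cV[K]_n) : (forall i, s i 0 *: e = k i *: e) ->
      B - A = h *m (v0 *m (B - A)) + s *m e.
    move=> sk; apply/row_matrixP => i; rewrite [RHS]linearD/= !row_mul.
    have rs (c : 'cV[K]_n) : row i c = (c i 0)%:M.
      by apply/rowP => j; rewrite ord1 !mxE eqxx.
    rewrite !rs !mul_scalar_mx sk -kE mulmxBl -scalemxAl rowE.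
    by rewrite [RHS]addrC subrK.
  have [e0|e0] := eqVneq e 0.
    exists (v0 *m (B - A)), 0; split; rewrite ?e0 ?mulmx0//.
    by rewrite -[X in _ = _ + X](mulmx0 _ (0 : 'cV[K]_n)) -e0; apply: E => i; rewrite e0 !scaler0.
  exists (v0 *m (B - A)), (\col_i k i); split => //.
    by apply: E => i; rewrite mxE.
  have : e *m (B - A) = 0 by rewrite mulmxBr eA eB subrr.
  rewrite {1}(E (\col_i k i)) => [|i]; last by rewrite mxE.
  rewrite mulmxDr mulmxA eh mul0mx add0r mulmxA [e *m \col_i k i]mx11_scalar mul_scalar_mx.
  by move/eqP; rewrite scaler_eq0 (negPf e0) orbF => /eqP ->; rewrite raddf0.
pose cM p q (M : 'M[K]_(p, q)) : 'M[{poly K}]_(p, q) := map_mx polyC M.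
pose c : {poly K} := 'X - 1.
have c0 : c != 0 by rewrite polyXsubC_eq0.
rewrite /char_poly /char_poly_mx; set M := 'X%:M - map_mx polyC A.
have Mh : M *m cM _ _ h = c *: cM _ _ h.
  by rewrite /M mulmxBl mul_scalar_mx -map_mxM Ah scalerBl scale1r.
have eM : cM _ _ e *m M = c *: cM _ _ e.
  by rewrite /M mulmxBr mul_mx_scalar -map_mxM eA scalerBl scale1r.
have -> : 'X%:M - map_mx polyC B = M - cM _ _ h *m cM _ _ r - cM _ _ s *m cM _ _ e.
  rewrite /M /cM -!map_mxM/= -[X in _ = X]addrA -opprD -map_mxD -E map_mxB.
  by rewrite opprB addrA subrK.
pose M' := M - cM _ _ h *m cM _ _ r.
have eM' : cM _ _ e *m M' = c *: cM _ _ e.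
  by rewrite mulmxBr eM mulmxA -map_mxM eh map_mx0 mul0mx subr0.
(* Since [M h = c h], the matrix [c M'] factors as [M] times [c - h r], and [c ^+ n] cancels from
   the determinants. The other rank-one term is removed in the same way on the left, by
   [e M' = c e]. *)
have d1 : \det M' = \det M.
  apply: (mulfI (expf_neq0 n c0)).
  rewrite -detZ (_ : c *: M' = M *m (c%:M - cM _ _ h *m cM _ _ r)).
    by rewrite det_mulmx det_sub_rank1// 1?mulrC// -map_mxM rh map_mx0.
  by rewrite mulmxBr mul_mx_scalar mulmxA Mh -scalemxAl -scalerBr.
apply: (mulfI (expf_neq0 n c0)).
rewrite -d1 -[RHS]detZ -/M' (_ : c *: (M' - _) = (c%:M - cM _ _ s *m cM _ _ e) *m M').
  by rewrite det_mulmx det_sub_rank1// -map_mxM es map_mx0.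
by rewrite mulmxBl mul_scalar_mx -mulmxA eM' -scalemxAr -scalerBr.
Qed.

(** The rows of [J] span a subspace invariant under [A], which acts there as [B]; the columns of [F]
    are functionals vanishing on it and fixed by [A], so [A] is the identity on the quotient. *)
Lemma char_poly_quotient n m (A : 'M[K]_(n + m)) (B : 'M[K]_n) (J : 'M[K]_(n, n + m))
    (L : 'M[K]_(n + m, n)) (F : 'M[K]_(n + m, m)) (N : 'M[K]_(m, n + m)) :
  J *m L = 1%:M -> J *m F = 0 -> N *m F = 1%:M -> J *m A = B *m J -> A *m F = F ->
  char_poly A = char_poly B * ('X - 1) ^+ m.
Proof.
move=> JL JF NF JA AF.
(* [P'] is the inverse of [P]. Subtracting [F N L] makes [N] annihilate the first block, which [L]
   alone need not satisfy. *)
pose P := col_mx J N; pose P' := row_mx (L - F *m N *m L) F.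
have PP : P *m P' = 1%:M.
  rewrite mul_col_row !mulmxBr !mulmxA JL JF NF !mul0mx mul1mx subr0 subrr.
  by rewrite -scalar_mx_block.
have PA : P *m A *m P' = block_mx B 0 (N *m A *m (L - F *m N *m L)) 1%:M.
  rewrite mul_col_mx mul_col_row JA -!mulmxA AF NF JF mulmx0.
  by rewrite !mulmxBr !mulmxA -[B *m J *m L]mulmxA JL -[B *m J *m F]mulmxA JF mulmx0 !mul0mx mulmx1 subr0.
have P'P : P' *m P = 1%:M by exact: mulmx1C.
have -> : char_poly A = char_poly (P *m A *m P').
  rewrite /char_poly /char_poly_mx.
  pose Q := map_mx polyC P; pose Q' := map_mx polyC P'.
  have QQ : Q *m Q' = 1%:M by rewrite -map_mxM PP map_mx1.
  have -> : 'X%:M - map_mx polyC (P *m A *m P') = Q *m ('X%:M - map_mx polyC A) *m Q'.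
    by rewrite mulmxBr mulmxBl !map_mxM mul_mx_scalar -scalemxAl QQ scalemx1.
  rewrite !det_mulmx mulrAC -det_mulmx QQ det1 mul1r//.
rewrite PA /char_poly /char_poly_mx map_block_mx map_mx0 map_mx1 scalar_mx_block.
rewrite opp_block_mx add_block_mx oppr0 addr0 det_lblock; congr (_ * _).
by rewrite -raddfB det_scalar.
Qed.

End CharPoly.

(** * First integrals and the pulled-back field *)

Section FlowTools.
Context {R : realType}.

Lemma diff_jacobian n m (f : 'rV[R]_n -> 'rV[R]_m) x v : 'd f x v = v *m 'J f x.
Proof. by rewrite /jacobian mul_rV_lin1. Qed.

Section Field.
Context {n : nat}.
Variables (X : 'rV[R]_n -> 'rV[R]_n) (U : set 'rV[R]_n) (J : 'rV[R]_n -> 'M[R]_n).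
Hypothesis XC : C1_map X U J.

Lemma conserved_along (f : 'rV[R]_n -> R) (u : R -> 'rV[R]_n) T :
  (forall z, U z -> differentiable f z) -> (forall z, U z -> 'd f z (X z) = 0) ->
  (forall t, 0 <= t <= T -> is_solution_at X U u t) ->
  forall t, 0 <= t <= T -> f (u t) = f (u 0).
Proof.
move=> fd f0 us t /andP[t0 tT].
have [s st|c _ /eqP] := @mean_value _ (fun s => f (u s)) (fun=> 0) 0 t t0.
  have sT : 0 <= s <= T by case/andP: st => -> /le_trans ->.
  have [Us ud] := us s sT; have := is_derive_diff_comp ud (fd _ Us).
  by rewrite f0.
by rewrite mul0r subr_eq0 => /eqP.
Qed.

(** Derivative at [u 0] of the identity [f (flow z) = f z], which holds on the neighbourhood
    supplied by [flow_near]. *)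
Lemma conserved_flow (f : 'rV[R]_n -> R) (u : R -> 'rV[R]_n) T : 0 <= T ->
  (forall z, U z -> differentiable f z) -> (forall z, U z -> 'd f z (X z) = 0) ->
  (forall t, 0 <= t <= T -> is_solution_at X U u t) ->
  forall v, 'd f (u T) ('d (flow X U T) (u 0) v) = 'd f (u 0) v.
Proof.
move=> T0 fd f0 us v.
have TT : 0 <= T <= T by rewrite T0 lexx.
have T00 : (0 : R) <= 0 <= T by apply/andP.
have [Fd _] := flow_diff XC T0 us.
have FE : flow X U T (u 0) = u T by exact: (flowE XC).
have [UT _] := us T TT; have [U0 _] := us 0 T00.
have Fv : is_derive (u 0) v (flow X U T) ('d (flow X U T) (u 0) v).
  by rewrite -deriveE//; apply: derivableP; exact: diff_derivable.
have fdT : differentiable f (flow X U T (u 0)) by rewrite FE; exact: fd.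
have [_] := is_derive_diff_comp Fv fdT; rewrite FE => E1.
have E2 : 'D_v f (u 0) = 'd f (u 0) v by apply: deriveE; exact: fd.
apply: etrans (esym E1) _; apply: etrans E2.
have [r r0 [C _ HC]] := flow_near XC T0 us.
apply: near_eq_derive; apply/nbhs_ballP; exists r => //= z.
rewrite -ball_normE /= distrC => /HC[w w0 ws].
have wS t : 0 <= t <= T -> is_solution_at X U w t by move=> /ws[].
by rewrite -w0 (flowE XC)// (conserved_along fd f0 wS).
Qed.

Lemma field_along_solution (u : R -> 'rV[R]_n) (t : R) :
  is_solution_at X U u t -> is_derive t 1 (fun s => X (u s)) (X (u t) *m J (u t)).
Proof.
move=> [Ut ud]; have [Xd XE] := C1_map_diff XC Ut.
by have := is_derive_diff_comp ud Xd; rewrite XE.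
Qed.

(** The velocity [X (u t)] solves the variational equation. On a periodic orbit this provides a
    fixed vector of the monodromy matrix. *)
Lemma flow_field (u : R -> 'rV[R]_n) T : 0 <= T ->
  (forall t, 0 <= t <= T -> is_solution_at X U u t) ->
  X (u 0) *m 'J (flow X U T) (u 0) = X (u T).
Proof.
move=> T0 us; have [_ H] := flow_diff XC T0 us.
rewrite -diff_jacobian.
exact: (H (fun s => X (u s)) (fun t tT => field_along_solution (us t tT))).
Qed.

Lemma solution_unique_ge0 (u v : R -> 'rV[R]_n) :
  (forall t, is_solution_at X U u t) -> (forall t, is_solution_at X U v t) ->
  u 0 = v 0 -> forall t, 0 <= t -> u t = v t.
Proof.
move=> us vs uv t t0.
by apply: (solution_unique XC (T := t)) => //; rewrite t0 lexx.
Qed.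

End Field.

(** Negative times are reached by reversing time, which turns [X] into [- X]. *)
Lemma solution_unique_line n (X : 'rV[R]_n -> 'rV[R]_n) U J (u v : R -> 'rV[R]_n) :
  C1_map X U J ->
  (forall t, is_solution_at X U u t) -> (forall t, is_solution_at X U v t) ->
  u 0 = v 0 -> forall t, u t = v t.
Proof.
move=> XC us vs uv t; have [t0|/ltW t0] := leP 0 t; first exact: (solution_unique_ge0 XC).
have NC : C1_map (fun x => - X x) U (fun x => - J x).
  move=> x Ux e e0; have [r r0 Hr] := XC x Ux e e0; exists r => // a b ar br.
  have [Ua H1 H2] := Hr a b ar br; split => // [|w].
    rewrite (_ : _ - _ - _ = - (X a - X b - (a - b) *m J x)) ?normrN//.
    by rewrite mulmxN !opprD !opprK.
  by rewrite (_ : _ - _ = - (J a - J x)) ?mulmxN ?normrN// opprD.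
have rev (w : R -> 'rV[R]_n) : (forall t, is_solution_at X U w t) ->
    forall t, is_solution_at (fun x => - X x) U (fun s => w (- s)) t.
  move=> ws s; have [Us wd] := ws (- s); split => //.
  apply/is_derive_row => i; rewrite mxE -mulrN1.
  have /is_derive_row/(_ i) wdi := wd.
  have sd : is_derive s 1 (fun s : R => - s) (-1) by exact: is_deriveNid.
  exact: (@is_derive1_comp _ (fun s => w s 0 i) (fun s : R => - s)).
have := @solution_unique_ge0 _ _ _ _ NC _ _ (rev u us) (rev v vs) _ (- t).
by rewrite oppr0 opprK oppr_ge0; apply.
Qed.

Lemma is_derive_reparam n (u : R -> 'rV[R]_n) (s : R -> R) (t : R) du ds :
  is_derive (s t) 1 u du -> is_derive t 1 s ds ->
  is_derive t 1 (fun t => u (s t)) (ds *: du).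
Proof.
move=> /is_derive_row ud sd; apply/is_derive_row => i; rewrite mxE mulrC.
exact: (@is_derive1_comp _ (fun s => u s 0 i) s).
Qed.

End FlowTools.

Section Regularization.
Context {R : realType}.
Variables (g c : R) (D : set 'rV[R]_3) (V : 'rV[R]_3 -> R).
Hypotheses (g0 : g != 0) (Do : open D) (VC : Ck 2 D V).

Local Notation U1 := (Ham_dom D).
Local Notation U2 := (Qreg_dom D).
Local Notation H := (Ham g V).
Local Notation Q := (Qreg g c V).
Local Notation X1 := (ham_field H).
Local Notation X2 := (constrained_field Q).
Local Notation Y := (ham_field (Q \o @moser R)).

Definition radius (z : 'rV[R]_(3 + 3)) : R := enorm (lsubmx z).

Lemma ham_field_C1 : C1_map X1 U1 (jac X1).
Proof.
apply: C1_map_Ck; first exact: Ham_dom_open.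
by move=> j; apply: Ck_ham_field; [exact: Ham_dom_open|exact: Ck_Ham].
Qed.

Lemma constrained_field_C1 : C1_map X2 U2 (jac X2).
Proof. by apply: C1_map_Ck; [exact: Qreg_dom_open|exact: Ck_constrained_field]. Qed.

Lemma pullback_field_C1 : C1_map Y U1 (jac Y).
Proof.
apply: C1_map_Ck; first exact: Ham_dom_open.
by move=> j; apply: Ck_ham_field; [exact: Ham_dom_open|exact: Ck_Qreg_moser].
Qed.

Lemma Ck_radius k : Ck k U1 radius.
Proof.
apply: Ck_sqrt => [z [q0 _]|]; first exact: dotv_gt0.
by apply: Ck_dotv; exact: Ck_lsubmx.
Qed.

Lemma radius_gt0 z : U1 z -> 0 < radius z.
Proof. by move=> [q0 _]; exact: enorm_gt0. Qed.

Lemma is_derive_Ham z v : U1 z -> is_derive z v H ((v *m grad H z) 0 0).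
Proof.
by move=> Uz; apply: (C1_derive _ (Ham_dom_open Do)) => //; apply: Ck_le (Ck_Ham g Do VC).
Qed.

Lemma is_derive_radius z v : U1 z -> is_derive z v radius ((v *m grad radius z) 0 0).
Proof. by move=> Uz; apply: (C1_derive _ (Ham_dom_open Do)) => //; exact: Ck_radius. Qed.

Lemma grad_Qreg_moser z : U1 z ->
  grad (Q \o @moser R) z = ((radius z * (H z - c) + g) / g) *:
    (radius z *: grad H z + (H z - c) *: grad radius z).
Proof.
move=> Uz; apply/colP => i; rewrite !mxE.
have hd := is_derive_Ham (delta_mx 0 i) Uz; have nd := is_derive_radius (delta_mx 0 i) Uz.
rewrite -rowE mxE in hd; rewrite -rowE mxE in nd.
rewrite (@near_eq_derive _ _ _ _ (fun z => (2 * g)^-1 * (radius z * (H z - c) + g) ^+ 2)); last first.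
  apply: (near_open (Ham_dom_open Do) Uz) => y [q0 _].
  by rewrite /= Qreg_moser.
have [_ ->] : is_derive z (delta_mx 0 i) (fun z => (2 * g)^-1 * (radius z * (H z - c) + g) ^+ 2)
   ((radius z * (H z - c) + g) / g * (radius z * grad H z i 0 + (H z - c) * grad radius z i 0)).
  by apply: is_derive_eq; rewrite /GRing.scale/=; field.
by rewrite !mxE.
Qed.

Lemma ham_field_grad n (f f1' f2' : 'rV[R]_(n + n) -> R) z (a b k : R) :
  grad f z = k *: (a *: grad f1' z + b *: grad f2' z) ->
  ham_field f z = k *: (a *: ham_field f1' z + b *: ham_field f2' z).
Proof.
move=> /colP E; rewrite /ham_field !scale_row_mx add_row_mx scale_row_mx.
congr row_mx; apply/rowP => i; rewrite !mxE.
  by have := E (rshift n i); rewrite !mxE delta_mx_rshift.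
have := E (lshift n i); rewrite !mxE delta_mx_lshift => ->; ring.
Qed.

Lemma pullback_fieldE z : U1 z ->
  Y z = ((radius z * (H z - c) + g) / g) *:
    (radius z *: X1 z + (H z - c) *: ham_field radius z).
Proof. by move=> Uz; apply: ham_field_grad; exact: grad_Qreg_moser. Qed.

Lemma pullback_field_level z : U1 z -> H z = c -> Y z = radius z *: X1 z.
Proof.
move=> Uz Hz; rewrite pullback_fieldE// Hz subrr mulr0 add0r divff// scale1r scale0r.
by rewrite addr0.
Qed.

(* The prefactor of [pullback_fieldE] is 1 on [H = c] and constant along
   [ker dH]. *)
Lemma jac_pullback_field_level z v : U1 z -> H z = c -> v *m grad H z = 0 ->
  v *m jac Y z = radius z *: (v *m jac X1 z) + (v *m grad radius z) 0 0 *: X1 z.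
Proof.
move=> Uz Hz vH.
have dY : is_derive z v Y (v *m jac Y z).
  have [Yd YE] := C1_map_diff pullback_field_C1 Uz.
  by rewrite -[v *m _]/(mulmxr (jac Y z) v) -YE -deriveE//; apply/derivableP/diff_derivable.
have dX : is_derive z v X1 (v *m jac X1 z).
  have [Xd XE] := C1_map_diff ham_field_C1 Uz.
  by rewrite -[v *m _]/(mulmxr (jac X1 z) v) -XE -deriveE//; apply/derivableP/diff_derivable.
have NC : C1_map (ham_field radius) U1 (jac (ham_field radius)).
  apply: C1_map_Ck; first exact: Ham_dom_open.
  by move=> j; apply: Ck_ham_field; [exact: Ham_dom_open|exact: Ck_radius].
have dN : is_derive z v (ham_field radius) ('D_v (ham_field radius) z).
  by have [Nd _] := C1_map_diff NC Uz; apply/derivableP/diff_derivable.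
have hd := is_derive_Ham v Uz; have nd := is_derive_radius v Uz.
rewrite vH mxE in hd.
set dn := (v *m grad radius z) 0 0 in nd *.
have kd : is_derive z v (fun z => (radius z * (H z - c) + g) / g) (dn * (H z - c) / g).
  by apply: is_derive_eq; rewrite /GRing.scale/=; field.
have nX := is_derive_scale nd dX.
have hcd : is_derive z v (fun z => H z - c) 0 by apply: is_derive_eq; rewrite subr0.
have hN := is_derive_scale hcd dN.
have sd : is_derive z v (fun z => radius z *: X1 z + (H z - c) *: ham_field radius z) _ := is_deriveD nX hN.
have := is_derive_scale kd sd.
rewrite Hz subrr !mulr0 mul0r !scale0r !add0r divff// scale1r !addr0.
have [_ E] := dY; move=> [_ dE].
apply: etrans (esym E) _; rewrite [RHS]addrC; apply: etrans dE; apply: near_eq_derive.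
by apply: (near_open (Ham_dom_open Do) Uz) => y; exact: pullback_fieldE.
Qed.

Lemma moser_diff z : differentiable (@moser R) z /\ forall v, 'd (@moser R) z v = dmoser z v.
Proof.
have MC : C1_map (@moser R) setT (jac (@moser R)).
  by apply: C1_map_Ck; [exact: openT|move=> j; exact: Ck_moser].
have [md _] := C1_map_diff MC (I : setT z); split => // v.
by rewrite -deriveE//; have [_ ->] := is_derive_moser z v.
Qed.

Lemma dmoser_pullback_field z : U1 z -> dmoser z (Y z) = X2 (moser z).
Proof.
move=> Uz; apply: (@moser_constrained _ _ U2); first exact: Qreg_dom_open.
  exact: Ck_le (Ck_Qreg g c Do VC).
exact: moser_dom.
Qed.

Lemma solution_moser u t : is_solution_at Y U1 u t ->
  is_solution_at X2 U2 (fun s => moser (u s)) t.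
Proof.
move=> [Ut ud]; split; first exact: moser_dom.
have [md mE] := moser_diff (u t); have := is_derive_diff_comp ud md.
by rewrite mE dmoser_pullback_field.
Qed.

(** Derivative of the identity between [moser] after the flow of [Y] and the flow of
    [constrained_field] after [moser]. Jacobians act on rows from the right, so the factors appear
    in the order of application. *)
Lemma flow_conjugacy u T : 0 <= T ->
  (forall t, 0 <= t <= T -> is_solution_at Y U1 u t) ->
  'J (@moser R) (u 0) *m 'J (flow X2 U2 T) (moser (u 0)) =
  'J (flow Y U1 T) (u 0) *m 'J (@moser R) (u T).
Proof.
move=> T0 us.
have us2 t : 0 <= t <= T -> is_solution_at X2 U2 (fun s => moser (u s)) t.
  by move=> /us; exact: solution_moser.
have [F1d _] := flow_diff pullback_field_C1 T0 us.
have [F2d _] := flow_diff constrained_field_C1 T0 us2.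
have FE : flow Y U1 T (u 0) = u T by exact: (flowE pullback_field_C1).
apply/row_matrixP => i; rewrite !rowE !mulmxA -!diff_jacobian.
set v := delta_mx 0 i.
have [md _] := moser_diff (u 0); have [mdT _] := moser_diff (u T).
have mv : is_derive (u 0) v (@moser R) ('d (@moser R) (u 0) v).
  by rewrite -deriveE//; apply/derivableP/diff_derivable.
have Fv : is_derive (u 0) v (flow Y U1 T) ('d (flow Y U1 T) (u 0) v).
  by rewrite -deriveE//; apply/derivableP/diff_derivable.
have [_ E1] := is_derive_diff_comp mv F2d.
have mdF : differentiable (@moser R) (flow Y U1 T (u 0)) by rewrite FE.
have [_] := is_derive_diff_comp Fv mdF; rewrite FE => E2.
apply: etrans (esym E1) _; apply: etrans E2.
have [r r0 [C _ HC]] := flow_near pullback_field_C1 T0 us.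
apply: near_eq_derive; apply/nbhs_ballP; exists r => //= z.
rewrite -ball_normE /= distrC => /HC[w w0 ws].
have wS t : 0 <= t <= T -> is_solution_at Y U1 w t by move=> /ws[].
have E3 := flowE pullback_field_C1 T0 wS.
have E4 := flowE constrained_field_C1 (u := fun s => moser (w s)) T0 (fun t tT => solution_moser (wS t tT)).
by rewrite -w0; exact: etrans E4 (esym (congr1 (@moser R) E3)).
Qed.

End Regularization.

(** * Gradients of first integrals, injectivity of the Moser map and of its differential *)

Section Misc.
Context {R : realType}.

(** Matrix form of [conserved_flow]: over a closed orbit the gradient of a first integral is a fixed
    column of the monodromy matrix. *)
Lemma conserved_grad n (X : 'rV[R]_n -> 'rV[R]_n) U J (f : 'rV[R]_n -> R) u T :
  C1_map X U J -> Ck 1 U f -> (forall z, U z -> (X z *m grad f z) 0 0 = 0) ->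
  0 <= T -> (forall t, 0 <= t <= T -> is_solution_at X U u t) ->
  'J (flow X U T) (u 0) *m grad f (u T) = grad f (u 0).
Proof.
move=> XC fC f0 T0 us; have Uo := C1_map_open XC.
have fd z (Uz : U z) := C1_diff Uo fC Uz.
have fd1 z : U z -> differentiable f z by move=> /fd[].
have fd2 z : U z -> 'd f z (X z) = 0 by move=> Uz; rewrite (fd z Uz).2 f0.
have E := conserved_flow XC T0 fd1 fd2 us.
have TT : 0 <= T <= T by rewrite T0 lexx.
have T00 : (0 : R) <= 0 <= T by apply/andP.
have [UT _] := us T TT; have [U0 _] := us 0 T00.
apply/row_matrixP => i; apply/rowP => j; rewrite ord1 row_mul !rowE.
have Ei := E (delta_mx 0 i).
apply: etrans (etrans Ei _); last exact: (fd _ U0).2.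
by rewrite (fd _ UT).2 diff_jacobian.
Qed.

Lemma Ck_f1 k (U : set 'rV[R]_(4 + 4)) : Ck k U f1.
Proof.
rewrite (_ : f1 = fun w => dotv (lsubmx w) (lsubmx w) - 1).
  by apply: CkB; [apply: Ck_dotv; exact: Ck_lsubmx|exact: Ck_cst].
by apply/funext => x; rewrite /f1 enorm_sqr.
Qed.

Lemma Ck_f2 k (U : set 'rV[R]_(4 + 4)) : Ck k U f2.
Proof. by apply: Ck_dotv; [exact: Ck_lsubmx|exact: Ck_rsubmx]. Qed.

Lemma grad_f1 (w v : 'rV[R]_(4 + 4)) : (v *m grad f1 w) 0 0 = 2 * dotv (lsubmx w) (lsubmx v).
Proof.
have [_ E1] := C1_derive v openT (Ck_f1 1 setT) (I : setT w).
by have [_ E2] := is_derive_f1 w v; rewrite -E1 E2.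
Qed.

Lemma grad_f2 (w v : 'rV[R]_(4 + 4)) :
  (v *m grad f2 w) 0 0 = dotv (lsubmx v) (rsubmx w) + dotv (lsubmx w) (rsubmx v).
Proof.
have [_ E1] := C1_derive v openT (Ck_f2 1 setT) (I : setT w).
by have [_ E2] := is_derive_f2 w v; rewrite -E1 E2.
Qed.

(** [moser_q] recovers [q], [xi_0] recovers [r], and the remaining [xi_k] then recover [p]. This
    serves to exclude a constant regularized orbit. *)
Lemma moser_inj : injective (@moser R).
Proof.
move=> z w E.
have q : lsubmx z = lsubmx w by rewrite -!moser_q_moser E.
have := congr1 lsubmx E; rewrite !moserE /moser_vec !row_mxKl => E1.
have rE : moser_r z = moser_r w.
  apply: invr_inj; have := congr1 (fun v : 'rV_4 => v 0 0) E1; rewrite !cons40.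
  by move=> /(congr1 (fun x => 1 - x)); rewrite !subKr.
have r0 : (moser_r w)^-1 != 0 by rewrite invr_eq0 gt_eqF// moser_r_gt0.
have := congr1 vec3 E1; rewrite !vec3_cons4 rE => /(scalerI r0)/oppr_inj p.
by rewrite -(hsubmxK z) -(hsubmxK w) q p.
Qed.

(** Makes the Jacobian of [moser] row-free, so that it has the right inverse [L] wanted by
    [char_poly_quotient]. *)
Lemma dmoser_inj (z v : 'rV[R]_(3 + 3)) : dmoser z v = 0 -> v = 0.
Proof.
have r0 : moser_r z != 0 by rewrite gt_eqF// moser_r_gt0.
have ri0 : (moser_r z)^-1 != 0 by rewrite invr_eq0.
move=> E; have := congr1 lsubmx E; have := congr1 rsubmx E.
rewrite /dmoser /dmoser_vec row_mxKl row_mxKr !linear0 => E2 E1.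
have xdx : dotv (- rsubmx z) (- rsubmx v) = 0.
  have := congr1 (fun v : 'rV_4 => v 0 0) E1; rewrite cons40 mxE => /eqP.
  by rewrite mulf_eq0 expf_eq0 (negPf ri0)/= => /eqP.
have dx : - rsubmx v = 0.
  have := congr1 vec3 E1; rewrite vec3_cons4 xdx mulr0 scale0r subr0 => /eqP.
  by rewrite /vec3 linear0 scaler_eq0 (negPf ri0) => /eqP.
have xdy : dotv (- rsubmx z) (lsubmx v) = 0.
  have := congr1 (fun v : 'rV_4 => v 0 0) E2; rewrite cons40 mxE dx dot0v add0r.
  by [].
have dy : lsubmx v = 0.
  have := congr1 vec3 E2; rewrite vec3_cons4 dx xdy dot0v dotv0 !scale0r scaler0.
  rewrite add0r !addr0 scale0r !subr0 => /eqP.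
  by rewrite /vec3 linear0 scaler_eq0 (negPf r0) => /eqP.
by rewrite -(hsubmxK v) dy -[rsubmx v]opprK dx oppr0 row_mx0.
Qed.

End Misc.

(** * Floquet multipliers *)

Section Tangent.
Context {R : realType}.
Implicit Types z v : 'rV[R]_(3 + 3).

(** Tangency to T*S^3: the linearised constraint [f1 = 0]. Together with [dmoser_orth2] it makes the
    Jacobian of [moser] annihilate both gradients. *)
Lemma dmoser_orth1 z v : dotv (lsubmx (moser z)) (lsubmx (dmoser z v)) = 0.
Proof.
rewrite moserE /dmoser /moser_vec /dmoser_vec !row_mxKl dotv_cons4.
have r0 : moser_r z != 0 by rewrite gt_eqF// moser_r_gt0.
have xx : dotv (- rsubmx z) (- rsubmx z) = 2 * moser_r z - 1.
  by rewrite !dotvE opprK dotv_moser.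
move: (- rsubmx z) (- rsubmx v) (moser_r z) r0 xx => x dx r r0 xx.
by rewrite !dotvE xx; field.
Qed.

Lemma dmoser_orth2 z v : dotv (lsubmx (dmoser z v)) (rsubmx (moser z)) +
  dotv (lsubmx (moser z)) (rsubmx (dmoser z v)) = 0.
Proof.
rewrite moserE /dmoser /moser_vec /dmoser_vec !row_mxKl !row_mxKr !dotv_cons4.
have r0 : moser_r z != 0 by rewrite gt_eqF// moser_r_gt0.
have xx : dotv (- rsubmx z) (- rsubmx z) = 2 * moser_r z - 1.
  by rewrite !dotvE opprK dotv_moser.
move: (- rsubmx z) (- rsubmx v) (lsubmx z) (lsubmx v) (moser_r z) r0 xx => x dx y dy r r0 xx.
by rewrite !dotvE (dotvC dx x) xx; field.
Qed.

End Tangent.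

(** Here [w] solves the variational equation of [X_H], [y] is [Y] and [r] is [|q|]. The excess
    [d *: x] is rewritten as [(d / r) *: y], so a correction along [y] with derivative [d / r]
    compensates it. *)
Lemma variation_combine (R : realType) n (w x y : 'rV[R]_n) (M N : 'M[R]_n) (r k d : R) :
  w *m M = r *: (w *m N) + d *: x -> y = r *: x -> r != 0 ->
  r *: (w *m N) + ((d / r) *: y + k *: (y *m M)) = (w + k *: y) *m M.
Proof.
move=> wM yx r0; rewrite mulmxDl wM -scalemxAl addrA; congr (_ + _ + _).
by rewrite yx scalerA divfK.
Qed.

Lemma row_difference (R : realType) n (v w e : 'rV[R]_n) (A B : 'M[R]_n) (k : R) :
  v *m B = w + k *: e -> w = v *m A -> v *m (B - A) = k *: e.
Proof. by move=> vB wA; rewrite mulmxBr vB wA addrAC subrr add0r. Qed.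

Section Multipliers.
Context {R : realType}.
Variables (g c : R) (D : set 'rV[R]_3) (V : 'rV[R]_3 -> R).
Hypotheses (g0 : g != 0) (Do : open D) (VC : Ck 2 D V).

Local Notation U1 := (Ham_dom D).
Local Notation U2 := (Qreg_dom D).
Local Notation H := (Ham g V).
Local Notation Q := (Qreg g c V).
Local Notation X1 := (ham_field H).
Local Notation X2 := (constrained_field Q).
Local Notation Y := (ham_field (Q \o @moser R)).

Lemma char_poly_moser u T : 0 <= T -> u T = u 0 ->
  (forall t, 0 <= t <= T -> is_solution_at Y U1 u t) ->
  char_poly ('J (flow X2 U2 T) (moser (u 0))) =
  char_poly ('J (flow Y U1 T) (u 0)) * ('X - 1) ^+ 2.
Proof.
move=> T0 uT us.
have us2 t : 0 <= t <= T -> is_solution_at X2 U2 (fun s => moser (u s)) t.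
  by move=> /us; exact: (solution_moser Do VC).
have X2C := constrained_field_C1 g c Do VC.
have JA := flow_conjugacy Do VC T0 us.
have A1 : 'J (flow X2 U2 T) (moser (u 0)) *m grad f1 (moser (u 0)) = grad f1 (moser (u 0)).
  have := conserved_grad X2C (Ck_f1 1 U2) _ T0 us2; rewrite /= uT; apply.
  move=> y [y0 _]; rewrite grad_f1 constrained_field_f1//.
  by move: y0; rewrite poisson_f1f2 mulf_eq0 pnatr_eq0.
have A2 : 'J (flow X2 U2 T) (moser (u 0)) *m grad f2 (moser (u 0)) = grad f2 (moser (u 0)).
  have := conserved_grad X2C (Ck_f2 1 U2) _ T0 us2; rewrite /= uT; apply.
  move=> y [y0 _]; rewrite grad_f2 constrained_field_f2//.
  by move: y0; rewrite poisson_f1f2 mulf_eq0 pnatr_eq0.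
rewrite uT in JA.
move: ('J (flow X2 U2 T) _) ('J (flow Y U1 T) _) JA A1 A2 => A B JA A1 A2.
move: (u 0) JA A1 A2 => z JA A1 A2.
have Jv v : v *m 'J (@moser R) z = dmoser z v.
  by rewrite -diff_jacobian; have [_ ->] := moser_diff z.
have /row_freeP[L JL] : row_free ('J (@moser R) z).
  by apply: inj_row_free => v; rewrite Jv; exact: dmoser_inj.
have x1 := dotv_xi_moser z; have x0 := dotv_xi_eta_moser z.
have J1 : 'J (@moser R) z *m grad f1 (moser z) = 0.
  apply/row_matrixP => i; apply/rowP => j; rewrite ord1 row_mul rowE Jv grad_f1.
  by rewrite dmoser_orth1 mulr0 !mxE.
have J2 : 'J (@moser R) z *m grad f2 (moser z) = 0.
  apply/row_matrixP => i; apply/rowP => j; rewrite ord1 row_mul rowE Jv grad_f2.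
  by rewrite dmoser_orth2 !mxE.
move: (moser z) x1 x0 A1 A2 J1 J2 => w x1 x0 A1 A2 J1 J2.
pose F : 'M[R]_(4 + 4, 1 + 1) := row_mx (grad f1 w) (grad f2 w).
pose xi := lsubmx w.
(* Rows dual to the gradients [(2 xi, 0)] of [f1] and [(eta, xi)] of [f2], by [|xi| = 1] and the
   orthogonality of [xi] and [eta]. *)
pose N : 'M[R]_(1 + 1, 4 + 4) := col_mx (row_mx (2^-1 *: xi) 0) (row_mx 0 xi).
have m11 (M : 'M[R]_1) a : M 0 0 = a -> M = a%:M.
  by move=> <-; exact: mx11_scalar.
apply: (@char_poly_quotient _ (3 + 3) (1 + 1) _ _ ('J (@moser R) z) L F N) => //.
- by rewrite mul_mx_row J1 J2 row_mx0.
- rewrite mul_col_row.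
  rewrite (m11 (row_mx (2^-1 *: xi) 0 *m grad f1 w) 1); last first.
    by rewrite grad_f1 row_mxKl dotvZr x1; field.
  rewrite (m11 (row_mx (2^-1 *: xi) 0 *m grad f2 w) 0); last first.
    by rewrite grad_f2 row_mxKl row_mxKr dotvZl x0 dotv0; ring.
  rewrite (m11 (row_mx 0 xi *m grad f1 w) 0); last first.
    by rewrite grad_f1 row_mxKl dotv0 mulr0.
  rewrite (m11 (row_mx 0 xi *m grad f2 w) 1); last first.
    by rewrite grad_f2 row_mxKl row_mxKr dot0v add0r.
  by rewrite raddf0 -scalar_mx_block.
- by rewrite mul_mx_row A1 A2.
Qed.

Variables (gamma : R -> 'rV[R]_(3 + 3)) (T : R) (tm : R -> R) (T' : R).
Hypothesis gsol : forall t, is_solution_at X1 U1 gamma t.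
Hypothesis gc : forall t, H (gamma t) = c.
Hypothesis T0 : 0 < T.
Hypothesis gT : gamma T = gamma 0.
Hypothesis tm0 : tm 0 = 0.
Hypothesis tmT : tm T' = T.
Hypothesis tmd : forall tau : R, is_derive tau 1 tm (enorm (lsubmx (gamma (tm tau)))).

Local Notation zeta := (fun tau => gamma (tm tau)).

Lemma reparam_solution tau : is_solution_at Y U1 zeta tau.
Proof.
have [Ug gd] := gsol (tm tau); split => //.
by rewrite (pullback_field_level g0 Do VC Ug (gc _)); exact: is_derive_reparam gd (tmd tau).
Qed.

Lemma time_change_mono a b : a <= b -> tm a <= tm b.
Proof.
move=> ab; have [x _ E] := mean_value ab (fun t (_ : a <= t <= b) => tmd t).
by rewrite -subr_ge0 E mulr_ge0 ?subr_ge0// sqrtr_ge0.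
Qed.

(** The sign of [T'] is not part of [regularized_orbit]; it follows because [tm] is monotone and
    takes the values [0] at 0 and [T > 0] at [T']. *)
Lemma regularized_period_gt0 : 0 < T'.
Proof. by rewrite ltNge; apply/negP => /time_change_mono; rewrite tm0 tmT leNgt T0. Qed.

Lemma char_poly_reparam :
  char_poly ('J (flow X1 U1 T) (gamma 0)) = char_poly ('J (flow Y U1 T') (gamma 0)).
Proof.
have Tp := ltW T0; have T'p := ltW regularized_period_gt0.
have X1C := ham_field_C1 g Do VC; have YC := pullback_field_C1 g c Do VC.
have HC1 : Ck 1 U1 H by exact: CkW (Ck_Ham g Do VC).
have QC1 : Ck 1 U1 (Q \o @moser R) by exact: CkW (Ck_Qreg_moser g c Do VC).
have [U0 _] := gsol 0.
have r0 : radius (gamma 0) != 0 by rewrite gt_eqF// (radius_gt0 U0).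
have zs t : 0 <= t <= T' -> is_solution_at Y U1 zeta t by move=> _; exact: reparam_solution.
have gs s (t : R) (_ : 0 <= t <= s) := gsol t.
have Yz : Y (gamma 0) = radius (gamma 0) *: X1 (gamma 0) by rewrite (pullback_field_level g0 Do VC).
have gQ : grad (Q \o @moser R) (gamma 0) = radius (gamma 0) *: grad H (gamma 0).
  by rewrite (grad_Qreg_moser c g0 Do VC)// gc subrr mulr0 add0r divff// scale1r scale0r addr0.
have eA : X1 (gamma 0) *m 'J (flow X1 U1 T) (gamma 0) = X1 (gamma 0).
  by have := flow_field X1C Tp (gs T); rewrite gT.
have eB : X1 (gamma 0) *m 'J (flow Y U1 T') (gamma 0) = X1 (gamma 0).
  apply: (scalerI r0); rewrite scalemxAl -Yz.
  by have := flow_field YC T'p zs; rewrite /= tmT gT tm0.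
have hA t : 0 <= t -> 'J (flow X1 U1 t) (gamma 0) *m grad H (gamma t) = grad H (gamma 0).
  move=> t0; have := conserved_grad X1C HC1 _ t0 (gs t); apply => y _.
  exact: grad_ham_field.
(* On the level the gradient of [Qreg \o moser] is [|q|] times that of [H], so the first integral of
   [Y] yields that [dH] is fixed. *)
have hB : 'J (flow Y U1 T') (gamma 0) *m grad H (gamma 0) = grad H (gamma 0).
  apply: (scalerI r0); rewrite scalemxAr -gQ.
  have := conserved_grad YC QC1 _ T'p zs; rewrite /= tmT gT tm0; apply => y _.
  exact: grad_ham_field.
have [FAd FA] := flow_diff X1C Tp (gs T).
have [FBd FB] := flow_diff YC T'p zs.
have hAT : 'J (flow X1 U1 T) (gamma 0) *m grad H (gamma 0) = grad H (gamma 0).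
  by have := hA T Tp; rewrite gT.
apply: (char_poly_flag eA eB hAT hB).
- by apply/rowP => i; rewrite ord1 grad_ham_field mxE.
- move=> /colP h0; rewrite /ham_field; apply/rowP => i; rewrite mxE.
  case: splitP => j _; rewrite !mxE.
    by have := h0 (rshift 3 j); rewrite !mxE delta_mx_rshift.
  by have := h0 (lshift 3 j); rewrite !mxE delta_mx_lshift => ->; rewrite oppr0.
move=> v vh.
have [w w0 wd] := linear_solution X1C Tp (gs T) v.
have wd' (t : R) : 0 <= t <= T -> is_derive t 1 w (w t *m jac X1 (gamma t)).
  by move=> tT; have := wd t; rewrite clamp_id.
have wA t : 0 <= t <= T -> w t = v *m 'J (flow X1 U1 t) (gamma 0).
  move=> /andP[t0 tT]; have [_ FE] := flow_diff X1C t0 (gs t).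
  have wt (s : R) : 0 <= s <= t -> is_derive s 1 w (w s *m jac X1 (gamma s)).
    by move=> /andP[s0 st]; apply: wd'; rewrite s0 (le_trans st).
  by have := FE w wt; rewrite w0 diff_jacobian.
(* Tangency is propagated by differentiating [H (flow t z) = H z], which
   avoids the symmetry of the Hessian of [H]. *)
have wH t : 0 <= t <= T -> w t *m grad H (gamma t) = 0.
  move=> tT; rewrite (wA t tT) -mulmxA; case/andP: tT => t0 _.
  by rewrite (hA t t0).
(* By [jac_pullback_field_level] the variational equation of [Y] has the additional term
   [(w grad |q|) X_H], which equals [f] times [Y] on the orbit. *)
pose f tau := (w (tm tau) *m grad (@radius R) (zeta tau)) 0 0 / radius (zeta tau).
have zc tau : {for tau, continuous zeta}.
  by have [_ zd] := reparam_solution tau; exact: is_derive_continuous zd.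
have Ug tau : U1 (zeta tau) by have [] := gsol (tm tau).
(* [is_derive_primitive] wants continuity on the whole line; [w] and [zeta] are defined there, [w]
   thanks to the clamped time in its equation. *)
have fc : continuous f.
  move=> tau.
  have numc : {for tau, continuous (fun x => (w (tm x) *m grad (@radius R) (zeta x)) 0 0)}.
    rewrite (_ : (fun x => _) = fun x => \sum_i w (tm x) 0 i * 'D_(delta_mx 0 i) (@radius R) (zeta x)); last first.
      by apply/funext => x; rewrite mxE; apply: eq_bigr => i _; rewrite mxE.
    apply: continuous_sum => i.
    have wc : {for tau, continuous (fun x => w (tm x) 0 i)}.
      apply: (@continuous_comp _ _ _ tm (fun s => w s 0 i)).
        exact: is_derive_continuous (tmd tau).
      by have /continuous_rowP := is_derive_continuous (wd (tm tau)).
    have dc : {for tau, continuous (fun x => 'D_(delta_mx 0 i) (@radius R) (zeta x))}.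
      apply: (@continuous_comp _ _ _ zeta (fun y => 'D_(delta_mx 0 i) (@radius R) y)).
        exact: zc.
      exact: Ck_continuous (Ck_partial i (Ham_dom_open Do) (Ck_radius D 1)).2 (Ug tau).
    exact: continuousM wc dc.
  have rc : {for tau, continuous (fun x => radius (zeta x))}.
    apply: (@continuous_comp _ _ _ zeta (@radius R)); first exact: zc.
    exact: Ck_continuous (Ck_radius D 0) (Ug tau).
  have rn0 : radius (zeta tau) != 0 by rewrite gt_eqF// (radius_gt0 (Ug tau)).
  have rVc : {for tau, continuous (fun x => (radius (zeta x))^-1)} by exact: continuousV.
  have fE : {for tau, continuous ((fun x => (w (tm x) *m grad (@radius R) (zeta x)) 0 0) \* (fun x => (radius (zeta x))^-1))}.
    exact: (continuousM numc rVc).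
  exact: fE.
(* Since [Y = |q| X1] on the orbit, [kappa] corrects the reparametrised
   solution [w] of the variational equation of [X1] into one for [Y]. *)
pose kappa := primitive f.
have kd (tau : R) : is_derive tau 1 kappa (f tau) by exact: is_derive_primitive.
pose wh tau := w (tm tau) + kappa tau *: Y (zeta tau).
have whd (tau : R) : 0 <= tau <= T' -> is_derive tau 1 wh (wh tau *m jac Y (zeta tau)).
  move=> /andP[t0 tT].
  have tT' : 0 <= tm tau <= T by rewrite -[X in X <= _]tm0 -tmT !time_change_mono.
  have d1 := is_derive_reparam (wd' _ tT') (tmd tau).
  have d2 := is_derive_scale (kd tau) (field_along_solution YC (reparam_solution tau)).
  have := is_deriveD d1 d2; congr (is_derive _ _ _ _).
  have rn0 : radius (zeta tau) != 0 by rewrite gt_eqF// (radius_gt0 (Ug tau)).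
  exact: variation_combine (jac_pullback_field_level g0 Do VC (Ug tau) (gc _) (wH _ tT'))
    (pullback_field_level g0 Do VC (Ug tau) (gc _)) rn0.
exists (kappa T' * radius (gamma 0)).
have TT : 0 <= T <= T by rewrite Tp lexx.
have E := etrans (esym (diff_jacobian _ _ _)) (FB wh whd).
have wh0 : wh 0 = v by rewrite /wh tm0 w0 /kappa primitive0 scale0r addr0.
have whT : wh T' = w T + (kappa T' * radius (gamma 0)) *: X1 (gamma 0).
  have gz : gamma (tm T') = gamma 0 by rewrite tmT.
  by rewrite /wh gz tmT Yz; congr (_ + _); exact: scalerA.
rewrite wh0 tm0 in E.
exact: row_difference (etrans E whT) (wA T TT).
Qed.

End Multipliers.

Theorem lemma8 (R : realType) (g c : R) (D : set 'rV[R]_3) (V : 'rV[R]_3 -> R)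
    (gamma : R -> 'rV[R]_(3 + 3)) (T : R)
    (gamma' : R -> 'rV[R]_(4 + 4)) (T' : R)
    (l1 l2 l3 l4 : R[i]) :
  g != 0 -> open D -> D 0 -> real_analytic_on D V ->
  periodic_orbit (ham_field (Ham g V)) (Ham_dom D) gamma T ->
  (forall t, Ham g V (gamma t) = c) ->
  floquet_multipliers (ham_field (Ham g V)) (Ham_dom D) (gamma 0) T
    [:: 1; 1; l1; l2; l3; l4] ->
  regularized_orbit gamma T gamma' T' ->
  periodic_orbit (constrained_field (Qreg g c V)) (Qreg_dom D) gamma' T' /\
  floquet_multipliers (constrained_field (Qreg g c V)) (Qreg_dom D) (gamma' 0) T'
    [:: 1; 1; 1; 1; l1; l2; l3; l4].
Proof.
move=> g0 Do _ Va [T0 gsol gper gnc] gc [_ mult] [tm [tm0 tmT tmd gE]].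
have VC : Ck 2 D V by exact: real_analytic_Ck.
have gT : gamma T = gamma 0 by rewrite -[T]add0r gper.
have zsol := reparam_solution g0 Do VC gsol gc tmd.
have {gE} -> : gamma' = fun tau => moser (gamma (tm tau)) by exact/funext.
have msol tau := solution_moser Do VC (zsol tau).
have T'0 := regularized_period_gt0 T0 tm0 tmT tmd.
have X2C := constrained_field_C1 g c Do VC.
split.
  split => //.
    (* The shifted curve solves the same equation and agrees with the original one at 0, because
       [tm T' = T] is a period of [gamma]. *)
    move=> tau; pose sh s := moser (gamma (tm (s + T'))).
    have shs s : is_solution_at (constrained_field (Qreg g c V)) (Qreg_dom D) sh s.
      have [Us sd] := msol (s + T'); split; first exact: Us.
      have d : is_derive s 1 (fun s : R => s + T') 1.
        by have := is_deriveD (is_derive_id s 1) (is_derive_cst T' s 1); rewrite addr0.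
      have := @is_derive_reparam _ _ (fun s => moser (gamma (tm s))) (fun s => s + T') s _ _ sd d.
      by rewrite scale1r.
    have sh0 : sh 0 = moser (gamma (tm 0)) by rewrite /sh add0r tmT tm0 gT.
    exact: (solution_unique_line X2C shs msol sh0 tau).
  (* A constant image would make [gamma] constant along [tm], hence a zero of [Y] and of [X_H] at
     [gamma 0]; then uniqueness makes [gamma] itself constant. In this way surjectivity of [tm] is
     not called for. *)
  apply: contrapT => /forallNP H.
  have zE tau : gamma (tm tau) = gamma 0.
    apply: moser_inj; apply/eqP/negPn/negP; rewrite -[in gamma 0]tm0; exact: H.
  have X10 : ham_field (Ham g V) (gamma 0) = 0.
    have [U0 _] := gsol 0.
    have [_ [_]] := zsol 0; rewrite (funext zE) derive_cst tm0.
    rewrite (pullback_field_level g0 Do VC U0 (gc 0)) => /esym/eqP.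
    by rewrite scaler_eq0 gt_eqF ?(radius_gt0 U0)//= => /eqP.
  have [t /eqP] := gnc; apply.
  have csol s : is_solution_at (ham_field (Ham g V)) (Ham_dom D) (fun=> gamma 0) s.
    by have [U0 _] := gsol 0; split; [exact: U0|rewrite X10; exact: is_derive_cst].
  exact: (solution_unique_line (ham_field_C1 g Do VC) gsol csol erefl t).
have [Fd _] := flow_diff X2C (ltW T'0) (fun t _ => msol t).
split; first exact: Fd.
have E := @char_poly_moser _ g c _ _ Do VC _ _ (ltW T'0) _ (fun t _ => zsol t).
have {}E := E (etrans (congr1 gamma tmT) (etrans gT (congr1 gamma (esym tm0)))).
have E2 := char_poly_reparam g0 Do VC gsol gc T0 gT tm0 tmT tmd.
rewrite E /= tm0 -E2 rmorphM/= mult rmorphXn rmorphB/= map_polyX rmorph1.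
by rewrite !big_cons big_nil polyC1; ring.
Qed.
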